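(* For integers $\varepsilon\in\{0,1\}$, $\alpha,\beta\ge0$, write $f=\varphi^\varepsilon\theta_3^\alpha\Delta_8^\beta=\sum_{m\ge0}a_mq^m$ and $\mathrm{Sh}f=\sum_{m\in\alpha/4+2\mathbb N}b_mq^m$. In what follows $a,b$ denote nonnegative integers (in the ''unless'' statements, arbitrary integers), and ''$m=\dots$'' means: the coefficient with index $m$ vanishes whenever $m$ is of that form (and lies in the index set). (a) For $f=(\theta_3^4\Delta_8)^k$: $a_m=0$ whenever $m-k$ is odd. For $\mathrm{Sh}\bigl((\theta_3^{16}\Delta_8)^k\bigr)$: $b_m=0$ whenever $m\equiv2\pmod4$. (b) $\theta_3$: $a_m=0$ unless $m$ is a perfect square; $\mathrm{Sh}(\theta_3)$: $b_m=0$ unless $m=a^2/4$; $\theta_3^2$: $a_m=0$ unless $m=a^2+b^2$; $\mathrm{Sh}(\theta_3^2)$: $b_m=0$ unless $m=(a^2+b^2)/4$; $\theta_3^3$: $a_m=0$ for $m=4^a(8b+7)$; $\varphi\theta_3^{12}$: $a_1=0$. (c) $\theta_3\Delta_8$: $a_m=0$ for $m=4^a(8b+5)$; $\theta_3^2\Delta_8$: $a_m=0$ unless $m=a^2+b^2$; $\mathrm{Sh}(\theta_3^2\Delta_8)$: $b_m=0$ unless $m=(a^2+b^2)/4$; $\theta_3^3\Delta_8$: $a_m=0$ for $m=4^a(8b+7)$; $\theta_3^7\Delta_8$: $a_m=0$ for $m=4^a(8b+3)$; $\varphi\theta_3^3\Delta_8$: $a_m=0$ for $m=4^a(8b+7)$;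 $\varphi\theta_3^{16}\Delta_8$: $a_m=0$ for $m=2\cdot4^a$; $\mathrm{Sh}(\varphi\theta_3^{16}\Delta_8)$: $b_m=0$ for $m=2\cdot4^a$; $\mathrm{Sh}(\varphi\theta_3^{40}\Delta_8)$: $b_{24}=0$. (d) $\theta_3^5\Delta_8^2$: $a_m=0$ for $m=4^a(8b+1)$; $\theta_3^{12}\Delta_8^2$: $a_m=0$ for $m=4^a$; $\varphi\theta_3^8\Delta_8^2$: $a_m=0$ for $m=4^a$; $\mathrm{Sh}(\varphi\theta_3^8\Delta_8^2)$: $b_m=0$ for $m=4^a$; $\varphi\theta_3^{20}\Delta_8^2$: $a_3=0$; $\varphi\theta_3^{33}\Delta_8^2$: $a_4=0$; $\mathrm{Sh}(\varphi\theta_3^{33}\Delta_8^2)$: $b_{49/4}=0$. (e) $\theta_3^4\Delta_8^3$: $a_m=0$ for $m=2\cdot4^a$; $\varphi\theta_3^{24}\Delta_8^3$: $a_m=0$ for $m=2^a$; $\mathrm{Sh}(\varphi\theta_3^{24}\Delta_8^3)$: $b_m=0$ for $m=2^a$.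
   Context: For $z$ in the upper half-plane $\mathbb H$ let $q^m=e^{i\pi zm}$. Define $\theta_2=\sum_{m\in\mathbb Z+1/2}q^{m^2}$, $\theta_3=\sum_{m\in\mathbb Z}q^{m^2}$, $\theta_4=\sum_{m\in\mathbb Z}(-q)^{m^2}$, $\Delta_8=\tfrac1{16}\theta_2^4\theta_4^4$, $\varphi=\theta_4^4-\theta_2^4$. A function $f=\varphi^\varepsilon\theta_3^\alpha\Delta_8^\beta$ has weight $\omega=2\varepsilon+\alpha/2+4\beta$, and its shadow is $(\mathrm{Sh}f)(z)=(i/z)^\omega f(1-1/z)$, using the principal branch of the power (note $|\arg(i/z)|<\pi/2$). The shadow is multiplicative; e.g. $\mathrm{Sh}\theta_3=\theta_2$, $\mathrm{Sh}\Delta_8=-\tfrac1{16}+q^2-7q^4+\cdots$, $\mathrm{Sh}\varphi=2+48q^2+\cdots$, and $\mathrm{Sh}f$ has a Fourier expansion in powers $q^m$, $m\in\alpha/4+2\mathbb N$. *)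

(* Defs.v *)
From Stdlib Require Import Reals.
From Coquelicot Require Import Coquelicot.
Open Scope R_scope.

Definition Cexp (w : C) : C :=
  (exp (Re w) * cos (Im w), exp (Re w) * sin (Im w)).

(* principal argument, with values in (-PI, PI] (atan2) *)
Definition Carg (w : C) : R :=
  let x := Re w in let y := Im w in
  match Rlt_dec 0 x with
  | left _ => atan (y / x)
  | right _ =>
    match Rlt_dec x 0 with
    | left _ => match Rle_dec 0 y with
                | left _ => atan (y / x) + PI
                | right _ => atan (y / x) - PI
                end
    | right _ => match Rlt_dec 0 y with
                 | left _ => PI / 2
                 | right _ => match Rlt_dec y 0 with
                              | left _ => - (PI / 2)
                              | right _ => 0
                              end
                 end
    end
  end.

Definition Clog (w : C) : C := (ln (Cmod w), Carg w).
Definition Cpowr (w : C) (s : R) : C := Cexp (RtoC s * Clog w)%C.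

Definition CSeries (u : nat -> C) : C :=
  (Series (fun n => Re (u n)), Series (fun n => Im (u n))).

Definition ZSum (g : Z -> C) : C :=
  (g 0%Z + CSeries (fun n => g (Z.of_nat (S n)) + g (- Z.of_nat (S n))%Z))%C.

Definition qpow (z : C) (m : R) : C := Cexp (Ci * RtoC PI * z * RtoC m)%C.

Definition theta2 (z : C) : C := ZSum (fun n => qpow z ((IZR n + /2) ^ 2)).
Definition theta3 (z : C) : C := ZSum (fun n => qpow z (IZR n ^ 2)).
(* theta_4 = sum_{m in Z} (-q)^{m^2} = sum (-1)^{m^2} q^{m^2} *)
Definition theta4 (z : C) : C :=
  ZSum (fun n => (RtoC ((-1) ^ Z.to_nat (n * n)) * qpow z (IZR n ^ 2))%C).

Definition Delta8 (z : C) : C :=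
  (RtoC (/16) * Cpow (theta2 z) 4 * Cpow (theta4 z) 4)%C.
Definition phi (z : C) : C := (Cpow (theta4 z) 4 - Cpow (theta2 z) 4)%C.

Definition form (eps alpha beta : nat) (z : C) : C :=
  (Cpow (phi z) eps * Cpow (theta3 z) alpha * Cpow (Delta8 z) beta)%C.

Definition weight (eps alpha beta : nat) : R :=
  2 * INR eps + INR alpha / 2 + 4 * INR beta.

Definition shadow (eps alpha beta : nat) (z : C) : C :=
  (Cpowr (Ci / z) (weight eps alpha beta) * form eps alpha beta (1 - / z))%C.

Definition q_expansion (g : C -> C) (c d : R) (a : nat -> C) : Prop :=
  forall z : C, 0 < Im z ->
    @is_series C_AbsRing C_NormedModule
      (fun n => (a n * qpow z (c + d * INR n))%C) (g z).

Definition coeffs_vanish (g : C -> C) (c d : R) (P : R -> Prop) : Prop :=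
  exists a : nat -> C, q_expansion g c d a /\
    forall n : nat, P (c + d * INR n) -> a n = 0%C.

Definition f_vanish (eps alpha beta : nat) (P : R -> Prop) : Prop :=
  coeffs_vanish (form eps alpha beta) 0 1 P.

Definition sh_vanish (eps alpha beta : nat) (P : R -> Prop) : Prop :=
  coeffs_vanish (shadow eps alpha beta) (INR alpha / 4) 2 P.

Definition form_4a_8b (r : nat) (m : R) : Prop :=
  exists a b : nat, m = INR (4 ^ a * (8 * b + r)).
Definition is_sq (m : R) : Prop := exists a : Z, m = IZR a ^ 2.
Definition is_sq_4 (m : R) : Prop := exists a : Z, m = IZR a ^ 2 / 4.
Definition is_sum2sq (m : R) : Prop := exists a b : Z, m = IZR a ^ 2 + IZR b ^ 2.
Definition is_sum2sq_4 (m : R) : Prop :=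
  exists a b : Z, m = (IZR a ^ 2 + IZR b ^ 2) / 4.
Definition is_2_4a (m : R) : Prop := exists a : nat, m = INR (2 * 4 ^ a).
Definition is_4a (m : R) : Prop := exists a : nat, m = INR (4 ^ a).
Definition is_2a (m : R) : Prop := exists a : nat, m = INR (2 ^ a).

(* Main.v *)
Require Import Defs.
From Stdlib Require Import Reals ZArith NArith Lia Lra List FunctionalExtensionality Ring.
From Coquelicot Require Import Coquelicot.
Import ListNotations.

(** Everything is expanded in t = q^(1/4). The dissections
    theta_3(q) = A + B, theta_4(q) = A - B, theta_2(q)^4 = 8 A B (A^2 + B^2) with
    A = theta_3(q^4), B = theta_2(q^4) write a form as a binary form in A and B whose
    monomials are sorted modulo 4 by the exponent of B. The exponents divisible by 4
    give again a form at q^4 (an eigenvector of U_4, up to one further step), which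
    reduces the families 4^a m to their first members; the other exponents are
    products supported on one class modulo 8. The form theta_3^2 Delta_8 is the theta
    series of Z^2 weighted by Re (a + i b)^4 / 4: this is a differential equation for
    theta_3, and such equations follow from their compatibility with q -> q^2, since
    an error term of minimal order n would also have order 2 n.

    For the shadows, theta_3(-1/z) = (z/i)^(1/2) theta_3(z) is proved by Poisson
    summation with Fejer kernels. The Gaussian integrals of complex parameter are
    carried to the real one by a linear homotopy of affine maps y = a x + b, along
    which the form exp (- PI y^2) dy is closed; the real integral is normalised
    by the case z = i. The other two inversions follow from the dissections. *)

(** The definitions are analytic: [coeffs_vanish] asks for an expansion valid at every z, and
    [shadow] contains a principal power. The vanishing itself is arithmetic. In t = q^(1/4) all
    three theta series have integer coefficients and q^m is t^(4 m), so the arithmetic takes place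
    in [Fform] and [Fsh], and analysis enters through evaluation and inversion alone. Branches are
    handled by writing z = i a^2 with Re a > 0: then a = p + i q is the principal root of z / i, and
    real parameters p, q replace it. Since theta_2 enters phi and Delta_8 only through its fourth
    power, no eighth root of unity appears. The Fejer kernels are nonnegative; this reduces Poisson
    summation to a bound on a derivative and to Cesaro means. The eigenvalues of U_4 given in the
    applications have absolute value 2^(w - 3/2) for half-integral weight w and 2^(w - 2) for
    integral w; each one is checked by computation on coefficient lists. *)

Open Scope Z_scope.

(** * Formal power series over Z as a commutative ring *)

Definition fps := nat -> Z.

Fixpoint zsum (F : nat -> Z) (n : nat) : Z :=
  match n with O => F O | S m => zsum F m + F (S m) end.

Definition fadd (f g : fps) : fps := fun n => f n + g n.
Definition fopp (f : fps) : fps := fun n => - f n.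
Definition fsub (f g : fps) : fps := fun n => f n - g n.
Definition fmul (f g : fps) : fps := fun n => zsum (fun i => f i * g (n - i)%nat) n.
Definition fC (c : Z) : fps := fun n => match n with O => c | _ => 0 end.
Fixpoint fpow (f : fps) (k : nat) : fps :=
  match k with O => fC 1 | S k => fmul f (fpow f k) end.

Declare Scope fps_scope.
Delimit Scope fps_scope with fps.
Bind Scope fps_scope with fps.
Infix "+" := fadd : fps_scope.
Infix "-" := fsub : fps_scope.
Infix "*" := fmul : fps_scope.
Infix "^" := fpow : fps_scope.

Lemma zsum_ext F G n :
  (forall i, (i <= n)%nat -> F i = G i) -> zsum F n = zsum G n.
Proof.
  induction n as [|n IH]; simpl; intros H; [apply H; lia|].
  rewrite IH, H; [reflexivity| lia | intros; apply H; lia].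
Qed.

Lemma zsum_zero F n : (forall i, (i <= n)%nat -> F i = 0) -> zsum F n = 0.
Proof.
  induction n as [|n IH]; simpl; intros H; [apply H; lia|].
  rewrite IH, H; [reflexivity| lia | intros; apply H; lia].
Qed.

Lemma zsum_add F G n : zsum (fun i => F i + G i) n = zsum F n + zsum G n.
Proof. induction n; simpl; lia. Qed.

Lemma zsum_scal c F n : zsum (fun i => c * F i) n = c * zsum F n.
Proof. induction n as [|n IH]; simpl; [|rewrite IH]; ring. Qed.

Lemma zsum_scalr c F n : zsum (fun i => F i * c) n = zsum F n * c.
Proof. induction n as [|n IH]; simpl; [|rewrite IH]; ring. Qed.

Lemma zsum_recl F n : zsum F (S n) = F O + zsum (fun i => F (S i)) n.
Proof. induction n as [|n IH]; [reflexivity|]. simpl in *. rewrite IH. ring. Qed.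

Lemma zsum_rev F n : zsum F n = zsum (fun i => F (n - i)%nat) n.
Proof.
  induction n as [|n IH]; [reflexivity|].
  rewrite (zsum_recl (fun i => F (S n - i)%nat)). simpl. rewrite IH. ring.
Qed.

(** Both sides run over the pairs with sum at most n, by antidiagonals on the left and by rows on
    the right. This exchange is the associativity of [fmul]. *)
Lemma zsum_triangle (G : nat -> nat -> Z) n :
  zsum (fun i => zsum (fun j => G j (i - j)%nat) i) n =
  zsum (fun j => zsum (fun k => G j k) (n - j)) n.
Proof.
  induction n as [|n IH]; [reflexivity|].
  cbn [zsum]. rewrite IH.
  replace (S n - S n)%nat with O by lia. cbn [zsum].
  rewrite Z.add_assoc, <- zsum_add. f_equal.
  apply zsum_ext; intros j Hj.
  replace (S n - j)%nat with (S (n - j)) by lia. reflexivity.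
Qed.

Lemma zsum_single F n k : (k <= n)%nat ->
  (forall i, (i <= n)%nat -> i <> k -> F i = 0) -> zsum F n = F k.
Proof.
  induction n as [|n IH]; simpl; intros Hk H.
  - f_equal; lia.
  - destruct (Nat.eq_dec k (S n)) as [->|Hne].
    + rewrite zsum_zero; [ring|]. intros; apply H; lia.
    + rewrite IH, (H (S n)); [ring | lia | lia | lia |].
      intros; apply H; lia.
Qed.

Lemma fmul_comm f g : (f * g = g * f)%fps.
Proof.
  extensionality n; unfold fmul. rewrite zsum_rev. apply zsum_ext; intros i Hi.
  replace (n - (n - i))%nat with i by lia. ring.
Qed.

Lemma fmul_assoc f g h : (f * (g * h) = f * g * h)%fps.
Proof.
  extensionality n; unfold fmul.
  transitivity (zsum (fun j => zsum (fun k => f j * g k * h (n - j - k)%nat) (n - j)) n).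
  { apply zsum_ext; intros j _. rewrite <- zsum_scal.
    apply zsum_ext; intros; ring. }
  rewrite <- (zsum_triangle (fun j k => f j * g k * h (n - j - k)%nat)).
  apply zsum_ext; intros i Hi. rewrite <- zsum_scalr.
  apply zsum_ext; intros j Hj. do 2 f_equal. lia.
Qed.

Lemma fC_mul c f n : (fC c * f)%fps n = c * f n.
Proof.
  unfold fmul. rewrite (zsum_single _ n 0); [simpl; do 2 f_equal; lia | lia |].
  intros i _ Hi. destruct i; [lia|]. reflexivity.
Qed.

Lemma fps_ring_theory : ring_theory (fC 0) (fC 1) fadd fmul fsub fopp eq.
Proof.
  constructor; intros; try (extensionality n; unfold fadd, fsub, fopp; ring).
  - extensionality n; unfold fadd, fC; destruct n; ring.
  - extensionality n; rewrite fC_mul; ring.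
  - apply fmul_comm.
  - apply fmul_assoc.
  - extensionality n; unfold fmul, fadd. rewrite <- zsum_add.
    apply zsum_ext; intros; ring.
  - extensionality n; unfold fadd, fopp, fC; destruct n; ring.
Qed.

Lemma fps_morph :
  ring_morph (fC 0) (fC 1) fadd fmul fsub fopp eq
             0 1 Z.add Z.mul Z.sub Z.opp Z.eqb fC.
Proof.
  constructor; try reflexivity; intros; try (extensionality n).
  - unfold fadd, fC; destruct n; ring.
  - unfold fsub, fC; destruct n; ring.
  - rewrite fC_mul. unfold fC; destruct n; ring.
  - unfold fopp, fC; destruct n; ring.
  - f_equal. now apply Z.eqb_eq.
Qed.

Lemma fps_power : power_theory (fC 1) fmul eq N.to_nat fpow.
Proof.
  constructor; intros r n. rewrite <- (N2Nat.id n) at 2.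
  induction (N.to_nat n) as [|k IH]; [reflexivity|].
  simpl. rewrite IH. clear IH.
  destruct k as [|k].
  - simpl. rewrite fmul_comm. extensionality m. rewrite fC_mul. ring.
  - simpl. generalize (Pos.of_succ_nat k); intro p.
    rewrite pow_pos_succ; [reflexivity | apply RelationClasses.eq_equivalence
      | repeat intro; congruence | apply fmul_assoc].
Qed.

Ltac fps_cst t :=
  match t with
  | fC ?z => match isZcst z with true => z | _ => constr:(NotConstant) end
  | _ => constr:(NotConstant)
  end.
Ltac fps_powcst t :=
  match isnatcst t with true => constr:(N.of_nat t) | _ => constr:(NotConstant) end.

Add Ring fps_ring : fps_ring_theory
  (morphism fps_morph, constants [fps_cst], power_tac fps_power [fps_powcst]).

Lemma fpow_mul f g k : ((f * g) ^ k = f ^ k * g ^ k)%fps.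
Proof. induction k as [|k IH]; simpl; [|rewrite IH]; ring. Qed.

Lemma fpow_add f k l : (f ^ (k + l) = f ^ k * f ^ l)%fps.
Proof. induction k as [|k IH]; simpl; [|rewrite IH]; ring. Qed.

Lemma fpow_pow f k l : ((f ^ k) ^ l = f ^ (k * l))%fps.
Proof.
  induction l as [|l IH]; simpl; [now rewrite Nat.mul_0_r|].
  rewrite IH, <- fpow_add. f_equal. lia.
Qed.

(** * Dilation, derivation and supports *)

Definition dil (d : nat) (f : fps) : fps :=
  fun n => if (n mod d =? 0)%nat then f (n / d)%nat else 0.

Lemma dil_at d f n : d <> O -> dil d f (d * n)%nat = f n.
Proof.
  intros Hd; unfold dil. rewrite Nat.mul_comm, Nat.Div0.mod_mul, Nat.div_mul by easy.
  reflexivity.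
Qed.

Lemma dil_off d f n : (n mod d <> 0)%nat -> dil d f n = 0.
Proof. intros H; unfold dil. now rewrite (proj2 (Nat.eqb_neq _ _) H). Qed.

Lemma dil_cases d n : d <> O -> (exists m, n = d * m)%nat \/ (n mod d <> 0)%nat.
Proof.
  intros Hd. destruct (Nat.eq_dec (n mod d) 0) as [H|H]; [left|now right].
  exists (n / d)%nat. pose proof (Nat.div_mod n d Hd). lia.
Qed.

Lemma dil_inj d f g : d <> O -> dil d f = dil d g -> f = g.
Proof.
  intros Hd H. extensionality n. now rewrite <- (dil_at d f), <- (dil_at d g), H.
Qed.

Lemma dil_add d f g : dil d (f + g)%fps = (dil d f + dil d g)%fps.
Proof. extensionality n; unfold dil, fadd. now destruct (_ =? _)%nat. Qed.

Lemma dil_sub d f g : dil d (f - g)%fps = (dil d f - dil d g)%fps.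
Proof. extensionality n; unfold dil, fsub. now destruct (_ =? _)%nat. Qed.

Lemma dil_C d c : d <> O -> dil d (fC c) = fC c.
Proof.
  intros Hd. extensionality n.
  destruct (dil_cases d n Hd) as [[m ->]|H].
  - rewrite dil_at by easy. destruct m; [now rewrite Nat.mul_0_r|].
    destruct d; [easy|]. reflexivity.
  - rewrite dil_off by easy. destruct n; [|easy].
    rewrite Nat.Div0.mod_0_l in H. easy.
Qed.

(** Nothing is added strictly between two multiples of d; this makes dilation multiplicative. *)
Lemma zsum_dil d (H : nat -> Z) m : d <> O ->
  (forall i, (i mod d <> 0)%nat -> H i = 0) ->
  zsum H (d * m) = zsum (fun i => H (d * i)%nat) m.
Proof.
  intros Hd HH. induction m as [|m IH]; [now rewrite Nat.mul_0_r; simpl; rewrite Nat.mul_0_r|].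
  cbn [zsum]. rewrite <- IH.
  assert (G : forall k, (k < d)%nat -> zsum H (d * m + k) = zsum H (d * m)).
  { induction k as [|k IHk]; intros Hk; [now rewrite Nat.add_0_r|].
    rewrite Nat.add_succ_r. cbn [zsum]. rewrite IHk by lia. rewrite HH; [ring|].
    replace (S (d * m + k)) with (S k + m * d)%nat by lia.
    rewrite Nat.Div0.mod_add, Nat.mod_small by lia. lia. }
  replace (d * S m)%nat with (S (d * m + (d - 1))) by lia.
  cbn [zsum]. rewrite G by lia. reflexivity.
Qed.

Lemma dil_mul d f g : d <> O -> dil d (f * g)%fps = (dil d f * dil d g)%fps.
Proof.
  intros Hd. extensionality n. symmetry.
  destruct (dil_cases d n Hd) as [[m ->]|H].
  - rewrite dil_at by easy. unfold fmul. rewrite zsum_dil; [|easy|].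
    + apply zsum_ext; intros i Hi. rewrite dil_at by easy.
      rewrite <- Nat.mul_sub_distr_l.
      now rewrite dil_at.
    + intros i Hi. now rewrite dil_off.
  - rewrite dil_off by easy. apply zsum_zero; intros i Hi.
    destruct (dil_cases d i Hd) as [[k ->]|Hk]; [|rewrite dil_off; easy].
    rewrite (dil_off d g); [ring|]. intro E. apply H.
    replace n with ((n - d * k) + k * d)%nat by lia.
    now rewrite Nat.Div0.mod_add.
Qed.

Lemma dil_pow d f k : d <> O -> dil d (f ^ k)%fps = (dil d f ^ k)%fps.
Proof.
  intros Hd. induction k as [|k IH]; simpl; [now apply dil_C|].
  now rewrite dil_mul, IH.
Qed.

Lemma dil_dil d e f : d <> O -> e <> O -> dil d (dil e f) = dil (d * e) f.
Proof.
  intros Hd He. extensionality n.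
  destruct (dil_cases d n Hd) as [[m ->]|H].
  - rewrite dil_at by easy. destruct (dil_cases e m He) as [[k ->]|H].
    + rewrite dil_at, Nat.mul_assoc, dil_at; lia.
    + rewrite !dil_off; trivial. intro E. apply H.
      apply Nat.Lcm0.mod_divide in E. destruct E as [x Hx].
      replace m with (x * e)%nat by nia. apply Nat.Div0.mod_mul.
  - rewrite !dil_off; trivial. intro E. apply H.
    apply Nat.Lcm0.mod_divide in E. destruct E as [x Hx].
    replace n with (x * e * d)%nat by lia. apply Nat.Div0.mod_mul.
Qed.

(** The Euler operator t d/dt, a derivation that does not enlarge supports. *)
Definition fD (f : fps) : fps := fun n => Z.of_nat n * f n.

Lemma fD_add f g : fD (f + g)%fps = (fD f + fD g)%fps.
Proof. extensionality n; unfold fD, fadd; ring. Qed.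

Lemma fD_sub f g : fD (f - g)%fps = (fD f - fD g)%fps.
Proof. extensionality n; unfold fD, fsub; ring. Qed.

Lemma fD_C c : fD (fC c) = fC 0.
Proof. extensionality n; unfold fD, fC; destruct n; ring. Qed.

Lemma fD_mul f g : fD (f * g)%fps = (fD f * g + f * fD g)%fps.
Proof.
  extensionality n; unfold fD, fmul, fadd.
  rewrite <- zsum_add, <- zsum_scal. apply zsum_ext; intros i Hi.
  replace (Z.of_nat n) with (Z.of_nat i + Z.of_nat (n - i)) by lia. ring.
Qed.

Lemma fD_dil d f : d <> O -> fD (dil d f) = (fC (Z.of_nat d) * dil d (fD f))%fps.
Proof.
  intros Hd. extensionality n. rewrite fC_mul. unfold fD at 1.
  destruct (dil_cases d n Hd) as [[m ->]|H].
  - rewrite !dil_at by easy. unfold fD. rewrite Nat2Z.inj_mul. ring.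
  - rewrite !dil_off by easy. ring.
Qed.

(** The offset r is a lower bound and not only a residue modulo d. Offsets add in products, so the
    order of a power of theta_2 is recorded as well. *)
Definition supp (d r : nat) (f : fps) : Prop :=
  forall n, f n <> 0 -> exists k, n = (r + d * k)%nat.

Lemma supp_C d c : supp d 0 (fC c).
Proof. intros [|n] H; [exists O; lia|]. now destruct H. Qed.

Lemma zsum_neq0 F n : zsum F n <> 0 -> exists i, (i <= n)%nat /\ F i <> 0.
Proof.
  induction n as [|n IH]; simpl; intros H; [now exists O|].
  destruct (Z.eq_dec (F (S n)) 0) as [E|E]; [|now exists (S n)].
  destruct IH as [i [Hi H']]; [lia|]. exists i; auto.
Qed.

Lemma supp_mul d r s f g : supp d r f -> supp d s g -> supp d (r + s) (f * g)%fps.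
Proof.
  intros Hf Hg n H. apply zsum_neq0 in H. destruct H as [i [Hi H]].
  destruct (Hf i) as [k Hk]; [intro E; apply H; rewrite E; ring|].
  destruct (Hg (n - i)%nat) as [l Hl]; [intro E; apply H; rewrite E; ring|].
  exists (k + l)%nat. nia.
Qed.

Lemma supp_pow d r f k : supp d r f -> supp d (r * k) (f ^ k)%fps.
Proof.
  intros H; induction k as [|k IH]; [rewrite Nat.mul_0_r; apply supp_C|].
  rewrite Nat.mul_succ_r, Nat.add_comm. now apply supp_mul.
Qed.

Lemma supp_add d r f g : supp d r f -> supp d r g -> supp d r (f + g)%fps.
Proof.
  intros Hf Hg n H. destruct (Z.eq_dec (f n) 0) as [E|E]; [|now apply Hf].
  apply Hg. unfold fadd in H. lia.
Qed.

Lemma supp_sub d r f g : supp d r f -> supp d r g -> supp d r (f - g)%fps.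
Proof.
  intros Hf Hg n H. destruct (Z.eq_dec (f n) 0) as [E|E]; [|now apply Hf].
  apply Hg. unfold fsub in H. lia.
Qed.

Lemma supp_dil d e r f : e <> O -> supp d r f -> supp (e * d) (e * r) (dil e f).
Proof.
  intros He Hf n H. destruct (dil_cases e n He) as [[m ->]|E].
  - rewrite dil_at in H by easy. destruct (Hf m H) as [k ->]. exists k; lia.
  - now rewrite dil_off in H.
Qed.

Lemma supp_weaken d r d' r' j l f :
  d = (d' * j)%nat -> r = (r' + d' * l)%nat -> supp d r f -> supp d' r' f.
Proof.
  intros -> -> Hf n H. destruct (Hf n H) as [k ->]. exists (l + j * k)%nat. lia.
Qed.

Lemma supp_vanish d r f n :
  supp d r f -> ~ (exists k, n = (r + d * k)%nat) -> f n = 0.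
Proof. intros Hf H. destruct (Z.eq_dec (f n) 0); [easy|]. destruct H; auto. Qed.

(** * Theta series in the variable t = q^(1/4) *)

Fixpoint ZS (M : nat) (H : Z -> Z) : Z :=
  match M with
  | O => H 0
  | S m => ZS m H + (H (Z.of_nat (S m)) + H (- Z.of_nat (S m)))
  end.

Lemma ZS_ext M H G :
  (forall a, Z.abs a <= Z.of_nat M -> H a = G a) -> ZS M H = ZS M G.
Proof.
  induction M as [|M IH]; intros HG; cbn [ZS]; [apply HG; lia|].
  rewrite IH, !HG; [reflexivity | lia | lia |]. intros; apply HG; lia.
Qed.

Lemma ZS_zero M H : (forall a, Z.abs a <= Z.of_nat M -> H a = 0) -> ZS M H = 0.
Proof.
  induction M as [|M IH]; intros HG; cbn [ZS]; [apply HG; lia|].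
  rewrite IH, !HG; [reflexivity | lia | lia |]. intros; apply HG; lia.
Qed.

Lemma ZS_add M H G : ZS M (fun a => H a + G a) = ZS M H + ZS M G.
Proof. induction M as [|M IH]; cbn [ZS]; [|rewrite IH]; ring. Qed.

Lemma ZS_scal M c H : ZS M (fun a => c * H a) = c * ZS M H.
Proof. induction M as [|M IH]; cbn [ZS]; [|rewrite IH]; ring. Qed.

Lemma ZS_swap M M' (H : Z -> Z -> Z) :
  ZS M (fun a => ZS M' (H a)) = ZS M' (fun b => ZS M (fun a => H a b)).
Proof.
  induction M as [|M IH]; cbn [ZS]; [reflexivity|].
  now rewrite IH, !ZS_add.
Qed.

Lemma ZS_zsum M n (H : nat -> Z -> Z) :
  zsum (fun i => ZS M (H i)) n = ZS M (fun a => zsum (fun i => H i a) n).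
Proof. induction n as [|n IH]; cbn [zsum]; [reflexivity|]. now rewrite IH, ZS_add. Qed.

Lemma ZS_big K M H : (forall a, Z.of_nat K < Z.abs a -> H a = 0) ->
  (K <= M)%nat -> ZS M H = ZS K H.
Proof.
  intros HH HM. induction HM as [|M HM IH]; [reflexivity|].
  cbn [ZS]. rewrite IH, !HH by lia. ring.
Qed.

Lemma ZS_succ M H :
  ZS M (fun a => H (a + 1)) = ZS M H + H (Z.of_nat M + 1) - H (- Z.of_nat M).
Proof.
  induction M as [|M IH]; cbn [ZS]; [simpl; ring|].
  rewrite IH, Nat2Z.inj_succ. unfold Z.succ.
  replace (- (Z.of_nat M + 1) + 1) with (- Z.of_nat M) by ring. ring.
Qed.

Lemma ZS_shift K M H s : (forall a, Z.of_nat K < Z.abs a -> H a = 0) ->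
  Z.of_nat K + Z.abs s <= Z.of_nat M ->
  ZS M (fun a => H (a + s)) = ZS M H.
Proof.
  intros HH.
  assert (P : forall n : nat, Z.of_nat K + Z.of_nat n <= Z.of_nat M ->
     ZS M (fun a => H (a + Z.of_nat n)) = ZS M H).
  { induction n as [|n IH]; intros Hn.
    - apply ZS_ext; intros; f_equal; lia.
    - transitivity (ZS M (fun a => H (a + 1 + Z.of_nat n))).
      { apply ZS_ext; intros; f_equal; lia. }
      rewrite (ZS_succ M (fun a => H (a + Z.of_nat n))).
      rewrite IH, !HH by lia. ring. }
  assert (Q : forall n : nat, Z.of_nat K + Z.of_nat n <= Z.of_nat M ->
     ZS M (fun a => H (a - Z.of_nat n)) = ZS M H).
  { induction n as [|n IH]; intros Hn.
    - apply ZS_ext; intros; f_equal; lia.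
    - rewrite <- IH by lia.
      transitivity (ZS M (fun a => H (a + 1 - Z.of_nat (S n)))).
      2:{ apply ZS_ext; intros; f_equal; lia. }
      rewrite (ZS_succ M (fun a => H (a - Z.of_nat (S n)))).
      rewrite !HH by lia. ring. }
  intros Hs. destruct (Z.le_gt_cases 0 s).
  - rewrite <- (Z2Nat.id s) by lia. apply P; lia.
  - rewrite <- (Q (Z.to_nat (- s))) by lia.
    apply ZS_ext; intros; f_equal; lia.
Qed.

Lemma ZS_parity M H : (forall a, Z.of_nat M < Z.abs a -> H a = 0) ->
  ZS M H = ZS M (fun b => H (2 * b) + H (2 * b + 1)).
Proof.
  intros HH.
  rewrite <- (ZS_big M (2 * M) H) by (auto; lia).
  (* The numbers 2 b and 2 b + 1 with b in [-m, m] fill [-2 m, 2 m + 1], one more than a symmetric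
     window. *)
  enough (E : forall m, ZS (2 * m) H + H (2 * Z.of_nat m + 1)
            = ZS m (fun b => H (2 * b) + H (2 * b + 1))).
  { rewrite <- E, HH by lia. ring. }
  induction m as [|m IH]; [reflexivity|].
  replace (2 * S m)%nat with (S (S (2 * m))) by lia.
  cbn [ZS]. rewrite <- IH.
  replace (Z.of_nat (S (2 * m))) with (2 * Z.of_nat m + 1) by lia.
  replace (Z.of_nat (S (S (2 * m)))) with (2 * Z.of_nat (S m)) by lia.
  replace (2 * - Z.of_nat (S m) + 1) with (- (2 * Z.of_nat m + 1)) by lia.
  replace (2 * - Z.of_nat (S m)) with (- (2 * Z.of_nat (S m))) by lia. ring.
Qed.

Definition ind (b : bool) (w : Z) : Z := if b then w else 0.

(** The sum over all integers a of w a times t^(e a). The cut at n loses no term when [e] is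
    [proper], because e a = n then forces the absolute value of a to be at most n. *)
Definition thser (e w : Z -> Z) : fps :=
  fun n => ZS n (fun a => ind (e a =? Z.of_nat n) (w a)).

(** Exponents in t = q^(1/4): [e3] and [e2] are four times a^2 and (a + 1/2)^2. *)
Definition e3 (a : Z) : Z := 4 * a ^ 2.
Definition e2 (a : Z) : Z := (2 * a + 1) ^ 2.
Definition zone (a : Z) : Z := 1.
Definition zsgn (a : Z) : Z := if Z.even a then 1 else -1.

Definition th2 : fps := thser e2 zone.
Definition th3 : fps := thser e3 zone.
Definition th4 : fps := thser e3 zsgn.

Definition proper (e : Z -> Z) : Prop := forall a, Z.abs a <= e a.

Lemma proper_e3 : proper e3.
Proof. intro a; unfold e3. nia. Qed.
Lemma proper_e2 : proper e2.
Proof. intro a; unfold e2. nia. Qed.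

Lemma ind_eq0 x y w : x <> y -> ind (x =? y) w = 0.
Proof. intro H. unfold ind. now rewrite (proj2 (Z.eqb_neq x y) H). Qed.

Lemma ind_cong x y x' y' w w' : w = w' -> (x = y <-> x' = y') ->
  ind (x =? y) w = ind (x' =? y') w'.
Proof.
  intros -> H. unfold ind. now destruct (Z.eqb_spec x y), (Z.eqb_spec x' y'); tauto.
Qed.

Lemma thser_big e w n M : proper e -> (n <= M)%nat ->
  thser e w n = ZS M (fun a => ind (e a =? Z.of_nat n) (w a)).
Proof.
  intros He HM. symmetry. apply ZS_big; [|easy].
  intros a Ha. apply ind_eq0. specialize (He a). lia.
Qed.

Lemma thser_mul e w e' w' n M : proper e -> proper e' -> (n <= M)%nat ->
  (thser e w * thser e' w')%fps n =
  ZS M (fun a => ZS M (fun b => ind (e a + e' b =? Z.of_nat n) (w a * w' b))).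
Proof.
  intros He He' HM. unfold fmul.
  transitivity (zsum (fun i => ZS M (fun a => ZS M (fun b =>
     ind (e a =? Z.of_nat i) (w a) * ind (e' b =? Z.of_nat (n - i)) (w' b)))) n).
  { apply zsum_ext; intros i Hi.
    rewrite (thser_big e w i M), (thser_big e' w' (n - i) M) by (auto; lia).
    rewrite Z.mul_comm, <- ZS_scal. apply ZS_ext; intros a _.
    rewrite ZS_scal. ring. }
  rewrite ZS_zsum. apply ZS_ext; intros a _.
  rewrite ZS_zsum. apply ZS_ext; intros b _.
  pose proof (He a). pose proof (He' b).
  destruct (Z.eqb_spec (e a + e' b) (Z.of_nat n)) as [E|E].
  - rewrite (zsum_single _ n (Z.to_nat (e a))); [| lia |].
    + unfold ind. rewrite !(proj2 (Z.eqb_eq _ _)) by lia. reflexivity.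
    + intros i Hi Hne. rewrite (ind_eq0 (e a)); [ring|lia].
  - apply zsum_zero; intros i Hi.
    destruct (Z.eq_dec (e a) (Z.of_nat i)).
    + rewrite (ind_eq0 (e' b)); [ring|lia].
    + rewrite (ind_eq0 (e a)); [ring|lia].
Qed.

Lemma thser_neq0 e w n : thser e w n <> 0 -> exists a, e a = Z.of_nat n.
Proof.
  intro Hn.
  assert (P : forall M H, ZS M H <> 0 -> exists a, H a <> 0).
  { induction M as [|M IH]; cbn [ZS]; intros H HM; [now exists 0|].
    destruct (Z.eq_dec (ZS M H) 0) as [E|E]; [|now apply IH].
    destruct (Z.eq_dec (H (Z.of_nat (S M))) 0) as [E'|E'].
    - exists (- Z.of_nat (S M)). lia.
    - now exists (Z.of_nat (S M)). }
  destruct (P _ _ Hn) as [a Ha]. exists a.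
  unfold ind in Ha. destruct (Z.eqb_spec (e a) (Z.of_nat n)); easy.
Qed.

Lemma thser_supp e w d r : (forall a, exists k : nat, e a = Z.of_nat (r + d * k)) ->
  supp d r (thser e w).
Proof.
  intros He n Hn. destruct (thser_neq0 e w n Hn) as [a Ha].
  destruct (He a) as [k Hk]. exists k. lia.
Qed.

Lemma supp_e3 w : supp 4 0 (thser e3 w).
Proof.
  apply thser_supp. intro a. exists (Z.to_nat (a ^ 2)). unfold e3. nia.
Qed.

Lemma supp_th3 : supp 4 0 th3.
Proof. apply supp_e3. Qed.
Lemma supp_th4 : supp 4 0 th4.
Proof. apply supp_e3. Qed.
Lemma supp_th2 : supp 8 1 th2.
Proof.
  apply thser_supp. intro a. exists (Z.to_nat (a * (a + 1) / 2)).
  assert (E : exists k, a * (a + 1) = 2 * k).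
  { destruct (Z.Even_or_Odd a) as [[k ->]|[k ->]].
    - exists (k * (2 * k + 1)); ring.
    - exists ((2 * k + 1) * (k + 1)); ring. }
  destruct E as [k E]. unfold e2. rewrite E.
  replace (2 * k / 2) with k by (rewrite Z.mul_comm, Z.div_mul; lia).
  assert (0 <= k) by nia. nia.
Qed.

Lemma dil_eval d f g : d <> O -> supp d 0 f ->
  (forall m, f (d * m)%nat = g m) -> f = dil d g.
Proof.
  intros Hd Hf H. extensionality n. destruct (dil_cases d n Hd) as [[m ->]|E].
  - now rewrite dil_at.
  - rewrite dil_off by easy. apply (supp_vanish d 0); [easy|].
    intros [k ->]. apply E. simpl. rewrite Nat.mul_comm. apply Nat.Div0.mod_mul.
Qed.

(** Split by the parity of the index: 4 (2 b)^2 and 4 (2 b + 1)^2 are four times the exponents of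
    theta_3 and of theta_2. *)
Lemma e3_dissect w : (forall a, w (2 * a) = 1) ->
  forall s, (forall a, w (2 * a + 1) = s) ->
  thser e3 w = dil 4 (th3 + fC s * th2)%fps.
Proof.
  intros w0 s w1. apply dil_eval; [easy|apply supp_e3|]. intro m.
  unfold fadd. rewrite fC_mul. unfold th3, th2.
  rewrite (thser_big e3 _ m (4 * m)), (thser_big e2 _ m (4 * m))
    by (apply proper_e3 || apply proper_e2 || lia).
  unfold thser. rewrite ZS_parity.
  2:{ intros a Ha. apply ind_eq0. pose proof (proper_e3 a). lia. }
  rewrite ZS_add, <- ZS_scal. f_equal; apply ZS_ext; intros b _.
  - apply ind_cong; [apply w0|]. unfold e3. lia.
  - rewrite w1. unfold e3, e2, ind, zone.
    destruct (Z.eqb_spec ((2 * b + 1) ^ 2) (Z.of_nat m)) as [E|E].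
    + rewrite (proj2 (Z.eqb_eq _ _)) by lia. ring.
    + rewrite (proj2 (Z.eqb_neq _ _)) by lia. ring.
Qed.

Lemma th3_dissect : th3 = (dil 4 th3 + dil 4 th2)%fps.
Proof.
  rewrite <- dil_add. unfold th3 at 1. rewrite (e3_dissect _) with (s := 1); try easy.
  f_equal. ring.
Qed.

Lemma th4_dissect : th4 = (dil 4 th3 - dil 4 th2)%fps.
Proof.
  rewrite <- dil_sub. unfold th4 at 1. rewrite (e3_dissect _) with (s := -1).
  - f_equal. ring.
  - intro a. unfold zsgn. rewrite Z.even_mul. reflexivity.
  - intro a. unfold zsgn. rewrite Z.even_add, Z.even_mul. reflexivity.
Qed.

Lemma abs_le_sq a : Z.abs a <= a ^ 2.
Proof. nia. Qed.

(* The substitution (a, b) = (c + d, c - d), resp. (c + d + 1, c - d). *)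
Lemma th3_sqr : (th3 ^ 2 = dil 2 (th3 ^ 2 + th2 ^ 2))%fps.
Proof.
  apply dil_eval; [easy| |].
  { apply (supp_weaken 4 0 2 0 2 0); [reflexivity..|].
    apply (supp_pow 4 0 th3 2 supp_th3). }
  intro m. unfold fadd.
  replace (th3 ^ 2)%fps with (th3 * th3)%fps by ring.
  replace (th2 ^ 2)%fps with (th2 * th2)%fps by ring.
  pose (M := (4 * m + 1)%nat). unfold th3, th2.
  rewrite !(thser_mul _ _ _ _ _ M) by (apply proper_e3 || apply proper_e2 || lia).
  unfold e3, e2, zone.
  transitivity (ZS M (fun a => ZS M (fun u =>
     ind (u ^ 2 + (2 * a - u) ^ 2 =? Z.of_nat m) 1))).
  { apply ZS_ext; intros a _.
    destruct (Z.le_gt_cases (Z.abs a) (Z.of_nat m)) as [Ha|Ha].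
    - rewrite <- (ZS_shift m M (fun u => ind (u ^ 2 + (2 * a - u) ^ 2 =? Z.of_nat m) 1) a).
      + apply ZS_ext; intros b _. apply ind_cong; [reflexivity|]. lia.
      + intros u Hu. apply ind_eq0.
        pose proof (abs_le_sq u); pose proof (abs_le_sq (2 * a - u)); lia.
      + lia.
    - rewrite !ZS_zero; [reflexivity| |]; intros u _; apply ind_eq0;
        pose proof (abs_le_sq a); pose proof (abs_le_sq (a - u));
        pose proof (abs_le_sq u); lia. }
  rewrite ZS_swap, ZS_parity.
  2:{ intros u Hu. apply ZS_zero; intros b _; apply ind_eq0.
      pose proof (abs_le_sq u); pose proof (abs_le_sq (2 * b - u)); lia. }
  rewrite ZS_add.
  f_equal; apply ZS_ext; intros d _.
  - destruct (Z.le_gt_cases (Z.abs d) (Z.of_nat m)) as [Hd|Hd].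
    + rewrite <- (ZS_shift m M (fun b => ind (4 * d ^ 2 + 4 * b ^ 2 =? Z.of_nat m) (1 * 1)) (- d)); [| |lia].
      * apply ZS_ext; intros a _. apply ind_cong; [reflexivity|]. lia.
      * intros u Hu. apply ind_eq0.
        pose proof (abs_le_sq u); pose proof (abs_le_sq d);
        pose proof (abs_le_sq (2 * u + 1)); pose proof (abs_le_sq (2 * d + 1)); lia.
    + rewrite !ZS_zero; [reflexivity| |]; intros u _; apply ind_eq0.
      * pose proof (abs_le_sq d); pose proof (abs_le_sq u); lia.
      * pose proof (abs_le_sq (2 * d)); pose proof (abs_le_sq (2 * u - 2 * d)); lia.
  - destruct (Z.le_gt_cases (Z.abs d) (Z.of_nat m)) as [Hd|Hd].
    + rewrite <- (ZS_shift m M (fun b =>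
          ind ((2 * d + 1) ^ 2 + (2 * b + 1) ^ 2 =? Z.of_nat m) (1 * 1)) (- d - 1)).
      * apply ZS_ext; intros a _. apply ind_cong; [reflexivity|]. lia.
      * intros u Hu. apply ind_eq0.
        pose proof (abs_le_sq u); pose proof (abs_le_sq d);
        pose proof (abs_le_sq (2 * u + 1)); pose proof (abs_le_sq (2 * d + 1)); lia.
      * lia.
    + rewrite !ZS_zero; [reflexivity| |]; intros u _; apply ind_eq0.
      * pose proof (abs_le_sq (2 * d + 1)); pose proof (abs_le_sq (2 * u + 1)); lia.
      * pose proof (abs_le_sq (2 * d + 1));
        pose proof (abs_le_sq (2 * u - (2 * d + 1))); lia.
Qed.

Lemma th3_sqr' : (th3 ^ 2 = dil 2 th3 ^ 2 + dil 2 th2 ^ 2)%fps.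
Proof. now rewrite th3_sqr at 1; rewrite dil_add, !dil_pow. Qed.

Lemma dil2_th3_sqr : (dil 2 th3 ^ 2 = dil 4 th3 ^ 2 + dil 4 th2 ^ 2)%fps.
Proof.
  rewrite <- dil_pow by easy. rewrite th3_sqr at 1.
  now rewrite dil_dil, dil_add, !dil_pow by easy.
Qed.

(** For A + B and A - B the cross terms cancel in the sum of squares 2 (A^2 + B^2), and A^2 + B^2 is
    again [dil 2 th3 ^ 2]. Subtracting [th3 ^ 2] leaves the claim. *)
Lemma th4_sqr : (th4 ^ 2 = dil 2 th3 ^ 2 - dil 2 th2 ^ 2)%fps.
Proof.
  assert (E : (th3 ^ 2 + th4 ^ 2 = fC 2 * dil 2 th3 ^ 2)%fps).
  { rewrite th4_dissect, th3_dissect at 1. rewrite dil2_th3_sqr. ring. }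
  rewrite th3_sqr' in E.
  transitivity (dil 2 th3 ^ 2 + dil 2 th2 ^ 2 + th4 ^ 2 - dil 2 th3 ^ 2 - dil 2 th2 ^ 2)%fps;
    [ring|]. rewrite E. ring.
Qed.

Lemma fC2_cancel f g : (fC 2 * f = fC 2 * g)%fps -> f = g.
Proof.
  intro H. extensionality n. apply (f_equal (fun h => h n)) in H.
  rewrite !fC_mul in H. lia.
Qed.

(** The difference of the squares of theta_3 and theta_4 is computed twice: as 2 theta_2(q^2)^2 from
    their squares and as 4 A B from their dissections. The resulting identity is one in q^2, and
    dilation is injective. *)
Lemma th2_sqr : (th2 ^ 2 = fC 2 * dil 2 th2 * dil 2 th3)%fps.
Proof.
  apply (dil_inj 2); [easy|]. rewrite !dil_mul, dil_pow, dil_C, !dil_dil by easy.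
  change (2 * 2)%nat with 4%nat.
  apply fC2_cancel.
  transitivity (th3 ^ 2 - th4 ^ 2)%fps.
  - rewrite th3_sqr', th4_sqr. ring.
  - rewrite th4_dissect, th3_dissect at 1. ring.
Qed.

(** With X and Y for theta_3 and theta_2 at q^2 this is (X^2 - Y^2)^2 = (X^2 + Y^2)^2 - (2 X
    Y)^2. *)
Lemma jacobi_quartic : (th4 ^ 4 = th3 ^ 4 - th2 ^ 4)%fps.
Proof.
  transitivity ((th4 ^ 2) ^ 2)%fps; [ring|].
  transitivity ((th3 ^ 2) ^ 2 - (th2 ^ 2) ^ 2)%fps; [|ring].
  rewrite th4_sqr, th3_sqr', th2_sqr. ring.
Qed.

Lemma th3_th4 : (th3 * th4 = dil 2 th4 ^ 2)%fps.
Proof.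
  rewrite <- dil_pow, th4_sqr, dil_sub, !dil_pow, !dil_dil by easy.
  change (2 * 2)%nat with 4%nat.
  rewrite th4_dissect, th3_dissect at 1. ring.
Qed.

Lemma th2_quartic_dissect :
  (th2 ^ 4 = fC 8 * dil 4 th3 * dil 4 th2 * (dil 4 th3 ^ 2 + dil 4 th2 ^ 2))%fps.
Proof.
  transitivity ((th2 ^ 2) ^ 2)%fps; [ring|].
  rewrite th2_sqr.
  transitivity (fC 4 * dil 2 (th2 ^ 2) * dil 2 th3 ^ 2)%fps.
  - rewrite dil_pow by easy. ring.
  - rewrite th2_sqr, dil2_th3_sqr, !dil_mul, dil_C, !dil_dil by easy.
    change (2 * 2)%nat with 4%nat. ring.
Qed.

(** * Differential equations of the theta series *)

(* If [W] had order [n > r], the left side would have order [n + r] and the right one at least [2 n]. *)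
Lemma dil2_functional_eq (u v W : fps) (r : nat) :
  (forall i, (i < r)%nat -> u i = 0) -> u r <> 0 ->
  (u * W = v * dil 2 W)%fps -> (forall n, (n <= r)%nat -> W n = 0) -> W = fC 0.
Proof.
  intros u0 ur E W0. extensionality n. replace (fC 0 n) with 0 by (destruct n; easy).
  induction n as [n IH] using lt_wf_ind.
  destruct (Nat.le_gt_cases n r) as [Hn|Hn]; [now apply W0|].
  apply (f_equal (fun f => f (n + r)%nat)) in E. unfold fmul in E.
  rewrite (zsum_single _ _ r) in E; [| lia |].
  - rewrite zsum_zero in E.
    + replace (n + r - r)%nat with n in E by lia. nia.
    + intros i Hi. destruct (dil_cases 2 (n + r - i)) as [[m Hm]|Hm]; [easy| |].
      * rewrite Hm, dil_at, IH; [ring| lia | easy].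
      * rewrite dil_off by easy. ring.
  - intros i Hi Hne. destruct (Nat.lt_ge_cases i r).
    + rewrite u0 by easy. ring.
    + rewrite IH by lia. ring.
Qed.

(** Multiplied by 2 theta_2 theta_3, the Wronskian involves only the squares of theta_2 and theta_3
    and their derivatives. These are polynomials in theta series at q^2, so the defect W at q
    becomes a multiple of W at q^2. The identity is used below to eliminate derivatives of
    theta_2. *)
Lemma th2_th3_wronskian :
  (th3 * fD th2 - th2 * fD th3 = th2 * th3 * th4 ^ 4)%fps.
Proof.
  set (W := (th3 * fD th2 - th2 * fD th3 - th2 * th3 * th4 ^ 4)%fps).
  enough (E : W = fC 0).
  { transitivity (W + th2 * th3 * th4 ^ 4)%fps; [unfold W; ring|]. rewrite E. ring. }
  set (X := dil 2 th3). set (Y := dil 2 th2).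
  apply (dil2_functional_eq (th2 * th3) (fC 2 * (X ^ 2 - Y ^ 2)) W 1).
  - intros i Hi. replace i with O by lia. reflexivity.
  - vm_compute. discriminate.
  - apply fC2_cancel.
    transitivity (th3 ^ 2 * fD (th2 ^ 2) - th2 ^ 2 * fD (th3 ^ 2)
                  - fC 2 * th2 ^ 2 * th3 ^ 2 * (th4 ^ 2) ^ 2)%fps.
    { unfold W. simpl fpow. rewrite !fD_mul, !fD_C. ring. }
    unfold W. rewrite jacobi_quartic, !dil_sub, !dil_mul, !dil_sub, !dil_pow by easy.
    rewrite th3_sqr', th2_sqr, th4_sqr, fD_add. fold X Y.
    replace (X ^ 2)%fps with (X * X)%fps by ring.
    replace (Y ^ 2)%fps with (Y * Y)%fps by ring.
    rewrite !fD_mul, fD_C.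
    replace (fD X) with (fC 2 * dil 2 (fD th3))%fps by (symmetry; now apply fD_dil).
    replace (fD Y) with (fC 2 * dil 2 (fD th2))%fps by (symmetry; now apply fD_dil).
    ring.
  - intros n Hn. destruct n as [|[|n]]; [vm_compute; reflexivity.. | lia].
Qed.

(* The right-hand side is 8 times the theta series of Z^2 weighted by Re (a + i b)^4. *)
Lemma th3_second_order :
  (fC 2 * th3 ^ 2 * th2 ^ 4 * th4 ^ 4 = th3 * fD (fD th3) - fC 3 * fD th3 ^ 2)%fps.
Proof.
  set (V := (th3 * fD (fD th3) - fC 3 * fD th3 ^ 2 - fC 2 * th3 ^ 2 * th2 ^ 4 * th4 ^ 4)%fps).
  enough (E : V = fC 0).
  { symmetry. transitivity (V + fC 2 * th3 ^ 2 * th2 ^ 4 * th4 ^ 4)%fps; [unfold V; ring|].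
    rewrite E. ring. }
  set (X := dil 2 th3). set (Y := dil 2 th2).
  apply (dil2_functional_eq (fC 2 * th3 ^ 2 * X ^ 2) (fC 8 * (th3 ^ 2) ^ 2) V 0).
  - lia.
  - vm_compute. discriminate.
  - transitivity (X ^ 2 * (th3 ^ 2 * fD (fD (th3 ^ 2)) - fC 2 * fD (th3 ^ 2) ^ 2
       - fC 4 * (th3 ^ 2) ^ 2 * (th2 ^ 2) ^ 2 * (th4 ^ 2) ^ 2))%fps.
    { unfold V. replace (th3 ^ 2)%fps with (th3 * th3)%fps by ring.
      rewrite !fD_mul, !fD_add, !fD_mul. ring. }
    unfold V. rewrite jacobi_quartic, !dil_sub, !dil_mul, !dil_sub, !dil_pow, !dil_C by easy.
    rewrite th3_sqr', th2_sqr, th4_sqr, fD_add. fold X Y.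
    pose proof (f_equal (dil 2) th2_th3_wronskian) as R.
    rewrite jacobi_quartic, !dil_sub, !dil_mul, !dil_sub, !dil_pow in R by easy.
    fold X Y in R.
    assert (HX : fD X = (fC 2 * dil 2 (fD th3))%fps) by now apply fD_dil.
    assert (HY : fD Y = (fC 2 * dil 2 (fD th2))%fps) by now apply fD_dil.
    assert (HXX : fD (fD X) = (fC 4 * dil 2 (fD (fD th3)))%fps).
    { rewrite HX, fD_mul, fD_C, fD_dil by easy. change (Z.of_nat 2) with 2. ring. }
    set (X1 := fD X) in *. set (Y1 := fD Y) in *. set (X2 := fD X1) in *.
    set (Y2 := fD Y1) in *.
    (* The Wronskian at q^2 and its derivative [R2] remove Y1 and Y2. The factor X^2 was put into
       [u] because these relations determine only X Y1 and X Y2. *)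
    assert (R1 : (X * Y1 = Y * X1 + fC 2 * X * Y * (X ^ 4 - Y ^ 4))%fps).
    { rewrite HX, HY.
      transitivity (fC 2 * (X * dil 2 (fD th2) - Y * dil 2 (fD th3))
         + fC 2 * Y * dil 2 (fD th3))%fps; [ring|]. rewrite R. ring. }
    assert (R2 : (X * Y2 = Y * X2 + fC 2 * (X1 * Y + X * Y1) * (X ^ 4 - Y ^ 4)
         + fC 8 * X * Y * (X ^ 3 * X1 - Y ^ 3 * Y1))%fps).
    { pose proof (f_equal fD R1) as R2. simpl fpow in R2.
      rewrite !fD_add, !fD_mul, !fD_sub, !fD_mul, !fD_C in R2.
      fold X1 Y1 X2 Y2 in R2.
      transitivity (X1 * Y1 + X * Y2 - X1 * Y1)%fps; [ring|]. rewrite R2. ring. }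
    replace (fD (X ^ 2)) with (fC 2 * X * X1)%fps
      by (simpl; rewrite !fD_mul, fD_C; unfold X1; ring).
    replace (fD (Y ^ 2)) with (fC 2 * Y * Y1)%fps
      by (simpl; rewrite !fD_mul, fD_C; unfold Y1; ring).
    rewrite fD_add, !fD_mul, fD_C. fold X1 Y1 X2 Y2.
    transitivity (fC 2 * (X ^ 2 + Y ^ 2) ^ 2 * (X * X2 - fC 3 * X1 ^ 2
       - fC 8 * X ^ 2 * Y ^ 4 * (X ^ 4 - Y ^ 4)))%fps.
    2:{ rewrite HXX, HX. ring. }
    transitivity ((X ^ 2 + Y ^ 2) * (fC 2 * X ^ 2 * X1 ^ 2 + fC 2 * X ^ 3 * X2
         + fC 2 * (X * Y1) ^ 2 + fC 2 * X * Y * (X * Y2))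
       - fC 8 * (X ^ 2 * X1 + Y * (X * Y1)) ^ 2
       - fC 16 * (X ^ 2 + Y ^ 2) ^ 2 * X ^ 4 * Y ^ 2 * (X ^ 2 - Y ^ 2) ^ 2)%fps; [ring|].
    rewrite R2.
    transitivity ((X ^ 2 + Y ^ 2) * (fC 2 * X ^ 2 * X1 ^ 2 + fC 2 * X ^ 3 * X2
         + fC 2 * (X * Y1) ^ 2 + fC 2 * X * Y * (Y * X2
         + fC 2 * (X1 * Y + (X * Y1)) * (X ^ 4 - Y ^ 4)
         + fC 8 * Y * (X ^ 4 * X1 - Y ^ 3 * (X * Y1))))
       - fC 8 * (X ^ 2 * X1 + Y * (X * Y1)) ^ 2
       - fC 16 * (X ^ 2 + Y ^ 2) ^ 2 * X ^ 4 * Y ^ 2 * (X ^ 2 - Y ^ 2) ^ 2)%fps; [ring|].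
    rewrite R1. ring.
  - intros n Hn. replace n with O by lia. vm_compute. reflexivity.
Qed.

(** * Dissection of binary forms in theta_3 and theta_2 *)

(* [hev X Y p] is the binary form of degree [length p - 1] with coefficients [p],
   [wev X W e c] the sum of [c_i W^i X^(e + 4 (k - i))], where [k = length c - 1]. *)
Fixpoint hev (X Y : fps) (p : list Z) : fps :=
  match p with
  | [] => fC 0
  | c :: p => (fC c * X ^ length p + Y * hev X Y p)%fps
  end.

Fixpoint wev (X W : fps) (e : nat) (c : list Z) : fps :=
  match c with
  | [] => fC 0
  | c0 :: c => (fC c0 * X ^ (e + 4 * length c) + W * wev X W e c)%fps
  end.

Fixpoint hadd (p q : list Z) : list Z :=
  match p, q with
  | x :: p, y :: q => x + y :: hadd p q
  | _, _ => []
  end.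

Definition hscal (k : Z) (p : list Z) : list Z := map (Z.mul k) p.

Lemma hadd_length p q : length p = length q -> length (hadd p q) = length p.
Proof.
  revert q; induction p as [|x p IH]; intros [|y q]; simpl; try easy.
  intro H; rewrite IH; lia.
Qed.

Lemma hev_add X Y p q : length p = length q ->
  hev X Y (hadd p q) = (hev X Y p + hev X Y q)%fps.
Proof.
  revert q; induction p as [|x p IH]; intros [|y q]; simpl; try easy; intro H.
  - ring.
  - rewrite IH, hadd_length by lia. replace (length q) with (length p) by lia.
    replace (fC (x + y)) with (fC x + fC y)%fps by (symmetry; apply fps_morph). ring.
Qed.

Lemma hev_scal X Y k p : hev X Y (hscal k p) = (fC k * hev X Y p)%fps.
Proof.
  induction p as [|x p IH]; simpl; [ring|]. rewrite IH. unfold hscal. rewrite length_map.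
  replace (fC (k * x)) with (fC k * fC x)%fps by (symmetry; apply fps_morph). ring.
Qed.

Lemma wev_scal X W e k c : wev X W e (hscal k c) = (fC k * wev X W e c)%fps.
Proof.
  induction c as [|x p IH]; simpl; [ring|]. rewrite IH. unfold hscal. rewrite length_map.
  replace (fC (k * x)) with (fC k * fC x)%fps by (symmetry; apply fps_morph). ring.
Qed.

Lemma hev_snoc X Y p : hev X Y (p ++ [0]) = (X * hev X Y p)%fps.
Proof.
  induction p as [|x p IH]; simpl; [ring|]. rewrite IH, length_app, Nat.add_1_r. simpl. ring.
Qed.

Fixpoint hlin (n : nat) : list Z :=
  match n with
  | O => [1]
  | S n => let p := hlin n in hadd (p ++ [0]) (0 :: p)
  end.

Lemma hlin_length n : length (hlin n) = S n.
Proof.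
  induction n as [|n IH]; [reflexivity|]. simpl.
  rewrite hadd_length; rewrite length_app; simpl; lia.
Qed.

Lemma hlin_hev X Y n : hev X Y (hlin n) = ((X + Y) ^ n)%fps.
Proof.
  induction n as [|n IH]; simpl; [ring|].
  rewrite hev_add by (rewrite length_app; simpl; lia).
  rewrite hev_snoc. simpl. rewrite IH. ring.
Qed.

Definition hmulW (p : list Z) : list Z :=
  hscal 8 (hadd (0 :: ((p ++ [0]) ++ [0]) ++ [0]) (0 :: 0 :: 0 :: p ++ [0])).

Lemma hmulW_length p : length (hmulW p) = (4 + length p)%nat.
Proof.
  unfold hmulW, hscal. rewrite length_map, hadd_length; simpl; rewrite !length_app; simpl; lia.
Qed.

Lemma hmulW_hev X Y p :
  hev X Y (hmulW p) = (fC 8 * X * Y * (X ^ 2 + Y ^ 2) * hev X Y p)%fps.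
Proof.
  unfold hmulW. rewrite hev_scal, hev_add by (simpl; rewrite !length_app; simpl; lia).
  simpl. rewrite !hev_snoc. ring.
Qed.

(** The binary form in A, B that arises from [wev] by X = A + B and W = 8 A B (A^2 + B^2). [hadd]
    cuts to the shorter list, so both summands must have the full length e + 4 k + 1; hence the
    separate singleton case. *)
Fixpoint hsubst (e : nat) (c : list Z) : list Z :=
  match c with
  | [] => []
  | [c0] => hscal c0 (hlin e)
  | c0 :: c => hadd (hscal c0 (hlin (e + 4 * length c))) (hmulW (hsubst e c))
  end.

Lemma hsubst_cons2 e x y c : hsubst e (x :: y :: c) =
  hadd (hscal x (hlin (e + 4 * length (y :: c)))) (hmulW (hsubst e (y :: c))).
Proof. reflexivity. Qed.

Lemma hsubst_length e c k : length c = S k -> length (hsubst e c) = (e + 4 * k + 1)%nat.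
Proof.
  revert k; induction c as [|x c IH]; [easy|]. intros k H.
  destruct c as [|y c].
  - simpl in *. unfold hscal. rewrite length_map, hlin_length. lia.
  - destruct k as [|k]; [simpl in H; lia|].
    rewrite hsubst_cons2, hadd_length; unfold hscal; rewrite length_map, hlin_length; [simpl in *; lia|].
    rewrite hmulW_length, (IH k); simpl in *; lia.
Qed.

Lemma hsubst_hev X Y e c :
  wev (X + Y) (fC 8 * X * Y * (X ^ 2 + Y ^ 2)) e c = hev X Y (hsubst e c).
Proof.
  induction c as [|x c IH]; [reflexivity|].
  destruct c as [|y c].
  - simpl. rewrite hev_scal, hlin_hev, Nat.add_0_r. ring.
  - rewrite hsubst_cons2, hev_add.
    + rewrite hev_scal, hlin_hev, hmulW_hev, <- IH. reflexivity.
    + unfold hscal. rewrite length_map, hlin_length, hmulW_length.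
      rewrite (hsubst_length e (y :: c) (length c)); simpl; lia.
Qed.

(* keeps the coefficients of [Y^j] with [j = r mod 4] *)
Fixpoint hclass (r : nat) (p : list Z) : list Z :=
  match p with
  | [] => []
  | c :: p => (match r with O => c | _ => 0 end)
              :: hclass (match r with O => 3 | S r => r end)%nat p
  end.

Fixpoint every4 (p : list Z) : list Z :=
  match p with
  | a :: _ :: _ :: _ :: p => a :: every4 p
  | a :: _ => [a]
  | [] => []
  end.

Lemma hclass_length r p : length (hclass r p) = length p.
Proof. revert r; induction p as [|c p IH]; intro r; simpl; auto. Qed.

(** The exponents of theta_3 lie in 4 N and those of theta_2 in 1 + 8 N, so a monomial with Y^j
    contributes only to indices congruent to j modulo 4. *)
Lemma hclass_coeff p : forall r n, (r < 4)%nat -> (n mod 4 = r)%nat ->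
  hev th3 th2 p n = hev th3 th2 (hclass r p) n.
Proof.
  induction p as [|c p IH]; [reflexivity|]. intros r n Hr Hn.
  cbn [hev hclass]. rewrite hclass_length. unfold fadd. f_equal.
  - rewrite !fC_mul. destruct r as [|r]; [reflexivity|].
    rewrite (supp_vanish 4 0 (th3 ^ length p)%fps n).
    + ring.
    + apply (supp_pow 4 0 th3 (length p) supp_th3).
    + intros [k ->]. rewrite Nat.add_0_l, Nat.mul_comm, Nat.Div0.mod_mul in Hn. lia.
  - unfold fmul. apply zsum_ext; intros i Hi.
    destruct (Z.eq_dec (th2 i) 0) as [E|E]; [rewrite E; ring|].
    destruct (supp_th2 i E) as [k ->]. f_equal. apply IH.
    + destruct r; lia.
    (* Taking away an exponent 1 + 8 k of theta_2 lowers the class by one; class 0 wraps around to 3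
       and costs one more from the quotient. *)
    + pose proof (Nat.div_mod n 4 ltac:(lia)).
      set (q := (n / 4)%nat) in *. rewrite Hn in H.
      destruct r as [|r].
      * symmetry; apply (Nat.mod_unique _ 4 (q - 1 - 2 * k)); lia.
      * symmetry; apply (Nat.mod_unique _ 4 (q - 2 * k)); lia.
Qed.

(** In degree e + 4 k with e < 4, the powers Y^(4 i) occur for i <= k and are paired with X^(e + 4
    (k - i)). So class 0 keeps the shape of [wev] with the same e and k, and U_4 acts on coefficient
    lists of fixed length. *)
Lemma every4_wev X Y e k p : (e < 4)%nat -> length p = (e + 4 * k + 1)%nat ->
  hev X Y (hclass 0 p) = wev X (Y ^ 4) e (every4 p) /\ length (every4 p) = S k.
Proof.
  intros He. revert p; induction k as [|k IH]; intros p Hp.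
  - destruct p as [|a p]; [simpl in Hp; lia|].
    assert (p = [] \/ (exists b, p = [b]) \/ (exists b c, p = [b; c])
            \/ (exists b c d, p = [b; c; d])) as [->|[[b ->]|[[b [c ->]]|[b [c [d ->]]]]]].
    { destruct p as [|b [|c [|d [|]]]]; simpl in Hp; try lia; eauto 8. }
    + simpl in Hp. replace e with 0%nat by lia. split; [simpl; ring|reflexivity].
    + simpl in Hp. replace e with 1%nat by lia. split; [simpl; ring|reflexivity].
    + simpl in Hp. replace e with 2%nat by lia. split; [simpl; ring|reflexivity].
    + simpl in Hp. replace e with 3%nat by lia. split; [simpl; ring|reflexivity].
  - destruct p as [|a [|b [|c [|d p]]]]; simpl in Hp; try lia.
    destruct (IH p) as [E L]; [lia|]. split; [|simpl; lia].
    cbn [hclass hev every4 wev length].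
    rewrite E, L. rewrite hclass_length.
    replace (S (S (S (length p)))) with (e + 4 * S k)%nat by lia. ring.
Qed.

Definition thform (e : nat) (c : list Z) : fps := wev th3 (th2 ^ 4) e c.

Lemma thform_dissect e c : thform e c = dil 4 (hev th3 th2 (hsubst e c)).
Proof.
  rewrite <- hsubst_hev. unfold thform.
  assert (P : forall X W, dil 4 (wev X W e c) = wev (dil 4 X) (dil 4 W) e c).
  { intros X W. induction c as [|x c IH]; cbn [wev]; [now apply dil_C|].
    now rewrite dil_add, !dil_mul, dil_pow, dil_C, IH by easy. }
  rewrite P, dil_add, <- th3_dissect, !dil_mul, dil_add, !dil_pow, dil_C by easy.
  now rewrite th2_quartic_dissect.
Qed.

Definition hU4 (e : nat) (c : list Z) : list Z := every4 (hsubst e c).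

(** This is U_4 in the variable q: indices in t carry a factor 4. The dissection removes one factor
    4 from 16 n, and at the remaining index 4 n only class 0 contributes. *)
Lemma thform_U4 e c n : (e < 4)%nat -> c <> [] ->
  thform e c (16 * n)%nat = thform e (hU4 e c) (4 * n)%nat.
Proof.
  intros He Hc. rewrite thform_dissect.
  replace (16 * n)%nat with (4 * (4 * n))%nat by lia. rewrite dil_at by easy.
  rewrite (hclass_coeff _ 0) by (lia || (rewrite Nat.mul_comm; apply Nat.Div0.mod_mul)).
  destruct c as [|x c]; [easy|].
  destruct (every4_wev th3 th2 e (length c) (hsubst e (x :: c)) He) as [E _].
  { now apply hsubst_length. }
  now rewrite E.
Qed.

Lemma hU4_nonempty e c : c <> [] -> hU4 e c <> [].
Proof.
  intros Hc. unfold hU4. destruct c as [|x c]; [easy|].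
  pose proof (hsubst_length e (x :: c) (length c) eq_refl) as L.
  destruct (hsubst e (x :: c)) as [|a [|b [|d [|f p]]]]; simpl in *; try easy; lia.
Qed.

(** Here the image of the form under U_4 is assumed to be an eigenvector, not the form itself. Hence
    two initial values: at n0, and at 4 n0 through [hU4 e c]. *)
Lemma thform_vanish_4a e c kappa n0 : (e < 4)%nat -> c <> [] ->
  hU4 e (hU4 e c) = hscal kappa (hU4 e c) ->
  thform e c (4 * n0)%nat = 0 -> thform e (hU4 e c) (4 * n0)%nat = 0 ->
  forall a, thform e c (4 * (4 ^ a * n0))%nat = 0.
Proof.
  intros He Hc E H0 H1.
  assert (P : forall a, thform e (hU4 e c) (4 * (4 ^ a * n0))%nat = 0).
  { induction a as [|a IH]; [now rewrite Nat.mul_1_l|].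
    replace (4 * (4 ^ S a * n0))%nat with (16 * (4 ^ a * n0))%nat by (simpl; lia).
    rewrite thform_U4, E by (auto using hU4_nonempty).
    unfold thform in *. rewrite wev_scal, fC_mul, IH. ring. }
  intros [|a]; [now rewrite Nat.mul_1_l|].
  replace (4 * (4 ^ S a * n0))%nat with (16 * (4 ^ a * n0))%nat by (simpl; lia).
  rewrite thform_U4 by auto. apply P.
Qed.

(** After one dissection the index 8 b + r meets a single class modulo 4, whose closed form g lives
    on s + 8 N. In the applications r and s are the two residues modulo 8 over the same residue
    modulo 4. The eigenvalue equation then carries the vanishing from a to a + 1. *)
Lemma thform_vanish_4a_8b e c kappa r s g : (e < 4)%nat -> c <> [] -> (r < 8)%nat ->
  hU4 e c = hscal kappa c ->
  hev th3 th2 (hclass (r mod 4) (hsubst e c)) = g -> supp 8 s g -> (s < 8)%nat -> s <> r ->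
  forall a b, thform e c (4 * (4 ^ a * (8 * b + r)))%nat = 0.
Proof.
  intros He Hc Hr E Hg Hs Hs8 Hsr a b.
  assert (H0 : thform e c (4 * (8 * b + r))%nat = 0).
  { rewrite thform_dissect, dil_at by easy.
    rewrite (hclass_coeff _ (r mod 4)).
    - rewrite Hg. apply (supp_vanish 8 s); [easy|]. intros [k Hk]. lia.
    - apply Nat.mod_upper_bound; lia.
    - replace (8 * b + r)%nat with (r + 2 * b * 4)%nat by lia. apply Nat.Div0.mod_add. }
  induction a as [|a IH]; [now rewrite Nat.mul_1_l|].
  replace (4 * (4 ^ S a * (8 * b + r)))%nat with (16 * (4 ^ a * (8 * b + r)))%nat
    by (simpl; lia).
  rewrite thform_U4, E by auto. unfold thform in *. rewrite wev_scal, fC_mul, IH. ring.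
Qed.

(** * Truncated evaluation *)

(** A product of functions recomputes its factors at each evaluation. Lists truncated after t^N
    store every intermediate product, which makes high powers computable. *)
Definition tr (N : nat) (f : fps) : list Z := map f (seq 0 (S N)).

Definition tmul (N : nat) (p q : list Z) : list Z :=
  map (fun n => zsum (fun i => nth i p 0 * nth (n - i) q 0) n) (seq 0 (S N)).

Lemma tr_nth N f n : (n <= N)%nat -> nth n (tr N f) 0 = f n.
Proof.
  intros H. unfold tr. rewrite (nth_indep _ 0 (f O)) by (rewrite length_map, length_seq; lia).
  rewrite map_nth, seq_nth by lia. f_equal.
Qed.

Lemma tr_mul N f g : tr N (f * g)%fps = tmul N (tr N f) (tr N g).
Proof.
  unfold tr at 1, tmul. apply map_ext_in. intros n Hn. apply in_seq in Hn.
  unfold fmul. apply zsum_ext; intros i Hi. rewrite !tr_nth by lia. reflexivity.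
Qed.

Lemma tr_pow N f k : tr N (f ^ k)%fps = Nat.iter k (tmul N (tr N f)) (tr N (fC 1)).
Proof. induction k as [|k IH]; simpl; [reflexivity|]. now rewrite tr_mul, IH. Qed.

Lemma tr_add N f g : tr N (f + g)%fps = hadd (tr N f) (tr N g).
Proof.
  unfold tr. induction (seq 0 (S N)) as [|n l IH]; [reflexivity|]. simpl. now rewrite IH.
Qed.

Lemma tr_sub N f g : tr N (f - g)%fps = hadd (tr N f) (hscal (-1) (tr N g)).
Proof.
  unfold tr. induction (seq 0 (S N)) as [|n l IH]; [reflexivity|].
  cbn [map hadd hscal] in *. now rewrite IH.
Qed.

Ltac coeff_compute :=
  match goal with |- ?f ?n = _ =>
    rewrite <- (tr_nth n f n) by lia;
    repeat first [rewrite tr_add | rewrite tr_sub | rewrite tr_mul | rewrite tr_pow];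
    vm_compute; reflexivity
  end.

(** * Vanishing coefficients *)

(* [16^beta] times the form, and [(-16)^beta] times its shadow, in the variable t. *)
Definition Fform (eps alpha beta : nat) : fps :=
  ((th4 ^ 4 - th2 ^ 4) ^ eps * th3 ^ alpha * (th2 ^ 4 * th4 ^ 4) ^ beta)%fps.
Definition Fsh (eps alpha beta : nat) : fps :=
  ((th3 ^ 4 + th4 ^ 4) ^ eps * th2 ^ alpha * (th3 ^ 4 * th4 ^ 4) ^ beta)%fps.

Lemma supp_th2_pow k : supp 8 k (th2 ^ k).
Proof. rewrite <- (Nat.mul_1_l k) at 1. apply supp_pow, supp_th2. Qed.

(** The product theta_3 theta_4 is theta_4(q^2)^2, so its fourth power is a series in t^8. *)
Lemma supp_th34 : supp 8 0 (th3 ^ 4 * th4 ^ 4).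
Proof.
  replace (th3 ^ 4 * th4 ^ 4)%fps with ((th3 * th4) ^ 4)%fps by ring.
  rewrite th3_th4, <- dil_pow by easy. apply (supp_pow 8 0).
  apply (supp_dil 4 2 0); [easy|]. apply (supp_pow 4 0 th4 2), supp_th4.
Qed.

(** In terms of theta_3 and theta_2 at q^2 this is (X^2 + Y^2)^2 + (X^2 - Y^2)^2 = 2 (X^4 + Y^4). *)
Lemma supp_th3_add_th4 : supp 8 0 (th3 ^ 4 + th4 ^ 4).
Proof.
  replace (th3 ^ 4 + th4 ^ 4)%fps with (dil 2 (fC 2 * (th3 ^ 4 + th2 ^ 4)))%fps.
  - apply (supp_dil 4 2 0); [easy|].
    apply (supp_mul 4 0 0); [apply supp_C|]. apply supp_add.
    + apply (supp_pow 4 0 th3 4), supp_th3.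
    + apply (supp_weaken 8 4 4 0 2 1); try reflexivity. apply (supp_th2_pow 4).
  - rewrite dil_mul, dil_add, !dil_pow, dil_C by easy.
    replace (th3 ^ 4)%fps with ((th3 ^ 2) ^ 2)%fps by ring.
    replace (th4 ^ 4)%fps with ((th4 ^ 2) ^ 2)%fps by ring.
    rewrite th3_sqr', th4_sqr. ring.
Qed.

Lemma supp_Fform eps alpha beta : supp 4 0 (Fform eps alpha beta).
Proof.
  assert (H : supp 4 0 (th2 ^ 4)).
  { apply (supp_weaken 8 4 4 0 2 1); try reflexivity. apply (supp_th2_pow 4). }
  assert (H4 : supp 4 0 (th4 ^ 4)) by apply (supp_pow 4 0 th4 4), supp_th4.
  unfold Fform. apply (supp_mul 4 0 0); [apply (supp_mul 4 0 0)|].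
  - now apply (supp_pow 4 0), supp_sub.
  - apply (supp_pow 4 0), supp_th3.
  - now apply (supp_pow 4 0), (supp_mul 4 0 0).
Qed.

Lemma supp_Fsh eps alpha beta : supp 8 alpha (Fsh eps alpha beta).
Proof.
  unfold Fsh. rewrite <- (Nat.add_0_r alpha) at 1.
  apply supp_mul; [apply (supp_mul 8 0 alpha)|].
  - apply (supp_pow 8 0), supp_th3_add_th4.
  - apply supp_th2_pow.
  - apply (supp_pow 8 0), supp_th34.
Qed.

(** The base is the fourth power of theta_2 theta_3 theta_4 = 2 eta^3. Its factor theta_2^4 has
    exponents in 4 + 8 N, the other factor is a series in t^8. *)
Lemma Fform_eta k : supp 8 (4 * k) (Fform 0 (4 * k) k).
Proof.
  replace (Fform 0 (4 * k) k) with ((th2 ^ 4) ^ k * (th3 ^ 4 * th4 ^ 4) ^ k)%fps.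
  - rewrite <- (Nat.add_0_r (4 * k)). apply supp_mul.
    + apply (supp_pow 8 4), (supp_th2_pow 4).
    + apply (supp_pow 8 0), supp_th34.
  - unfold Fform. rewrite !fpow_mul, <- (fpow_pow th3 4 k). simpl ((_ - _) ^ 0)%fps. ring.
Qed.

(** Up to a constant the base is eta^24 at q^2, by the duplication formulas for theta_2^2 and
    theta_3 theta_4. All exponents in t are thus divisible by 16, that is, m is divisible by 4. *)
Lemma Fsh_eta k : supp 16 (16 * k) (Fsh 0 (16 * k) k).
Proof.
  replace (Fsh 0 (16 * k) k) with ((fC 256 * dil 2 (th2 ^ 8 * (th3 ^ 4 * th4 ^ 4) ^ 2)) ^ k)%fps.
  - apply (supp_pow 16 16). apply (supp_mul 16 0 16); [apply supp_C|].
    apply (supp_dil 8 2 8); [easy|]. apply (supp_mul 8 8 0); [apply (supp_th2_pow 8)|].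
    apply (supp_pow 8 0), supp_th34.
  - unfold Fsh. rewrite <- (fpow_pow th2 16 k). simpl ((_ + _) ^ 0)%fps.
    transitivity ((th2 ^ 16 * (th3 ^ 4 * th4 ^ 4)) ^ k)%fps; [|rewrite !fpow_mul; ring].
    f_equal.
    replace (th2 ^ 16 * (th3 ^ 4 * th4 ^ 4))%fps with ((th2 ^ 2) ^ 8 * (th3 * th4) ^ 4)%fps by ring.
    rewrite th2_sqr, th3_th4. rewrite !dil_mul, !dil_pow, !dil_mul, !dil_pow by easy. ring.
Qed.

Lemma fmul_neq0 (f g : fps) n : (f * g)%fps n <> 0 ->
  exists i j, n = (i + j)%nat /\ f i <> 0 /\ g j <> 0.
Proof.
  intro H. apply zsum_neq0 in H. destruct H as [i [Hi H]].
  exists i, (n - i)%nat. split; [lia|]. split; intro E; apply H; rewrite E; ring.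
Qed.

Lemma Fform_1 n : Fform 0 1 0 (4 * n)%nat <> 0 -> exists a, Z.of_nat n = a ^ 2.
Proof.
  replace (Fform 0 1 0) with th3 by (unfold Fform; ring).
  intro H. apply thser_neq0 in H. destruct H as [a H]. exists a. unfold e3 in H. lia.
Qed.

Lemma Fsh_1 n : Fsh 0 1 0 n <> 0 -> exists a, Z.of_nat n = a ^ 2.
Proof.
  replace (Fsh 0 1 0) with th2 by (unfold Fsh; ring).
  intro H. apply thser_neq0 in H. destruct H as [a H]. exists (2 * a + 1). now symmetry.
Qed.

Lemma sum2sq_th3 (f g : fps) n : (forall i, f i <> 0 -> th3 i <> 0) ->
  (forall i, g i <> 0 -> th3 i <> 0) -> (f * g)%fps (4 * n)%nat <> 0 ->
  exists a b, Z.of_nat n = a ^ 2 + b ^ 2.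
Proof.
  intros Hf Hg H. apply fmul_neq0 in H. destruct H as [i [j [E [Hi Hj]]]].
  apply Hf in Hi. apply Hg in Hj. apply thser_neq0 in Hi, Hj.
  destruct Hi as [a Ha], Hj as [b Hb]. exists a, b. unfold e3 in *. lia.
Qed.

Lemma Fform_2 n : Fform 0 2 0 (4 * n)%nat <> 0 -> exists a b, Z.of_nat n = a ^ 2 + b ^ 2.
Proof.
  replace (Fform 0 2 0) with (th3 * th3)%fps by (unfold Fform; ring).
  now apply sum2sq_th3.
Qed.

Lemma Fsh_2 n : Fsh 0 2 0 n <> 0 -> exists a b, Z.of_nat n = a ^ 2 + b ^ 2.
Proof.
  replace (Fsh 0 2 0) with (th2 * th2)%fps by (unfold Fsh; ring).
  intro H. apply fmul_neq0 in H. destruct H as [i [j [E [Hi Hj]]]].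
  apply thser_neq0 in Hi, Hj. destruct Hi as [a Ha], Hj as [b Hb].
  exists (2 * a + 1), (2 * b + 1). unfold e2 in *. lia.
Qed.

(** By [th3_second_order] the form is a combination of products of derivatives of theta_3, and
    derivatives live on the exponents of theta_3 itself. *)
Lemma Fform_2_1 n : Fform 0 2 1 (4 * n)%nat <> 0 -> exists a b, Z.of_nat n = a ^ 2 + b ^ 2.
Proof.
  assert (D : forall i, fD th3 i <> 0 -> th3 i <> 0).
  { intros i H E. apply H. unfold fD. rewrite E. ring. }
  assert (DD : forall i, fD (fD th3) i <> 0 -> th3 i <> 0).
  { intros i H E. apply H. unfold fD. rewrite E. ring. }
  intro H.
  assert (E : (fC 2 * Fform 0 2 1 = th3 * fD (fD th3) + fC (-3) * (fD th3 * fD th3))%fps).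
  { transitivity (fC 2 * th3 ^ 2 * th2 ^ 4 * th4 ^ 4)%fps; [unfold Fform; ring|].
    rewrite th3_second_order. ring. }
  apply (f_equal (fun f => f (4 * n)%nat)) in E.
  unfold fadd in E. rewrite !fC_mul in E.
  destruct (Z.eq_dec ((th3 * fD (fD th3))%fps (4 * n)%nat) 0) as [E1|E1].
  - apply (sum2sq_th3 (fD th3) (fD th3)); auto. lia.
  - now apply (sum2sq_th3 th3 (fD (fD th3))).
Qed.

(** The form at q is a combination of its shadow and itself at q^2. At index 2 (2 + 8 n) only the
    shadow contributes, as the form lives on multiples of 4. So 1 + 4 n is a sum of two squares, and
    doubling gives (a + b)^2 + (a - b)^2. *)
Lemma Fsh_2_1 n : Fsh 0 2 1 (2 + 8 * n)%nat <> 0 ->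
  exists a b, Z.of_nat (2 + 8 * n) = a ^ 2 + b ^ 2.
Proof.
  assert (E : Fform 0 2 1 = dil 2 (fC 4 * Fsh 0 2 1 - fC 4 * Fform 0 2 1)).
  { transitivity (th3 ^ 2 * (th2 ^ 2) ^ 2 * (th4 ^ 2) ^ 2)%fps; [unfold Fform; ring|].
    replace (fC 4 * Fsh 0 2 1 - fC 4 * Fform 0 2 1)%fps
      with (fC 4 * th2 ^ 2 * th3 ^ 2 * (th3 ^ 2 - th2 ^ 2) * th4 ^ 4)%fps
      by (unfold Fform, Fsh; ring).
    rewrite jacobi_quartic, !dil_mul, !dil_sub, !dil_pow, dil_C by easy.
    rewrite th3_sqr', th2_sqr, th4_sqr. ring. }
  apply (f_equal (fun f => f (2 * (2 + 8 * n))%nat)) in E.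
  rewrite dil_at in E by easy. unfold fsub in E. rewrite !fC_mul in E.
  rewrite (supp_vanish 4 0 (Fform 0 2 1) (2 + 8 * n)) in E.
  - intro H. destruct (Fform_2_1 (1 + 4 * n)) as [a [b Hab]].
    + replace (4 * (1 + 4 * n))%nat with (2 * (2 + 8 * n))%nat by lia. lia.
    + exists (a + b), (a - b). lia.
  - apply supp_Fform.
  - intros [k Hk]. lia.
Qed.

Ltac thform_eq := unfold Fform, Fsh, thform; cbn [wev length Nat.add Nat.mul]; rewrite ?jacobi_quartic; ring.

Ltac class_eq :=
  match goal with |- hev _ _ ?l = _ =>
    let l' := eval vm_compute in l in
    replace l with l' by (vm_compute; reflexivity); cbn [hev length]; ring
  end.

(** The easy half of the three-square theorem: class 3 of (A + B)^3 is B^3 alone, with exponents in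
    3 + 8 N. *)
Lemma Fform_3 a b : Fform 0 3 0 (4 * (4 ^ a * (8 * b + 7)))%nat = 0.
Proof.
  replace (Fform 0 3 0) with (thform 3 [1]) by thform_eq.
  apply (thform_vanish_4a_8b 3 [1] 1 7 3 (th2 ^ 3)); try lia; try easy.
  - class_eq.
  - apply (supp_th2_pow 3).
Qed.

Lemma Fform_1_1 a b : Fform 0 1 1 (4 * (4 ^ a * (8 * b + 5)))%nat = 0.
Proof.
  replace (Fform 0 1 1) with (thform 1 [0; 1; -1]) by thform_eq.
  apply (thform_vanish_4a_8b 1 [0; 1; -1] (-8) 5 1 (fC 8 * th2 * (th3 ^ 4 * th4 ^ 4)));
    try lia; try easy.
  - rewrite jacobi_quartic. class_eq.
  - apply (supp_mul 8 1 0); [apply (supp_mul 8 0 1)|]; auto using supp_C, supp_th2, supp_th34.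
Qed.

Lemma Fform_3_1 a b : Fform 0 3 1 (4 * (4 ^ a * (8 * b + 7)))%nat = 0.
Proof.
  replace (Fform 0 3 1) with (thform 3 [0; 1; -1]) by thform_eq.
  apply (thform_vanish_4a_8b 3 [0; 1; -1] 16 7 3 (fC (-16) * th2 ^ 3 * (th3 ^ 4 * th4 ^ 4)));
    try lia; try easy.
  - rewrite jacobi_quartic. class_eq.
  - apply (supp_mul 8 3 0); [apply (supp_mul 8 0 3)|];
      auto using supp_C, supp_th2_pow, supp_th34.
Qed.

Lemma Fform_7_1 a b : Fform 0 7 1 (4 * (4 ^ a * (8 * b + 3)))%nat = 0.
Proof.
  replace (Fform 0 7 1) with (thform 3 [0; 1; -1; 0]) by thform_eq.
  apply (thform_vanish_4a_8b 3 [0; 1; -1; 0] (-64) 3 7 (fC 64 * th2 ^ 7 * (th3 ^ 4 * th4 ^ 4)));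
    try lia; try easy.
  - rewrite jacobi_quartic. class_eq.
  - apply (supp_mul 8 7 0); [apply (supp_mul 8 0 7)|];
      auto using supp_C, supp_th2_pow, supp_th34.
Qed.

Lemma Fform_phi_3_1 a b : Fform 1 3 1 (4 * (4 ^ a * (8 * b + 7)))%nat = 0.
Proof.
  replace (Fform 1 3 1) with (thform 3 [0; 1; -3; 2]) by thform_eq.
  apply (thform_vanish_4a_8b 3 [0; 1; -3; 2] 64 7 3
    (fC 64 * th2 ^ 3 * (th3 ^ 4 * th4 ^ 4) * (th3 ^ 4 + th4 ^ 4))); try lia; try easy.
  - rewrite jacobi_quartic. class_eq.
  - apply (supp_mul 8 3 0); [apply (supp_mul 8 3 0); [apply (supp_mul 8 0 3)|]|];
      auto using supp_C, supp_th2_pow, supp_th34, supp_th3_add_th4.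
Qed.

Lemma Fform_5_2 a b : Fform 0 5 2 (4 * (4 ^ a * (8 * b + 1)))%nat = 0.
Proof.
  replace (Fform 0 5 2) with (thform 1 [0; 0; 1; -2; 1; 0]) by thform_eq.
  apply (thform_vanish_4a_8b 1 [0; 0; 1; -2; 1; 0] 512 1 5
    (fC 512 * th2 ^ 5 * (th3 ^ 4 * th4 ^ 4) ^ 2)); try lia; try easy.
  - rewrite jacobi_quartic. class_eq.
  - apply (supp_mul 8 5 0); [apply (supp_mul 8 0 5)|];
      auto using supp_C, supp_th2_pow. apply (supp_pow 8 0), supp_th34.
Qed.

Ltac thform_4a c k n0 :=
  apply (thform_vanish_4a 0 c k n0);
  [ lia | discriminate | vm_compute; reflexivity
  | unfold thform; cbn [wev length Nat.add Nat.mul]; coeff_compute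
  | let d := eval vm_compute in (hU4 0 c) in
    replace (hU4 0 c) with d by (vm_compute; reflexivity);
    unfold thform; cbn [wev length Nat.add Nat.mul]; coeff_compute ].

Lemma Fform_phi_16_1 a : Fform 1 16 1 (4 * (4 ^ a * 2))%nat = 0.
Proof.
  replace (Fform 1 16 1) with (thform 0 [0; 1; -3; 2; 0; 0; 0; 0]) by thform_eq.
  thform_4a [0; 1; -3; 2; 0; 0; 0; 0] 4096 2%nat.
Qed.

Lemma Fsh_phi_16_1 a : Fsh 1 16 1 (4 * (4 ^ a * 2))%nat = 0.
Proof.
  replace (Fsh 1 16 1) with (thform 0 [0; 0; 0; 0; 2; -3; 1; 0]) by thform_eq.
  thform_4a [0; 0; 0; 0; 2; -3; 1; 0] 4096 2%nat.
Qed.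

Lemma Fform_12_2 a : Fform 0 12 2 (4 * (4 ^ a * 1))%nat = 0.
Proof.
  replace (Fform 0 12 2) with (thform 0 [0; 0; 1; -2; 1; 0; 0; 0]) by thform_eq.
  thform_4a [0; 0; 1; -2; 1; 0; 0; 0] 4096 1%nat.
Qed.

Lemma Fform_phi_8_2 a : Fform 1 8 2 (4 * (4 ^ a * 1))%nat = 0.
Proof.
  replace (Fform 1 8 2) with (thform 0 [0; 0; 1; -4; 5; -2; 0; 0]) by thform_eq.
  thform_4a [0; 0; 1; -4; 5; -2; 0; 0] 4096 1%nat.
Qed.

Lemma Fsh_phi_8_2 a : Fsh 1 8 2 (4 * (4 ^ a * 1))%nat = 0.
Proof.
  replace (Fsh 1 8 2) with (thform 0 [0; 0; 2; -5; 4; -1; 0; 0]) by thform_eq.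
  thform_4a [0; 0; 2; -5; 4; -1; 0; 0] 4096 1%nat.
Qed.

Lemma Fform_4_3 a : Fform 0 4 3 (4 * (4 ^ a * 2))%nat = 0.
Proof.
  replace (Fform 0 4 3) with (thform 0 [0; 0; 0; 1; -3; 3; -1; 0]) by thform_eq.
  thform_4a [0; 0; 0; 1; -3; 3; -1; 0] 4096 2%nat.
Qed.

Lemma vanish_2a (f : fps) : (forall a, f (4 * (4 ^ a * 1))%nat = 0) ->
  (forall a, f (4 * (4 ^ a * 2))%nat = 0) -> forall a, f (4 * 2 ^ a)%nat = 0.
Proof.
  intros H1 H2 a. destruct (Nat.Even_or_Odd a) as [[k ->]|[k ->]].
  - rewrite <- (H1 k), Nat.pow_mul_r. f_equal. simpl. lia.
  - rewrite <- (H2 k), Nat.pow_add_r, Nat.pow_mul_r. f_equal.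
Qed.

Lemma Fform_phi_24_3 a : Fform 1 24 3 (4 * 2 ^ a)%nat = 0.
Proof.
  replace (Fform 1 24 3)
    with (thform 0 [0; 0; 0; 1; -5; 9; -7; 2; 0; 0; 0; 0; 0; 0]) by thform_eq.
  revert a. apply vanish_2a; intro a.
  - thform_4a [0; 0; 0; 1; -5; 9; -7; 2; 0; 0; 0; 0; 0; 0] 16777216 1%nat.
  - thform_4a [0; 0; 0; 1; -5; 9; -7; 2; 0; 0; 0; 0; 0; 0] 16777216 2%nat.
Qed.

Lemma Fsh_phi_24_3 a : Fsh 1 24 3 (4 * 2 ^ a)%nat = 0.
Proof.
  replace (Fsh 1 24 3)
    with (thform 0 [0; 0; 0; 0; 0; 0; 2; -7; 9; -5; 1; 0; 0; 0]) by thform_eq.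
  revert a. apply vanish_2a; intro a.
  - thform_4a [0; 0; 0; 0; 0; 0; 2; -7; 9; -5; 1; 0; 0; 0] 16777216 1%nat.
  - thform_4a [0; 0; 0; 0; 0; 0; 2; -7; 9; -5; 1; 0; 0; 0] 16777216 2%nat.
Qed.

Lemma Fform_phi_12 : Fform 1 12 0 4%nat = 0.
Proof. unfold Fform. coeff_compute. Qed.
Lemma Fsh_phi_40_1 : Fsh 1 40 1 96%nat = 0.
Proof. unfold Fsh. coeff_compute. Qed.
Lemma Fform_phi_20_2 : Fform 1 20 2 12%nat = 0.
Proof. unfold Fform. coeff_compute. Qed.
Lemma Fform_phi_33_2 : Fform 1 33 2 16%nat = 0.
Proof. unfold Fform. coeff_compute. Qed.
Lemma Fsh_phi_33_2 : Fsh 1 33 2 49%nat = 0.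
Proof. unfold Fsh. coeff_compute. Qed.

Open Scope R_scope.

(** * Evaluation of formal series at t = exp (i PI z / 4) *)

Lemma ex_series_Rle (a b : nat -> R) :
  (forall n, Rabs (a n) <= b n) -> ex_series b -> ex_series a.
Proof. apply (@ex_series_le R_AbsRing R_CompleteNormedModule). Qed.

Lemma is_series_Rplus (a b : nat -> R) la lb :
  is_series a la -> is_series b lb -> is_series (fun n => a n + b n) (la + lb).
Proof. apply (@is_series_plus R_AbsRing R_NormedModule). Qed.

Lemma is_series_Rminus (a b : nat -> R) la lb :
  is_series a la -> is_series b lb -> is_series (fun n => a n - b n) (la - lb).
Proof. apply (@is_series_minus R_AbsRing R_NormedModule). Qed.

Lemma is_series_Rscal (c : R) (a : nat -> R) la :
  is_series a la -> is_series (fun n => c * a n) (c * la).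
Proof. apply (@is_series_scal_l R_AbsRing R_NormedModule). Qed.

Lemma is_series_Rext (a b : nat -> R) (l : R) :
  (forall n, a n = b n) -> is_series a l -> is_series b l.
Proof. apply is_series_ext. Qed.

(** Real and imaginary parts are kept apart so that the theorems on real series, in particular on
    Cauchy products, apply. *)
Definition cser (u : nat -> C) (s : C) : Prop :=
  is_series (fun n => Re (u n)) (Re s) /\ is_series (fun n => Im (u n)) (Im s).

Lemma sum_n_C (u : nat -> C) N :
  @sum_n C_AbelianMonoid u N = (sum_n (fun n => Re (u n)) N, sum_n (fun n => Im (u n)) N).
Proof.
  induction N as [|N IH].
  - rewrite !sum_O. now destruct (u O).
  - now rewrite !sum_Sn, IH.
Qed.

Lemma cser_is_series u s : cser u s -> @is_series C_AbsRing C_NormedModule u s.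
Proof.
  intros [H1 H2]. unfold is_series in *.
  apply (filterlim_ext (fun N => (sum_n (fun n => Re (u n)) N, sum_n (fun n => Im (u n)) N))).
  { intro N. symmetry. apply sum_n_C. }
  apply (proj2 (@filterlim_locally _ C_UniformSpace _ _ _ _)). intro eps.
  pose proof (proj1 (filterlim_locally _ _) H1 eps) as B1.
  pose proof (proj1 (filterlim_locally _ _) H2 eps) as B2.
  generalize (filter_and _ _ B1 B2). apply filter_imp. intros N [h1 h2]. now split.
Qed.

Lemma Cexp_add a b : Cexp (a + b) = (Cexp a * Cexp b)%C.
Proof.
  destruct a, b. unfold Cexp, Cmult; simpl. rewrite exp_plus, cos_plus, sin_plus.
  apply injective_projections; simpl; ring.
Qed.

Lemma qpow_eq z m : qpow z m =
  (exp (- (PI * Im z * m)) * cos (PI * Re z * m), exp (- (PI * Im z * m)) * sin (PI * Re z * m)).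
Proof.
  unfold qpow, Cexp. destruct z as [x y]. simpl.
  replace ((0 * PI - 1 * 0) * x - (0 * 0 + 1 * PI) * y) with (- (PI * y)) by ring.
  replace ((0 * PI - 1 * 0) * y + (0 * 0 + 1 * PI) * x) with (PI * x) by ring.
  replace (- (PI * y) * m - PI * x * 0) with (- (PI * y * m)) by ring.
  replace (- (PI * y) * 0 + PI * x * m) with (PI * x * m) by ring. reflexivity.
Qed.

Lemma qpow_add z m n : qpow z (m + n) = (qpow z m * qpow z n)%C.
Proof.
  unfold qpow. rewrite <- Cexp_add. f_equal. rewrite RtoC_plus. ring.
Qed.

Definition tq (z : C) (n : nat) : C := qpow z (INR n / 4).
Definition trad (z : C) : R := exp (- (PI * Im z / 4)).

Lemma tq_add z n m : tq z (n + m) = (tq z n * tq z m)%C.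
Proof. unfold tq. rewrite <- qpow_add. f_equal. rewrite plus_INR. field. Qed.

Lemma trad_bound z : 0 < Im z -> 0 < trad z < 1.
Proof.
  intro Hz. unfold trad. split; [apply exp_pos|].
  rewrite <- exp_0. apply exp_increasing. pose proof PI_RGT_0. nra.
Qed.

Lemma trad_pow z n : exp (- (PI * Im z * (INR n / 4))) = trad z ^ n.
Proof.
  induction n as [|n IH].
  - simpl. replace (- (PI * Im z * (0 / 4))) with 0 by field. apply exp_0.
  - rewrite S_INR. simpl pow. rewrite <- IH. unfold trad. rewrite <- exp_plus. f_equal. field.
Qed.

Lemma Re_tq_bound z n : Rabs (Re (tq z n)) <= trad z ^ n.
Proof.
  unfold tq. rewrite qpow_eq, trad_pow. simpl. rewrite Rabs_mult.
  assert (0 < trad z ^ n) by (apply pow_lt, exp_pos).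
  rewrite (Rabs_pos_eq (trad z ^ n)) by lra.
  pose proof (COS_bound (PI * Re z * (INR n / 4))).
  assert (Rabs (cos (PI * Re z * (INR n / 4))) <= 1) by (apply Rabs_le; lra).
  nra.
Qed.

Lemma Im_tq_bound z n : Rabs (Im (tq z n)) <= trad z ^ n.
Proof.
  unfold tq. rewrite qpow_eq, trad_pow. simpl. rewrite Rabs_mult.
  assert (0 < trad z ^ n) by (apply pow_lt, exp_pos).
  rewrite (Rabs_pos_eq (trad z ^ n)) by lra.
  pose proof (SIN_bound (PI * Re z * (INR n / 4))).
  assert (Rabs (sin (PI * Re z * (INR n / 4))) <= 1) by (apply Rabs_le; lra).
  nra.
Qed.

(** The series f at t has sum s. Absolute convergence belongs to the relation so that it is stable
    under [fmul], which evaluates to a Cauchy product. *)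
Definition ev (z : C) (f : fps) (s : C) : Prop :=
  ex_series (fun n => Rabs (IZR (f n)) * trad z ^ n) /\
  cser (fun n => (RtoC (IZR (f n)) * tq z n)%C) s.

Lemma Re_RtoC_mul a w : Re (RtoC a * w)%C = a * Re w.
Proof. destruct w; simpl; ring. Qed.
Lemma Im_RtoC_mul a w : Im (RtoC a * w)%C = a * Im w.
Proof. destruct w; simpl; ring. Qed.

Lemma is_series_head (u : nat -> R) : (forall n, u (S n) = 0) -> is_series u (u O).
Proof.
  intro H. unfold is_series. apply (filterlim_ext (fun _ => u O)); [|apply filterlim_const].
  induction x as [|n IH]; [now rewrite sum_O|].
  rewrite sum_Sn, <- IH, H. symmetry. apply Rplus_0_r.
Qed.

Lemma tq_0 z : tq z 0 = (1, 0).
Proof.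
  unfold tq. rewrite qpow_eq. simpl.
  replace (- (PI * Im z * (0 / 4))) with 0 by field.
  replace (PI * Re z * (0 / 4)) with 0 by field.
  rewrite exp_0, cos_0, sin_0. apply injective_projections; simpl; ring.
Qed.

Lemma ev_C z c : ev z (fC c) (RtoC (IZR c)).
Proof.
  split; [|split].
  - exists (Rabs (IZR c) * trad z ^ 0).
    apply (is_series_head (fun n => Rabs (IZR (fC c n)) * trad z ^ n)).
    intro n. simpl. rewrite Rabs_R0. ring.
  - replace (Re (RtoC (IZR c))) with (Re (RtoC (IZR (fC c O)) * tq z 0)%C)
      by (rewrite tq_0; simpl; ring).
    apply (is_series_head (fun n => Re (RtoC (IZR (fC c n)) * tq z n)%C)).
    intro n. rewrite Re_RtoC_mul. simpl. ring.
  - replace (Im (RtoC (IZR c))) with (Im (RtoC (IZR (fC c O)) * tq z 0)%C)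
      by (rewrite tq_0; simpl; ring).
    apply (is_series_head (fun n => Im (RtoC (IZR (fC c n)) * tq z n)%C)).
    intro n. rewrite Im_RtoC_mul. simpl. ring.
Qed.

Lemma ev_add z f g s s' : ev z f s -> ev z g s' -> ev z (f + g)%fps (s + s')%C.
Proof.
  intros [A [B B']] [A' [D D']]. split.
  - apply (ex_series_Rle _ (fun n => Rabs (IZR (f n)) * trad z ^ n + Rabs (IZR (g n)) * trad z ^ n)).
    + intro n. unfold fadd. rewrite plus_IZR.
      assert (0 < trad z ^ n) by (apply pow_lt, exp_pos).
      rewrite Rabs_mult, Rabs_Rabsolu, (Rabs_pos_eq (trad z ^ n)) by lra.
      pose proof (Rabs_triang (IZR (f n)) (IZR (g n))). nra.
    + destruct A as [a Ha], A' as [a' Ha']. exists (a + a'). now apply is_series_Rplus.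
  - split.
    + apply (is_series_Rext (fun n => Re (RtoC (IZR (f n)) * tq z n)%C
        + Re (RtoC (IZR (g n)) * tq z n)%C)).
      * intro n. rewrite !Re_RtoC_mul. unfold fadd. rewrite plus_IZR. ring.
      * now apply is_series_Rplus.
    + apply (is_series_Rext (fun n => Im (RtoC (IZR (f n)) * tq z n)%C
        + Im (RtoC (IZR (g n)) * tq z n)%C)).
      * intro n. rewrite !Im_RtoC_mul. unfold fadd. rewrite plus_IZR. ring.
      * now apply is_series_Rplus.
Qed.

Lemma IZR_zsum F n : IZR (zsum F n) = sum_f_R0 (fun i => IZR (F i)) n.
Proof. induction n as [|n IH]; simpl; [reflexivity|]. now rewrite plus_IZR, IH. Qed.

Lemma sum_f_R0_scal_r (u : nat -> R) c n : sum_f_R0 u n * c = sum_f_R0 (fun i => u i * c) n.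
Proof. induction n as [|n IH]; simpl; [reflexivity|]. rewrite <- IH. ring. Qed.

Lemma sum_f_R0_minus (u v : nat -> R) n :
  sum_f_R0 (fun i => u i - v i) n = sum_f_R0 u n - sum_f_R0 v n.
Proof. induction n as [|n IH]; simpl; [reflexivity|]. rewrite IH. ring. Qed.

Lemma ev_mul z f g s s' : ev z f s -> ev z g s' -> ev z (f * g)%fps (s * s')%C.
Proof.
  intros [A [B B']] [A' [D D']].
  assert (aR : forall h, ex_series (fun n => Rabs (IZR (h n)) * trad z ^ n) ->
     ex_series (fun n => Rabs (Re (RtoC (IZR (h n)) * tq z n)%C))).
  { intros h Hh. apply (ex_series_Rle _ (fun n => Rabs (IZR (h n)) * trad z ^ n)); [|easy].
    intro n. rewrite Rabs_Rabsolu.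
    rewrite Re_RtoC_mul, Rabs_mult. apply Rmult_le_compat_l; [apply Rabs_pos|apply Re_tq_bound]. }
  assert (aI : forall h, ex_series (fun n => Rabs (IZR (h n)) * trad z ^ n) ->
     ex_series (fun n => Rabs (Im (RtoC (IZR (h n)) * tq z n)%C))).
  { intros h Hh. apply (ex_series_Rle _ (fun n => Rabs (IZR (h n)) * trad z ^ n)); [|easy].
    intro n. rewrite Rabs_Rabsolu.
    rewrite Im_RtoC_mul, Rabs_mult. apply Rmult_le_compat_l; [apply Rabs_pos|apply Im_tq_bound]. }
  assert (spl : forall i n, (i <= n)%nat -> tq z n = (tq z i * tq z (n - i))%C).
  { intros i n Hi. rewrite <- tq_add. f_equal. lia. }
  split.
  - assert (P : ex_series (fun n => sum_f_R0 (fun k => (Rabs (IZR (f k)) * trad z ^ k) *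
        (Rabs (IZR (g (n - k)%nat)) * trad z ^ (n - k))) n)).
    { destruct A as [a Ha], A' as [a' Ha']. exists (a * a').
      assert (N : forall h n, Rabs (Rabs (IZR (h n)) * trad z ^ n) = Rabs (IZR (h n)) * trad z ^ n).
      { intros h n. apply Rabs_pos_eq, Rmult_le_pos; [apply Rabs_pos|].
        left; apply pow_lt, exp_pos. }
      apply (is_series_mult (fun n => Rabs (IZR (f n)) * trad z ^ n)
        (fun n => Rabs (IZR (g n)) * trad z ^ n)); try easy.
      - exists a. eapply is_series_ext; [|exact Ha]. intro n. symmetry; apply N.
      - exists a'. eapply is_series_ext; [|exact Ha']. intro n. symmetry; apply N. }
    revert P. apply ex_series_Rle. intro n.
    assert (0 < trad z ^ n) by (apply pow_lt, exp_pos).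
    rewrite Rabs_mult, Rabs_Rabsolu, (Rabs_pos_eq (trad z ^ n)) by lra.
    unfold fmul. rewrite IZR_zsum.
    apply Rle_trans with (sum_f_R0 (fun i => Rabs (IZR (f i * g (n - i)%nat))) n * trad z ^ n).
    + apply Rmult_le_compat_r; [lra|]. apply Rsum_abs.
    + rewrite sum_f_R0_scal_r. apply Req_le, sum_eq. intros i Hi.
      rewrite mult_IZR, Rabs_mult. replace (trad z ^ n) with (trad z ^ i * trad z ^ (n - i)).
      ring. rewrite <- pow_add. f_equal. lia.
  - split.
    + eapply is_series_Rext; [|apply is_series_Rminus;
        [apply (is_series_mult _ _ _ _ B D (aR _ A) (aR _ A'))
        |apply (is_series_mult _ _ _ _ B' D' (aI _ A) (aI _ A'))]].
      intro n. rewrite Re_RtoC_mul. rewrite <- sum_f_R0_minus. unfold fmul. rewrite IZR_zsum, sum_f_R0_scal_r.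
      apply sum_eq; intros i Hi. rewrite mult_IZR, (spl i n Hi). simpl. ring.
    + eapply is_series_Rext; [|apply is_series_Rplus;
        [apply (is_series_mult _ _ _ _ B D' (aR _ A) (aI _ A'))
        |apply (is_series_mult _ _ _ _ B' D (aI _ A) (aR _ A'))]].
      intro n. rewrite Im_RtoC_mul. rewrite <- sum_plus. unfold fmul. rewrite IZR_zsum, sum_f_R0_scal_r.
      apply sum_eq; intros i Hi. rewrite mult_IZR, (spl i n Hi). simpl. ring.
Qed.

Lemma ev_sub z f g s s' : ev z f s -> ev z g s' -> ev z (f - g)%fps (s - s')%C.
Proof.
  intros Hf Hg. replace (f - g)%fps with (f + fC (-1) * g)%fps by ring.
  replace (s - s')%C with (s + RtoC (IZR (-1)) * s')%C.
  - apply ev_add; [easy|]. apply ev_mul; [apply ev_C|easy].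
  - destruct s, s'. unfold Cminus, Cplus, Cmult, Copp; simpl.
    apply injective_projections; simpl; ring.
Qed.

Lemma ev_pow z f s k : ev z f s -> ev z (f ^ k)%fps (s ^ k)%C.
Proof.
  intro H. induction k as [|k IH]; simpl; [apply ev_C|]. now apply ev_mul.
Qed.

Lemma is_series_sparse (u : nat -> R) s c d : (0 < d)%nat ->
  (forall n, u n <> 0 -> exists k, n = (c + d * k)%nat) ->
  is_series u s -> is_series (fun k => u (c + d * k)%nat) s.
Proof.
  intros Hd Hu H.
  assert (Z : forall n, (forall k, n <> (c + d * k)%nat) -> u n = 0).
  { intros n Hn. destruct (Req_dec (u n) 0) as [E|E]; [easy|].
    destruct (Hu n E) as [k Hk]. now destruct (Hn k). }
  assert (E : forall K, sum_n (fun k => u (c + d * k)%nat) K = sum_n u (c + d * K)).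
  { assert (Z0 : forall m, (m < c)%nat -> sum_n u m = 0).
    { induction m as [|m IH]; intro Hm.
      - rewrite sum_O. apply Z. intros k Hk. lia.
      - rewrite sum_Sn, IH, Z by (intros; lia). unfold plus; simpl; ring. }
    induction K as [|K IH].
    - rewrite sum_O, Nat.mul_0_r, Nat.add_0_r. destruct c as [|c']; [now rewrite sum_O|].
      rewrite sum_Sn, Z0 by lia. unfold plus; simpl; ring.
    - rewrite sum_Sn, IH.
      assert (Z1 : forall j, (j < d)%nat -> sum_n u (c + d * K + j) = sum_n u (c + d * K)).
      { induction j as [|j IHj]; intro Hj; [now rewrite Nat.add_0_r|].
        rewrite Nat.add_succ_r, sum_Sn, IHj, Z by
          (lia || (intros k Hk; destruct (Nat.le_gt_cases k K); nia)).
        unfold plus; simpl; ring. }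
      replace (c + d * S K)%nat with (S (c + d * K + (d - 1))) by lia.
      rewrite sum_Sn, Z1 by lia. reflexivity. }
  unfold is_series in *. apply (filterlim_ext (fun K => sum_n u (c + d * K))).
  { intro K. symmetry. apply E. }
  apply (filterlim_comp _ _ _ (fun K => (c + d * K)%nat) (sum_n u) _ eventually); [|easy].
  intros P [N HN]. exists N. intros n Hn. apply HN. nia.
Qed.

(** An expansion in the sense of [q_expansion] runs over one arithmetic progression, so the zero
    terms outside the support are dropped. The scalar k will restore the power of 1/16 or -1/16 that
    makes [Fform] and [Fsh] integral. *)
Lemma ev_sparse z f s c d (k : R) : (0 < d)%nat -> supp d c f -> ev z f s ->
  @is_series C_AbsRing C_NormedModule
    (fun n => (RtoC (k * IZR (f (c + d * n)%nat)) * tq z (c + d * n))%C) (RtoC k * s)%C.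
Proof.
  intros Hd Hs [_ [B B']]. apply cser_is_series. split.
  - rewrite Re_RtoC_mul.
    apply (is_series_Rext (fun n => k * (Re (RtoC (IZR (f (c + d * n)%nat)) * tq z (c + d * n))%C))).
    { intro n. rewrite !Re_RtoC_mul. ring. }
    apply is_series_Rscal.
    apply (is_series_sparse (fun n => Re (RtoC (IZR (f n)) * tq z n)%C)); try easy.
    intros n Hn. apply Hs. intro E. apply Hn. rewrite Re_RtoC_mul, E. ring.
  - rewrite Im_RtoC_mul.
    apply (is_series_Rext (fun n => k * (Im (RtoC (IZR (f (c + d * n)%nat)) * tq z (c + d * n))%C))).
    { intro n. rewrite !Im_RtoC_mul. ring. }
    apply is_series_Rscal.
    apply (is_series_sparse (fun n => Im (RtoC (IZR (f n)) * tq z n)%C)); try easy.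
    intros n Hn. apply Hs. intro E. apply Hn. rewrite Im_RtoC_mul, E. ring.
Qed.

(** * Theta functions as sums of their series in t *)

Fixpoint RS (M : nat) (g : Z -> R) : R :=
  match M with
  | O => g 0%Z
  | S m => RS m g + (g (Z.of_nat (S m)) + g (- Z.of_nat (S m))%Z)
  end.

Lemma IZR_ZS M H : IZR (ZS M H) = RS M (fun a => IZR (H a)).
Proof. induction M as [|M IH]; cbn [ZS RS]; [reflexivity|]. now rewrite !plus_IZR, IH. Qed.

Lemma RS_ext M f g :
  (forall a, (Z.abs a <= Z.of_nat M)%Z -> f a = g a) -> RS M f = RS M g.
Proof.
  induction M as [|M IH]; intros H; cbn [RS]; [apply H; lia|].
  rewrite IH, !H; [reflexivity | lia | lia |]. intros; apply H; lia.
Qed.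

Lemma RS_plus M f g : RS M (fun a => f a + g a) = RS M f + RS M g.
Proof. induction M as [|M IH]; cbn [RS]; [|rewrite IH]; ring. Qed.

Lemma RS_scal_r M c g : RS M (fun a => g a * c) = RS M g * c.
Proof. induction M as [|M IH]; cbn [RS]; [|rewrite IH]; ring. Qed.

Lemma RS_bound M g B : (forall a, (Z.abs a <= Z.of_nat M)%Z -> Rabs (g a) <= B) ->
  Rabs (RS M g) <= (2 * INR M + 1) * B.
Proof.
  induction M as [|M IH]; intros H; cbn [RS].
  - simpl. specialize (H 0%Z ltac:(lia)). lra.
  - rewrite S_INR. pose proof (H (Z.of_nat (S M)) ltac:(lia)).
    pose proof (H (- Z.of_nat (S M))%Z ltac:(lia)).
    assert (Rabs (RS M g) <= (2 * INR M + 1) * B) by (apply IH; intros; apply H; lia).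
    eapply Rle_trans; [apply Rabs_triang|].
    eapply Rle_trans; [apply Rplus_le_compat_l, Rabs_triang|]. lra.
Qed.

Lemma RS_sum_n M g :
  RS (S M) g = g 0%Z + sum_n (fun n => g (Z.of_nat (S n)) + g (- Z.of_nat (S n))%Z) M.
Proof.
  induction M as [|M IH]; [now rewrite sum_O|].
  change (RS (S (S M)) g)
    with (RS (S M) g + (g (Z.of_nat (S (S M))) + g (- Z.of_nat (S (S M)))%Z)).
  rewrite IH, sum_Sn. unfold plus; simpl. ring.
Qed.

Lemma ex_series_linear_geom r : 0 < r < 1 -> ex_series (fun n => (2 * INR n + 1) * r ^ n).
Proof.
  intros Hr.
  assert (P : forall n, 0 < (2 * INR n + 1) * r ^ n).
  { intro n. pose proof (pos_INR n). apply Rmult_lt_0_compat; [lra|]. apply pow_lt; lra. }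
  assert (E : ex_series (fun n => Rabs ((2 * INR n + 1) * r ^ n))).
  { apply (ex_series_DAlembert _ r); [lra| |].
    - intro n. specialize (P n). lra.
    - apply (is_lim_seq_ext (fun n => r + 2 * r * / (2 * INR n + 1))).
      + intro n. pose proof (pos_INR n). pose proof (pow_lt r n ltac:(lra)).
        rewrite Rabs_pos_eq.
        * rewrite S_INR. simpl. field. split; lra.
        * left. apply Rdiv_lt_0_compat; apply P.
      + replace (Finite r) with (Finite (r + 2 * r * 0)) by (f_equal; ring).
        apply is_lim_seq_plus'; [apply is_lim_seq_const|].
        apply is_lim_seq_mult'; [apply is_lim_seq_const|].
        apply (is_lim_seq_inv _ p_infty); [|easy].
        apply (is_lim_seq_le_p_loc INR); [|apply is_lim_seq_INR].
        exists O. intros n _. pose proof (pos_INR n). lra. }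
  revert E. apply ex_series_ext. intro n. apply Rabs_pos_eq. left. apply P.
Qed.

Lemma pow_le_antitone r m n : 0 < r < 1 -> (m <= n)%nat -> r ^ n <= r ^ m.
Proof.
  intros Hr Hmn. replace n with (m + (n - m))%nat by lia. rewrite pow_add.
  assert (r ^ (n - m) <= 1).
  { rewrite <- (pow1 (n - m)). apply pow_incr. lra. }
  pose proof (pow_lt r m ltac:(lra)). nra.
Qed.

Definition thterm (e w : Z -> Z) (h : nat -> R) (a : Z) : R :=
  IZR (w a) * h (Z.to_nat (e a)).

(** Sorting the integers a by their exponent: the partial sum up to t^N collects exactly those with
    e a <= N. *)
Lemma thser_partial e w h M N : proper e -> (N <= M)%nat ->
  sum_n (fun n => IZR (thser e w n) * h n) N =
  RS M (fun a => if (e a <=? Z.of_nat N)%Z then thterm e w h a else 0).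
Proof.
  intro He. set (g := thterm e w h).
  assert (P : forall n, (n <= M)%nat -> IZR (thser e w n) * h n =
    RS M (fun a => if (e a =? Z.of_nat n)%Z then g a else 0)).
  { intros n Hn. rewrite (thser_big e w n M He Hn), IZR_ZS, <- RS_scal_r.
    apply RS_ext; intros a _. unfold ind, g, thterm.
    destruct (Z.eqb_spec (e a) (Z.of_nat n)) as [E|E].
    - now rewrite E, Nat2Z.id.
    - apply Rmult_0_l. }
  induction N as [|N IH]; intros HN.
  - rewrite sum_O, P by lia. apply RS_ext; intros a _. specialize (He a).
    destruct (Z.eqb_spec (e a) (Z.of_nat 0)), (Z.leb_spec (e a) (Z.of_nat 0)); try easy; lia.
  - rewrite sum_Sn, IH, P by lia. unfold plus; simpl. rewrite <- RS_plus.
    apply RS_ext; intros a _.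
    destruct (Z.leb_spec (e a) (Z.of_nat N)), (Z.eqb_spec (e a) (Z.pos (Pos.of_succ_nat N))),
      (Z.leb_spec (e a) (Z.pos (Pos.of_succ_nat N))); try ring; lia.
Qed.

Lemma thser_term_bound e w h r a : (forall b, (Z.abs (w b) <= 1)%Z) ->
  (forall n, Rabs (h n) <= r ^ n) -> Rabs (thterm e w h a) <= r ^ Z.to_nat (e a).
Proof.
  intros Hw Hh. unfold thterm. rewrite Rabs_mult. specialize (Hh (Z.to_nat (e a))).
  assert (Rabs (IZR (w a)) <= 1) by (rewrite <- abs_IZR; apply IZR_le, Hw).
  pose proof (Rabs_pos (h (Z.to_nat (e a)))). nra.
Qed.

Lemma thser_ex_series (e w : Z -> Z) (h : nat -> R) (r : R) : proper e ->
  (forall a, (Z.abs (w a) <= 1)%Z) -> 0 < r < 1 -> (forall n, Rabs (h n) <= r ^ n) ->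
  ex_series (fun n => thterm e w h (Z.of_nat (S n)) + thterm e w h (- Z.of_nat (S n))%Z).
Proof.
  intros He Hw Hr Hh. set (g := thterm e w h).
  apply (ex_series_Rle _ (fun n => (2 * INR n + 1) * r ^ n + (2 * INR n + 1) * r ^ n)).
  - intro n. eapply Rle_trans; [apply Rabs_triang|].
    assert (P : forall a, (Z.of_nat n <= Z.abs a)%Z -> Rabs (g a) <= (2 * INR n + 1) * r ^ n).
    { intros a Ha. eapply Rle_trans; [now apply (thser_term_bound e w h r)|].
      apply Rle_trans with (r ^ n).
      - apply pow_le_antitone; [easy|]. specialize (He a). lia.
      - pose proof (pow_lt r n ltac:(lra)). pose proof (pos_INR n). nra. }
    apply Rplus_le_compat; apply P; lia.
  - destruct (ex_series_linear_geom r Hr) as [l Hl]. exists (l + l). now apply is_series_Rplus.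
Qed.

Lemma thterm_RS_lim (e w : Z -> Z) (h : nat -> R) (r : R) : proper e ->
  (forall a, (Z.abs (w a) <= 1)%Z) -> 0 < r < 1 -> (forall n, Rabs (h n) <= r ^ n) ->
  is_lim_seq (fun N => RS N (thterm e w h)) (thterm e w h 0%Z + Series (fun n =>
    thterm e w h (Z.of_nat (S n)) + thterm e w h (- Z.of_nat (S n))%Z)).
Proof.
  intros He Hw Hr Hh. apply is_lim_seq_incr_1.
  apply (is_lim_seq_ext _ _ _ (fun N => eq_sym (RS_sum_n N (thterm e w h)))).
  apply is_lim_seq_plus'; [apply is_lim_seq_const|].
  apply (Series_correct _ (thser_ex_series e w h r He Hw Hr Hh)).
Qed.

(** The symmetric sum over [-N, N] and the sum over e a <= N differ by terms with e a > N. There are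
    at most 2 N + 1 of them, each at most r^N. *)
Lemma thser_is_series (e w : Z -> Z) (h : nat -> R) (r : R) : proper e ->
  (forall a, (Z.abs (w a) <= 1)%Z) -> 0 < r < 1 -> (forall n, Rabs (h n) <= r ^ n) ->
  is_series (fun n => IZR (thser e w n) * h n) (thterm e w h 0%Z + Series (fun n =>
    thterm e w h (Z.of_nat (S n)) + thterm e w h (- Z.of_nat (S n))%Z)).
Proof.
  intros He Hw Hr Hh. set (g := thterm e w h).
  set (L := g 0%Z + _).
  pose proof (thterm_RS_lim e w h r He Hw Hr Hh) as A. fold g L in A.
  assert (B : is_lim_seq (fun N => RS N (fun a => if (e a <=? Z.of_nat N)%Z then 0 else g a)) 0).
  { apply is_lim_seq_abs_0.
    apply (is_lim_seq_le_le (fun _ => 0) _ (fun N => (2 * INR N + 1) * r ^ N)).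
    - intro N. split; [apply Rabs_pos|]. apply RS_bound. intros a _.
      destruct (Z.leb_spec (e a) (Z.of_nat N)).
      + rewrite Rabs_R0. apply pow_le; lra.
      + eapply Rle_trans; [now apply (thser_term_bound e w h r)|]. apply pow_le_antitone; [easy|lia].
    - apply is_lim_seq_const.
    - apply ex_series_lim_0, ex_series_linear_geom, Hr. }
  assert (D : is_lim_seq (fun N => RS N g
     - RS N (fun a => if (e a <=? Z.of_nat N)%Z then 0 else g a)) (L - 0)).
  { apply is_lim_seq_minus'; easy. }
  rewrite Rminus_0_r in D. revert D. apply is_lim_seq_ext. intro N.
  match goal with |- ?l = _ =>
    change (l = @sum_n R_AbelianMonoid (fun n => IZR (thser e w n) * h n) N) end.
  rewrite (thser_partial e w h N N) by (auto; lia). fold g.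
  enough (RS N g = RS N (fun a => if (e a <=? Z.of_nat N)%Z then g a else 0)
    + RS N (fun a => if (e a <=? Z.of_nat N)%Z then 0 else g a)) by lra.
  rewrite <- RS_plus. apply RS_ext. intros a _. destruct (_ <=? _)%Z; ring.
Qed.

Lemma thser_abs_bound e w n : (forall a, (Z.abs (w a) <= 1)%Z) ->
  Rabs (IZR (thser e w n)) <= 2 * INR n + 1.
Proof.
  intros Hw. unfold thser. rewrite IZR_ZS.
  rewrite <- (Rmult_1_r (2 * INR n + 1)). apply RS_bound. intros a _.
  rewrite <- abs_IZR. apply IZR_le. specialize (Hw a).
  unfold ind. destruct (e a =? Z.of_nat n)%Z; [exact Hw | easy].
Qed.

Lemma ev_thser z e w : 0 < Im z -> proper e -> (forall a, (Z.abs (w a) <= 1)%Z) ->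
  ev z (thser e w) (ZSum (fun a => (RtoC (IZR (w a)) * qpow z (IZR (e a) / 4))%C)).
Proof.
  intros Hz He Hw. pose proof (trad_bound z Hz) as Hr. split; [|split].
  - apply (ex_series_Rle _ (fun n => (2 * INR n + 1) * trad z ^ n)).
    + intro n. pose proof (pow_lt (trad z) n ltac:(lra)).
      rewrite Rabs_mult, Rabs_Rabsolu, (Rabs_pos_eq (trad z ^ n)) by lra.
      apply Rmult_le_compat_r; [lra|]. now apply thser_abs_bound.
    + now apply ex_series_linear_geom.
  - pose proof (thser_is_series e w (fun n => Re (tq z n)) (trad z) He Hw Hr (Re_tq_bound z)) as HS.
    replace (Re (ZSum _)) with
      (IZR (w 0%Z) * Re (tq z (Z.to_nat (e 0%Z))) + Series (fun n =>
         IZR (w (Z.of_nat (S n))) * Re (tq z (Z.to_nat (e (Z.of_nat (S n))))) +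
         IZR (w (- Z.of_nat (S n))%Z) * Re (tq z (Z.to_nat (e (- Z.of_nat (S n))%Z))))).
    + revert HS. apply is_series_Rext. intro n. now rewrite Re_RtoC_mul.
    + assert (T : forall a, Re (RtoC (IZR (w a)) * qpow z (IZR (e a) / 4))%C
        = IZR (w a) * Re (tq z (Z.to_nat (e a)))).
      { intro a. rewrite Re_RtoC_mul. unfold tq. rewrite INR_IZR_INZ, Z2Nat.id; [reflexivity|].
        specialize (He a). lia. }
      unfold ZSum, CSeries.
      change (Re (?a + (?b, ?c))%C) with (Re a + b).
      rewrite T. f_equal. apply Series_ext. intro n.
      change (Re (?a + ?b)%C) with (Re a + Re b). now rewrite !T.
  - pose proof (thser_is_series e w (fun n => Im (tq z n)) (trad z) He Hw Hr (Im_tq_bound z)) as HS.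
    replace (Im (ZSum _)) with
      (IZR (w 0%Z) * Im (tq z (Z.to_nat (e 0%Z))) + Series (fun n =>
         IZR (w (Z.of_nat (S n))) * Im (tq z (Z.to_nat (e (Z.of_nat (S n))))) +
         IZR (w (- Z.of_nat (S n))%Z) * Im (tq z (Z.to_nat (e (- Z.of_nat (S n))%Z))))).
    + revert HS. apply is_series_Rext. intro n. now rewrite Im_RtoC_mul.
    + assert (T : forall a, Im (RtoC (IZR (w a)) * qpow z (IZR (e a) / 4))%C
        = IZR (w a) * Im (tq z (Z.to_nat (e a)))).
      { intro a. rewrite Im_RtoC_mul. unfold tq. rewrite INR_IZR_INZ, Z2Nat.id; [reflexivity|].
        specialize (He a). lia. }
      unfold ZSum, CSeries.
      change (Im (?a + (?b, ?c))%C) with (Im a + c).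
      rewrite T. f_equal. apply Series_ext. intro n.
      change (Im (?a + ?b)%C) with (Im a + Im b). now rewrite !T.
Qed.

Lemma zone_bound a : (Z.abs (zone a) <= 1)%Z.
Proof. easy. Qed.
Lemma zsgn_bound a : (Z.abs (zsgn a) <= 1)%Z.
Proof. unfold zsgn. now destruct (Z.even a). Qed.

(** The limit of symmetric sums is the form in which theta_3 enters Poisson summation. *)
Lemma theta3_RS_lim z : 0 < Im z ->
  is_lim_seq (fun N => RS N (fun n => Re (qpow z (IZR n ^ 2)))) (Re (theta3 z)) /\
  is_lim_seq (fun N => RS N (fun n => Im (qpow z (IZR n ^ 2)))) (Im (theta3 z)).
Proof.
  intro Hz. pose proof (trad_bound z Hz) as Hr.
  assert (T : forall (f : C -> R) a, thterm e3 zone (fun n => f (tq z n)) a = f (qpow z (IZR a ^ 2))).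
  { intros f a. unfold thterm, zone, tq, e3. rewrite Rmult_1_l. do 2 f_equal.
    rewrite INR_IZR_INZ, Z2Nat.id by nia. rewrite mult_IZR, (pow_IZR a 2). simpl Z.of_nat. field. }
  split.
  - pose proof (thterm_RS_lim e3 zone (fun n => Re (tq z n)) (trad z) proper_e3 zone_bound Hr
      (Re_tq_bound z)) as A.
    rewrite T in A.
    rewrite (Series_ext _ _ (fun n => f_equal2 Rplus (T Re (Z.of_nat (S n)))
      (T Re (- Z.of_nat (S n))%Z))) in A.
    revert A. apply is_lim_seq_ext. intro N. apply RS_ext. intros a _. apply T.
  - pose proof (thterm_RS_lim e3 zone (fun n => Im (tq z n)) (trad z) proper_e3 zone_bound Hr
      (Im_tq_bound z)) as A.
    rewrite T in A.
    rewrite (Series_ext _ _ (fun n => f_equal2 Rplus (T Im (Z.of_nat (S n)))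
      (T Im (- Z.of_nat (S n))%Z))) in A.
    revert A. apply is_lim_seq_ext. intro N. apply RS_ext. intros a _. apply T.
Qed.

Lemma ev_th3 z : 0 < Im z -> ev z th3 (theta3 z).
Proof.
  intro Hz. replace (theta3 z) with (ZSum (fun a => (RtoC (IZR (zone a)) * qpow z (IZR (e3 a) / 4))%C)).
  - apply ev_thser; auto using proper_e3, zone_bound.
  - unfold theta3. f_equal. extensionality a. unfold zone, e3.
    rewrite Cmult_1_l. f_equal. rewrite mult_IZR, (pow_IZR a 2). simpl Z.of_nat. field.
Qed.

Lemma ev_th2 z : 0 < Im z -> ev z th2 (theta2 z).
Proof.
  intro Hz. replace (theta2 z) with (ZSum (fun a => (RtoC (IZR (zone a)) * qpow z (IZR (e2 a) / 4))%C)).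
  - apply ev_thser; auto using proper_e2, zone_bound.
  - unfold theta2. f_equal. extensionality a. unfold zone, e2.
    rewrite Cmult_1_l. f_equal. rewrite <- (pow_IZR _ 2), plus_IZR, mult_IZR. field.
Qed.

Lemma ev_th4 z : 0 < Im z -> ev z th4 (theta4 z).
Proof.
  intro Hz. replace (theta4 z) with (ZSum (fun a => (RtoC (IZR (zsgn a)) * qpow z (IZR (e3 a) / 4))%C)).
  - apply ev_thser; auto using proper_e3, zsgn_bound.
  - unfold theta4. f_equal. extensionality a. f_equal.
    + f_equal. unfold zsgn. destruct (Z.Even_or_Odd a) as [Ha|Ha].
      * rewrite (proj2 (Z.even_spec a) Ha). destruct Ha as [k ->].
        replace (Z.to_nat (2 * k * (2 * k))) with (2 * Z.to_nat (2 * k * k))%nat by lia.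
        now rewrite pow_1_even.
      * rewrite <- Z.negb_odd, (proj2 (Z.odd_spec a) Ha). destruct Ha as [k ->].
        replace (Z.to_nat ((2 * k + 1) * (2 * k + 1)))
          with (S (2 * Z.to_nat (2 * k * (k + 1)))) by nia.
        now rewrite pow_1_odd.
    + unfold e3. f_equal. rewrite mult_IZR, (pow_IZR a 2). simpl Z.of_nat. field.
Qed.

Lemma ev_Fform z eps alpha beta : 0 < Im z ->
  ev z (Fform eps alpha beta) ((theta4 z ^ 4 - theta2 z ^ 4) ^ eps * theta3 z ^ alpha
    * (theta2 z ^ 4 * theta4 z ^ 4) ^ beta)%C.
Proof.
  intro Hz. pose proof (ev_th2 z Hz). pose proof (ev_th3 z Hz). pose proof (ev_th4 z Hz).
  unfold Fform. auto 6 using ev_mul, ev_pow, ev_sub.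
Qed.

Lemma ev_Fsh z eps alpha beta : 0 < Im z ->
  ev z (Fsh eps alpha beta) ((theta3 z ^ 4 + theta4 z ^ 4) ^ eps * theta2 z ^ alpha
    * (theta3 z ^ 4 * theta4 z ^ 4) ^ beta)%C.
Proof.
  intro Hz. pose proof (ev_th2 z Hz). pose proof (ev_th3 z Hz). pose proof (ev_th4 z Hz).
  unfold Fsh. auto 6 using ev_mul, ev_pow, ev_add.
Qed.

Lemma f_vanish_intro eps alpha beta (P : R -> Prop) :
  (forall n, P (INR n) -> Fform eps alpha beta (4 * n)%nat = 0%Z) ->
  f_vanish eps alpha beta P.
Proof.
  intro H. exists (fun n => RtoC ((/ 16) ^ beta * IZR (Fform eps alpha beta (0 + 4 * n)%nat))).
  split.
  - intros z Hz.
    pose proof (ev_sparse z _ _ 0 4 ((/ 16) ^ beta) ltac:(lia)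
      (supp_Fform eps alpha beta) (ev_Fform z eps alpha beta Hz)) as HS.
    replace (form eps alpha beta z) with (RtoC ((/ 16) ^ beta) *
      ((theta4 z ^ 4 - theta2 z ^ 4) ^ eps * theta3 z ^ alpha
    * (theta2 z ^ 4 * theta4 z ^ 4) ^ beta))%C.
    + revert HS. apply is_series_ext. intro n. f_equal. unfold tq. f_equal.
      rewrite plus_INR, mult_INR. simpl (INR 4). simpl (INR 0). field.
    + unfold form, phi, Delta8. rewrite RtoC_pow, !Cpow_mult_l. ring.
  - intros n Hn. rewrite Nat.add_0_l, H; [f_equal; ring|].
    replace (INR n) with (0 + 1 * INR n) by ring. easy.
Qed.

(** * Poisson summation by Fejer kernels *)

Definition dirichlet (j : nat) (s : R) : R := RS j (fun k => cos (2 * PI * IZR k * s)).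
(** The Fejer kernel without the factor 1 / (m + 1), so that its integral over a period is m + 1. *)
Definition fejer (m : nat) (s : R) : R := sum_f_R0 (fun j => dirichlet j s) m.

Lemma dirichlet_S j s :
  dirichlet (S j) s = dirichlet j s + 2 * cos (2 * PI * INR (S j) * s).
Proof.
  unfold dirichlet. cbn [RS]. rewrite opp_IZR, <- INR_IZR_INZ.
  replace (2 * PI * - INR (S j) * s) with (- (2 * PI * INR (S j) * s)) by ring.
  rewrite cos_neg. ring.
Qed.

Lemma dirichlet_sin j s : dirichlet j s * sin (PI * s) = sin ((2 * INR j + 1) * (PI * s)).
Proof.
  induction j as [|j IH].
  - unfold dirichlet. simpl. replace (2 * PI * 0 * s) with 0 by ring. rewrite cos_0.
    replace ((2 * 0 + 1) * (PI * s)) with (PI * s) by ring. ring.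
  - rewrite dirichlet_S, Rmult_plus_distr_r, IH, S_INR.
    set (u := PI * s).
    replace (2 * PI * (INR j + 1) * s) with (2 * (INR j + 1) * u) by (unfold u; ring).
    replace ((2 * INR j + 1) * u) with (2 * (INR j + 1) * u - u) by ring.
    replace ((2 * (INR j + 1) + 1) * u) with (2 * (INR j + 1) * u + u) by ring.
    rewrite sin_minus, sin_plus. ring.
Qed.

(** The sum telescopes, since sin ((2 v + 1) u) sin u is the difference of the squared sines at (v +
    1) u and v u. *)
Lemma fejer_sin m s : fejer m s * (sin (PI * s)) ^ 2 = (sin (INR (S m) * (PI * s))) ^ 2.
Proof.
  assert (E : forall v u, sin ((2 * v + 1) * u) * sin u = sin ((v + 1) * u) ^ 2 - sin (v * u) ^ 2).
  { intros v u. replace ((2 * v + 1) * u) with ((v + 1) * u + v * u) by ring.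
    replace u with ((v + 1) * u - v * u) at 3 by ring.
    rewrite sin_plus, sin_minus.
    set (a := (v + 1) * u). set (b := v * u).
    transitivity (sin a ^ 2 * cos b ^ 2 - cos a ^ 2 * sin b ^ 2); [ring|].
    pose proof (sin2_cos2 a) as Ha. pose proof (sin2_cos2 b) as Hb. unfold Rsqr in *.
    replace (cos b ^ 2) with (1 - sin b ^ 2) by (simpl; lra).
    replace (cos a ^ 2) with (1 - sin a ^ 2) by (simpl; lra). ring. }
  induction m as [|m IH].
  - unfold fejer. simpl sum_f_R0.
    transitivity (dirichlet 0 s * sin (PI * s) * sin (PI * s)); [ring|].
    rewrite dirichlet_sin, E. simpl INR.
    replace (0 * (PI * s)) with 0 by ring. rewrite sin_0.
    replace ((0 + 1) * (PI * s)) with (1 * (PI * s)) by ring. ring.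
  - unfold fejer in *. cbn [sum_f_R0]. rewrite Rmult_plus_distr_r, IH.
    transitivity (sin (INR (S m) * (PI * s)) ^ 2
      + dirichlet (S m) s * sin (PI * s) * sin (PI * s)); [ring|].
    rewrite dirichlet_sin, E, (S_INR (S m)). ring.
Qed.

Lemma fejer_0 m : 0 <= fejer m 0.
Proof.
  assert (D : forall j, 0 <= dirichlet j 0).
  { induction j as [|j IH].
    - unfold dirichlet; simpl. rewrite Rmult_0_r, cos_0. lra.
    - rewrite dirichlet_S, Rmult_0_r, cos_0. lra. }
  unfold fejer. induction m as [|m IH]; simpl; [apply D|]. specialize (D (S m)). lra.
Qed.

Lemma sin_PI_lower s : Rabs s <= / 2 -> s ^ 2 <= (sin (PI * s)) ^ 2.
Proof.
  intro Hs. pose proof PI_RGT_0. pose proof PI_4. pose proof PI2_3_2.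
  assert (P : forall t, 0 <= t <= / 2 -> t <= sin (PI * t)).
  { intros t Ht.
    (* With u = PI t in [0, 2] the cubic Taylor bound u - u^3 / 6 is at least u / 3, and u >= 3
       t. *)
    pose proof (pre_sin_bound (PI * t) 0 ltac:(nra) ltac:(nra)) as [Hl _].
    unfold sin_approx, sin_term in Hl. simpl in Hl.
    set (u := PI * t) in *. assert (0 <= u <= 2) by (unfold u; nra).
    assert (u * u * u <= 4 * u) by nra.
    apply Rle_trans with (u - u * u * u / 6); [|lra].
    assert (3 * t <= u) by (unfold u; nra). lra. }
  destruct (Rle_dec 0 s).
  - rewrite Rabs_pos_eq in Hs by easy. specialize (P s ltac:(lra)). nra.
  - rewrite Rabs_left in Hs by lra. specialize (P (- s) ltac:(lra)).
    replace (PI * - s) with (- (PI * s)) in P by ring. rewrite sin_neg in P. nra.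
Qed.

Lemma fejer_nonneg m s : Rabs s <= / 2 -> 0 <= fejer m s.
Proof.
  intro Hs. destruct (Req_dec s 0) as [->|Hn]; [apply fejer_0|].
  pose proof (sin_PI_lower s Hs). pose proof (fejer_sin m s) as E.
  assert (0 < s ^ 2) by (simpl; nra).
  pose proof (pow2_ge_0 (sin (INR (S m) * (PI * s)))). nra.
Qed.

Lemma fejer_upper m s : Rabs s <= / 2 -> fejer m s * s ^ 2 <= 1.
Proof.
  intro Hs. pose proof (sin_PI_lower s Hs). pose proof (fejer_sin m s) as E.
  pose proof (fejer_nonneg m s Hs).
  pose proof (SIN_bound (INR (S m) * (PI * s))).
  assert (sin (INR (S m) * (PI * s)) ^ 2 <= 1) by nra. nra.
Qed.

(** Split at distance d from 0: inside, the first term suffices; outside, [fejer_upper] bounds the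
    left side by 1 / d. *)
Lemma fejer_weight m s d : Rabs s <= / 2 -> 0 < d -> Rabs s * fejer m s <= d * fejer m s + / d.
Proof.
  intros Hs Hd. pose proof (fejer_nonneg m s Hs). pose proof (fejer_upper m s Hs) as U.
  assert (0 < / d) by now apply Rinv_0_lt_compat.
  destruct (Rle_dec (Rabs s) d) as [H1|H1]; [nra|].
  assert (s ^ 2 = Rabs s * Rabs s) by (rewrite <- Rabs_mult, Rabs_pos_eq; simpl; nra).
  apply Rle_trans with (/ d); [|nra].
  apply Rmult_le_reg_r with d; [easy|]. rewrite Rinv_l by lra.
  apply Rle_trans with (Rabs s * fejer m s * Rabs s); [|rewrite H2 in U; lra].
  apply Rmult_le_compat_l; [|lra]. apply Rmult_le_pos; [apply Rabs_pos|easy].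
Qed.

Lemma continuous_dirichlet j s : continuous (dirichlet j) s.
Proof.
  induction j as [|j IH].
  - apply (continuous_ext (fun _ => 1)); [|apply continuous_const].
    intro x. unfold dirichlet; simpl. replace (2 * PI * 0 * x) with 0 by ring. now rewrite cos_0.
  - apply (continuous_ext (fun x => plus (dirichlet j x) (2 * cos (2 * PI * INR (S j) * x)))).
    { intro x. now rewrite dirichlet_S. }
    apply (continuous_plus (V := R_NormedModule)); [easy|].
    apply ex_derive_continuous. auto_derive. easy.
Qed.

Lemma continuous_fejer m s : continuous (fejer m) s.
Proof.
  unfold fejer. induction m as [|m IH]; simpl; [apply continuous_dirichlet|].
  apply (continuous_plus (V := R_NormedModule) (fun s => sum_f_R0 (fun j => dirichlet j s) m)
    (dirichlet (S m))); [easy|apply continuous_dirichlet].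
Qed.

Lemma fejer_periodic m (n : Z) s : fejer m (IZR n + s) = fejer m s.
Proof.
  unfold fejer. apply sum_eq. intros j _. unfold dirichlet. apply RS_ext. intros k _.
  replace (2 * PI * IZR k * (IZR n + s)) with (2 * PI * IZR k * s + 2 * IZR (k * n) * PI)
    by (rewrite mult_IZR; ring).
  generalize (2 * PI * IZR k * s). intro x. generalize (k * n)%Z. intro l.
  destruct (Z.le_gt_cases 0 l).
  - rewrite <- (Z2Nat.id l) by lia. rewrite <- INR_IZR_INZ. apply cos_period.
  - rewrite <- (cos_period (x + 2 * IZR l * PI) (Z.to_nat (- l))).
    rewrite INR_IZR_INZ, Z2Nat.id, opp_IZR by lia. f_equal. ring.
Qed.

Lemma is_RInt_Req (f : R -> R) a b (l l' : R) : l = l' -> is_RInt f a b l -> is_RInt f a b l'.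
Proof. now intros ->. Qed.

Lemma RInt_dirichlet j : is_RInt (dirichlet j) (- / 2) (/ 2) 1.
Proof.
  induction j as [|j IH].
  - apply (is_RInt_ext (fun _ => 1)).
    { intros x _. unfold dirichlet; simpl. replace (2 * PI * 0 * x) with 0 by ring.
      now rewrite cos_0. }
    pose proof (is_RInt_const (V := R_NormedModule) (- / 2) (/ 2) 1) as H.
    revert H. apply is_RInt_Req. unfold scal; simpl; unfold mult; simpl. field.
  - apply (is_RInt_ext (fun x => plus (dirichlet j x) (2 * cos (2 * PI * INR (S j) * x)))).
    { intros x _. now rewrite dirichlet_S. }
    apply (is_RInt_Req _ _ _ (plus 1 0)); [unfold plus; simpl; ring|].
    apply (is_RInt_plus (V := R_NormedModule)); [easy|].
    pose proof PI_RGT_0. assert (0 < INR (S j)) by (apply lt_0_INR; lia).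
    set (a := INR (S j)) in *.
    apply (is_RInt_Req _ _ _ (minus (sin (2 * PI * a * / 2) / (PI * a)) (sin (2 * PI * a * - / 2) / (PI * a)))).
    2: apply (is_RInt_derive (V := R_CompleteNormedModule) (fun x => sin (2 * PI * a * x) / (PI * a))
        (fun x => 2 * cos (2 * PI * a * x))).
    2: { intros x _. auto_derive; [easy|]. field. split; lra. }
    2: { intros x _. apply (ex_derive_continuous (fun x => 2 * cos (2 * PI * a * x))).
      auto_derive. easy. }
    replace (2 * PI * a * / 2) with (a * PI) by field.
    replace (2 * PI * a * - / 2) with (- (a * PI)) by field.
    rewrite sin_neg. unfold minus, plus, opp; simpl.
    replace (sin (a * PI)) with 0; [field; split; lra|].
    symmetry. apply sin_eq_0_1. exists (Z.of_nat (S j)). unfold a. now rewrite INR_IZR_INZ.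
Qed.

Lemma RInt_fejer m : is_RInt (fejer m) (- / 2) (/ 2) (INR (S m)).
Proof.
  induction m as [|m IH]; [apply RInt_dirichlet|].
  rewrite S_INR.
  apply (is_RInt_ext (fun x => plus (fejer m x) (dirichlet (S m) x))); [easy|].
  apply (is_RInt_plus (V := R_NormedModule)); [easy|apply RInt_dirichlet].
Qed.
Lemma RS_abs_le N f g : (forall a, Rabs (f a) <= g a) -> Rabs (RS N f) <= RS N g.
Proof.
  intro H. induction N as [|N IH]; cbn [RS]; [apply H|].
  eapply Rle_trans; [apply Rabs_triang|]. apply Rplus_le_compat; [easy|].
  eapply Rle_trans; [apply Rabs_triang|]. apply Rplus_le_compat; apply H.
Qed.

Lemma ex_RInt_Rcont (f : R -> R) a b : (forall x, continuous f x) -> ex_RInt f a b.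
Proof. intro H. apply (ex_RInt_continuous (V := R_CompleteNormedModule)). auto. Qed.

Lemma continuous_Rmult (f g : R -> R) x :
  continuous f x -> continuous g x -> continuous (fun x => f x * g x) x.
Proof. apply (continuous_mult (K := R_AbsRing)). Qed.

(** By periodicity the kernel has mass m + 1 around every integer n. The error is the integral of
    the kernel against h (n + s) - h n, which is at most M times the absolute value of s, and
    [fejer_weight] integrates this. *)
Lemma fejer_piece (h h' : R -> R) m (n : Z) M d :
  (forall x, is_derive h x (h' x)) ->
  (forall s, Rabs s <= / 2 -> Rabs (h' (IZR n + s)) <= M) -> 0 < d ->
  Rabs (RInt (fun x => h x * fejer m x) (IZR n - / 2) (IZR n + / 2) - INR (S m) * h (IZR n))
  <= M * (d * INR (S m) + / d).
Proof.
  intros Hh HM Hd.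
  assert (Ch : forall x, continuous h x).
  { intro x. apply (ex_derive_continuous h). eexists. apply Hh. }
  assert (I1 : is_RInt (fun x => h x * fejer m x) (IZR n - / 2) (IZR n + / 2)
     (RInt (fun x => h x * fejer m x) (IZR n - / 2) (IZR n + / 2))).
  { apply (RInt_correct (V := R_CompleteNormedModule)), ex_RInt_Rcont.
    intro x. apply continuous_Rmult; [easy|apply continuous_fejer]. }
  set (P := RInt _ _ _) in *.
  assert (I2 : is_RInt (fun s => (h (IZR n + s) - h (IZR n)) * fejer m s) (- / 2) (/ 2)
     (P - INR (S m) * h (IZR n))).
  { replace (IZR n - / 2) with (1 * - / 2 + IZR n) in I1 by ring.
    replace (IZR n + / 2) with (1 * / 2 + IZR n) in I1 by ring.
    apply (is_RInt_comp_lin (V := R_NormedModule)) in I1.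
    pose proof (is_RInt_scal (V := R_NormedModule) _ _ _ (h (IZR n)) _ (RInt_fejer m)) as I3.
    pose proof (is_RInt_minus (V := R_NormedModule) _ _ _ _ _ _ I1 I3) as I4.
    apply (is_RInt_Req _ _ _ (minus P (scal (h (IZR n)) (INR (S m))))).
    { unfold minus, plus, opp, scal; simpl; unfold mult; simpl. ring. }
    revert I4. apply is_RInt_ext. intros s _.
    unfold minus, plus, opp, scal; simpl; unfold mult; simpl.
    replace (1 * s + IZR n) with (IZR n + s) by ring. rewrite fejer_periodic. ring. }
  assert (I3 : is_RInt (fun s => M * (d * fejer m s + / d)) (- / 2) (/ 2)
     (M * (d * INR (S m) + / d))).
  { pose proof (is_RInt_scal (V := R_NormedModule) _ _ _ d _ (RInt_fejer m)) as J1.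
    pose proof (is_RInt_const (V := R_NormedModule) (- / 2) (/ 2) (/ d)) as J2.
    pose proof (is_RInt_plus (V := R_NormedModule) _ _ _ _ _ _ J1 J2) as J3.
    pose proof (is_RInt_scal (V := R_NormedModule) _ _ _ M _ J3) as J4.
    revert J4. apply is_RInt_Req.
    unfold plus, scal; simpl; unfold mult; simpl. field. lra. }
  refine (norm_RInt_le (V := R_NormedModule) _ _ _ _ _ _ _ _ I2 I3); [lra|].
  intros s Hs. assert (As : Rabs s <= / 2) by (apply Rabs_le; lra).
  change (Rabs ((h (IZR n + s) - h (IZR n)) * fejer m s) <= M * (d * fejer m s + / d)).
  pose proof (fejer_nonneg m s As). pose proof (fejer_weight m s d As Hd).
  assert (M0 : 0 <= M) by (eapply Rle_trans; [apply Rabs_pos | apply (HM s As)]).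
  rewrite Rabs_mult, (Rabs_pos_eq (fejer m s)) by easy.
  apply Rle_trans with (M * Rabs s * fejer m s); [|rewrite Rmult_assoc; now apply Rmult_le_compat_l].
  apply Rmult_le_compat_r; [easy|].
  destruct (MVT_gen h (IZR n) (IZR n + s) h') as [c [Hc Ec]].
  - intros x _. apply Hh.
  - intros x _. apply continuity_pt_filterlim, Ch.
  - rewrite Ec, Rabs_mult. replace (IZR n + s - IZR n) with s by ring.
    apply Rmult_le_compat_r; [apply Rabs_pos|].
    replace c with (IZR n + (c - IZR n)) by ring. apply HM.
    unfold Rmin, Rmax in Hc. destruct (Rle_dec _ _); apply Rabs_le; unfold Rabs in As;
      destruct (Rcase_abs s); lra.
Qed.

(** Windows with half-integral ends split into unit intervals centred at the integers. *)
Lemma fejer_pieces (h h' : R -> R) m (M : Z -> R) d N :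
  (forall x, is_derive h x (h' x)) ->
  (forall n s, Rabs s <= / 2 -> Rabs (h' (IZR n + s)) <= M n) -> 0 < d ->
  Rabs (RInt (fun x => h x * fejer m x) (- (INR N + / 2)) (INR N + / 2)
        - INR (S m) * RS N (fun n => h (IZR n)))
  <= RS N M * (d * INR (S m) + / d).
Proof.
  intros Hh HM Hd.
  assert (Ex : forall a b, ex_RInt (fun x => h x * fejer m x) a b).
  { intros a b. apply ex_RInt_Rcont. intro x. apply continuous_Rmult; [|apply continuous_fejer].
    apply (ex_derive_continuous h). eexists. apply Hh. }
  set (P := fun n : Z => RInt (fun x => h x * fejer m x) (IZR n - / 2) (IZR n + / 2)).
  assert (E : RInt (fun x => h x * fejer m x) (- (INR N + / 2)) (INR N + / 2) = RS N P).
  { induction N as [|N IH].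
    - unfold P. simpl. f_equal; ring.
    - cbn [RS]. rewrite <- IH. unfold P. rewrite opp_IZR, <- INR_IZR_INZ, S_INR.
      rewrite <- (RInt_Chasles _ (- (INR N + 1 + / 2)) (- (INR N + / 2))) by apply Ex.
      rewrite <- (RInt_Chasles _ (- (INR N + / 2)) (INR N + / 2) (INR N + 1 + / 2)) by apply Ex.
      replace (- (INR N + 1) - / 2) with (- (INR N + 1 + / 2)) by ring.
      replace (- (INR N + 1) + / 2) with (- (INR N + / 2)) by field.
      replace (INR N + 1 - / 2) with (INR N + / 2) by field.
      unfold plus; simpl. ring. }
  rewrite E.
  replace (RS N P - INR (S m) * RS N (fun n => h (IZR n)))
    with (RS N (fun n => P n + h (IZR n) * - INR (S m)))
    by (rewrite RS_plus, RS_scal_r; ring).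
  rewrite <- RS_scal_r. apply RS_abs_le. intro n. unfold P.
  eapply Rle_trans; [|apply (fejer_piece h h' m n (M n) d Hh (HM n) Hd)].
  apply Req_le. f_equal. ring.
Qed.

Lemma fejer_lim (h : R -> R) (c : Z -> R) m : (forall x, continuous h x) ->
  (forall k, is_lim_seq (fun N => RInt (fun x => h x * cos (2 * PI * IZR k * x))
     (- (INR N + / 2)) (INR N + / 2)) (c k)) ->
  is_lim_seq (fun N => RInt (fun x => h x * fejer m x) (- (INR N + / 2)) (INR N + / 2))
    (sum_f_R0 (fun j => RS j c) m).
Proof.
  intros Ch Hc.
  assert (Add : forall (f g : R -> R) lf lg, (forall x, continuous f x) -> (forall x, continuous g x) ->
    is_lim_seq (fun N => RInt (fun x => h x * f x) (- (INR N + / 2)) (INR N + / 2)) (Finite lf) ->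
    is_lim_seq (fun N => RInt (fun x => h x * g x) (- (INR N + / 2)) (INR N + / 2)) (Finite lg) ->
    is_lim_seq (fun N => RInt (fun x => h x * (f x + g x)) (- (INR N + / 2)) (INR N + / 2))
      (Finite (lf + lg))).
  { intros f g lf lg Cf Cg Hf Hg.
    eapply is_lim_seq_ext; [|apply (is_lim_seq_plus' _ _ _ _ Hf Hg)].
    intro N. cbv beta.
    rewrite <- (RInt_plus (V := R_CompleteNormedModule)) by
      (apply ex_RInt_Rcont; intro; now apply continuous_Rmult).
    apply RInt_ext. intros x _. unfold plus; simpl. ring. }
  assert (Cc : forall k x, continuous (fun x => cos (2 * PI * k * x)) x).
  { intros k x. apply (ex_derive_continuous (fun x => cos (2 * PI * k * x))). auto_derive. easy. }
  assert (D : forall j, is_lim_seq (fun N => RInt (fun x => h x * dirichlet j x)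
      (- (INR N + / 2)) (INR N + / 2)) (RS j c)).
  { induction j as [|j IH]; [apply Hc|].
    unfold dirichlet in *. cbn [RS]. apply Add; [apply (continuous_dirichlet j)| | easy |].
    - intro x. apply (continuous_plus (V := R_NormedModule)
        (fun x => cos (2 * PI * _ * x)) (fun x => cos (2 * PI * _ * x))); apply Cc.
    - apply Add; auto. }
  induction m as [|m IH]; [apply D|].
  unfold fejer. cbn [sum_f_R0]. apply Add; auto using continuous_dirichlet.
  apply (continuous_fejer m).
Qed.

(** Divide the estimate of [fejer_pieces] by m + 1 and let N grow: the Cesaro mean of the partial
    sums of c is within L (d + 1 / (d (m + 1))) of G. Then m grows, so that the mean tends to S, and
    finally d shrinks. *)
Lemma fejer_poisson (h h' : R -> R) (c M : Z -> R) (L G S : R) :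
  (forall x, is_derive h x (h' x)) ->
  (forall n s, Rabs s <= / 2 -> Rabs (h' (IZR n + s)) <= M n) ->
  (forall N, RS N M <= L) ->
  (forall k, is_lim_seq (fun N => RInt (fun x => h x * cos (2 * PI * IZR k * x))
     (- (INR N + / 2)) (INR N + / 2)) (c k)) ->
  is_lim_seq (fun N => RS N (fun n => h (IZR n))) G ->
  is_lim_seq (fun j => RS j c) S -> G = S.
Proof.
  intros Hh HM HL Hc HG HS.
  assert (Ch : forall x, continuous h x).
  { intro x. apply (ex_derive_continuous h). eexists. apply Hh. }
  assert (B : forall d m, 0 < d ->
    Rabs (sum_f_R0 (fun j => RS j c) m / INR (Datatypes.S m) - G) <= L * (d + / d * / INR (Datatypes.S m))).
  { intros d m Hd. pose proof (fejer_lim h c m Ch Hc) as F.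
    set (K := INR (Datatypes.S m)). assert (HK : 0 < K) by (apply lt_0_INR; lia).
    assert (F2 : is_lim_seq (fun N => Rabs (/ K * RInt (fun x => h x * fejer m x)
        (- (INR N + / 2)) (INR N + / 2) - RS N (fun n => h (IZR n))))
        (Rabs (/ K * sum_f_R0 (fun j => RS j c) m - G))).
    { apply (is_lim_seq_abs _ (Finite _)). apply is_lim_seq_minus'; [|easy].
      apply (is_lim_seq_scal_l _ (/ K) (Finite _)). easy. }
    replace (sum_f_R0 (fun j => RS j c) m / K) with (/ K * sum_f_R0 (fun j => RS j c) m)
      by (unfold Rdiv; ring).
    refine (is_lim_seq_le _ (fun _ => L * (d + / d * / K)) (Finite _) (Finite _) _
      F2 (is_lim_seq_const _)).
    intro N.
    pose proof (fejer_pieces h h' m M d N Hh HM Hd) as P. fold K in P.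
    set (I := RInt _ _ _) in *. set (H := RS N _) in *.
    replace (/ K * I - H) with (/ K * (I - K * H)) by (field; lra).
    rewrite Rabs_mult, (Rabs_pos_eq (/ K)) by (left; now apply Rinv_0_lt_compat).
    assert (0 < / K) by now apply Rinv_0_lt_compat.
    assert (0 < / d) by now apply Rinv_0_lt_compat.
    apply Rle_trans with (/ K * (RS N M * (d * K + / d))); [now apply Rmult_le_compat_l; [lra|]|].
    replace (/ K * (RS N M * (d * K + / d))) with (RS N M * (d + / d * / K)) by (field; lra).
    apply Rmult_le_compat_r; [nra|apply HL]. }
  assert (Ces : is_lim_seq (fun m => sum_f_R0 (fun j => RS j c) m / INR (Datatypes.S m)) S).
  { apply is_lim_seq_Reals in HS. pose proof (Cesaro_1 _ _ HS) as C1.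
    apply is_lim_seq_Reals in C1. apply is_lim_seq_incr_1 in C1. exact C1. }
  assert (B2 : forall d, 0 < d -> Rabs (S - G) <= L * d).
  { intros d Hd.
    assert (F1 : is_lim_seq (fun m => Rabs (sum_f_R0 (fun j => RS j c) m / INR (Datatypes.S m) - G))
      (Rabs (S - G))).
    { apply (is_lim_seq_abs _ (Finite _)), is_lim_seq_minus'; [easy|apply is_lim_seq_const]. }
    assert (F2 : is_lim_seq (fun m => L * (d + / d * / INR (Datatypes.S m))) (L * (d + / d * 0))).
    { apply is_lim_seq_mult'; [apply is_lim_seq_const|].
      apply is_lim_seq_plus'; [apply is_lim_seq_const|].
      apply is_lim_seq_mult'; [apply is_lim_seq_const|].
      apply (is_lim_seq_inv _ p_infty); [|easy].
      apply -> (is_lim_seq_incr_1 INR). apply is_lim_seq_INR. }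
    rewrite Rmult_0_r, Rplus_0_r in F2.
    apply (is_lim_seq_le _ _ (Finite _) (Finite _) (fun m => B d m Hd) F1 F2). }
  assert (L0 : 0 <= L).
  { specialize (B2 1 ltac:(lra)). pose proof (Rabs_pos (S - G)). lra. }
  assert (Z : Rabs (S - G) <= 0).
  { apply Rnot_lt_le. intro H.
    (* This d makes L d at most half of the distance; L + 1 keeps the quotient defined when L =
       0. *)
    specialize (B2 (Rabs (S - G) / (2 * (L + 1))) ltac:(apply Rdiv_lt_0_compat; lra)).
    assert (L * (Rabs (S - G) / (2 * (L + 1))) <= Rabs (S - G) / 2).
    { apply Rmult_le_reg_r with (2 * (L + 1)); [lra|].
      replace (L * (Rabs (S - G) / (2 * (L + 1))) * (2 * (L + 1))) with (L * Rabs (S - G)) by (field; lra).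
      nra. }
    lra. }
  pose proof (Rabs_pos (S - G)). assert (E : Rabs (S - G) = 0) by lra.
  destruct (Req_dec (S - G) 0) as [E'|E']; [lra|]. now apply Rabs_no_R0 in E'.
Qed.

(** * Gaussian integrals along a homotopy of affine maps *)

(* With [a = (1 + t al) + i t be], [b = t (ga + i de)] and [y = a x + b = A + i B]:
   [gK = Re (exp (- i th) a exp (- PI y^2))],
   [gV = Re (exp (- i th) (d y / d t) exp (- PI y^2))],
   [gW] is the common value of [d gK / d t] and [d gV / d x]. *)
Definition gA (al ga t x : R) : R := (1 + t * al) * x + t * ga.
Definition gB (be de t x : R) : R := t * be * x + t * de.
Definition gexp (al be ga de t x : R) : R :=
  exp (- PI * (gA al ga t x * gA al ga t x + - (gB be de t x * gB be de t x))).
Definition gcos (al be ga de th t x : R) : R := cos (2 * PI * (gA al ga t x * gB be de t x) + th).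
Definition gsin (al be ga de th t x : R) : R := sin (2 * PI * (gA al ga t x * gB be de t x) + th).
Definition gK (al be ga de th t x : R) : R :=
  gexp al be ga de t x *
  ((1 + t * al) * gcos al be ga de th t x + t * be * gsin al be ga de th t x).
Definition gV (al be ga de th t x : R) : R :=
  gexp al be ga de t x *
  ((al * x + ga) * gcos al be ga de th t x + (be * x + de) * gsin al be ga de th t x).
Definition gW (al be ga de th t x : R) : R :=
  let m1 := gA al ga t x * (1 + t * al) - gB be de t x * (t * be) in
  let m2 := gA al ga t x * (t * be) + gB be de t x * (1 + t * al) in
  gexp al be ga de t x *
  ((al - 2 * PI * ((al * x + ga) * m1 - (be * x + de) * m2)) * gcos al be ga de th t x
   + (be - 2 * PI * ((al * x + ga) * m2 + (be * x + de) * m1)) * gsin al be ga de th t x).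

Lemma gK_derive al be ga de th t x :
  is_derive (fun t => gK al be ga de th t x) t (gW al be ga de th t x).
Proof.
  unfold gK, gW, gexp, gcos, gsin, gA, gB. auto_derive; [easy|]. ring.
Qed.

Lemma gV_derive al be ga de th t x :
  is_derive (fun x => gV al be ga de th t x) x (gW al be ga de th t x).
Proof.
  unfold gV, gW, gexp, gcos, gsin, gA, gB. auto_derive; [easy|]. ring.
Qed.

Ltac cont2d :=
  repeat first
  [ apply continuity_2d_pt_const | apply continuity_2d_pt_id1 | apply continuity_2d_pt_id2
  | apply continuity_2d_pt_plus | apply continuity_2d_pt_minus
  | apply continuity_2d_pt_mult | apply continuity_2d_pt_opp
  | apply continuity_1d_2d_pt_comp with (f := exp);
    [apply derivable_continuous_pt, derivable_pt_exp|]
  | apply continuity_1d_2d_pt_comp with (f := cos);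
    [apply derivable_continuous_pt, derivable_pt_cos|]
  | apply continuity_1d_2d_pt_comp with (f := sin);
    [apply derivable_continuous_pt, derivable_pt_sin|] ].

Lemma gW_continuous al be ga de th t x : continuity_2d_pt (gW al be ga de th) t x.
Proof. unfold gW, gexp, gcos, gsin, gA, gB. cont2d. Qed.

Lemma gK_continuous al be ga de th t x : continuous (gK al be ga de th t) x.
Proof.
  apply (ex_derive_continuous (gK al be ga de th t)).
  unfold gK, gexp, gcos, gsin, gA, gB. auto_derive. easy.
Qed.

Lemma gW_continuous_x al be ga de th t x : continuous (gW al be ga de th t) x.
Proof.
  apply (ex_derive_continuous (gW al be ga de th t)).
  unfold gW, gexp, gcos, gsin, gA, gB. auto_derive. easy.
Qed.

(** Closedness of the form: differentiating under the integral replaces d gK / d t by d gV / d x, so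
    along the homotopy the integral changes only by boundary values of [gV]. *)
Lemma gK_homotopy al be ga de th p q eps :
  (forall t, 0 <= t <= 1 -> Rabs (gV al be ga de th t q - gV al be ga de th t p) <= eps) ->
  Rabs (RInt (gK al be ga de th 1) p q - RInt (gK al be ga de th 0) p q) <= eps.
Proof.
  intro H.
  set (J := fun t => RInt (fun x => gK al be ga de th t x) p q).
  assert (D : forall t, is_derive J t (gV al be ga de th t q - gV al be ga de th t p)).
  { intro t.
    assert (E : RInt (fun x => Derive (fun u => gK al be ga de th u x) t) p q
      = gV al be ga de th t q - gV al be ga de th t p).
    { rewrite (RInt_ext _ (gW al be ga de th t)).
      2:{ intros x _. apply is_derive_unique, gK_derive. }
      apply is_RInt_unique.
      apply (is_RInt_derive (V := R_CompleteNormedModule) (gV al be ga de th t) (gW al be ga de th t)).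
      - intros x _. apply gV_derive.
      - intros x _. apply gW_continuous_x. }
    rewrite <- E. apply is_derive_RInt_param.
    - apply filter_forall. intros u x _. eexists. apply gK_derive.
    - intros x _. apply (continuity_2d_pt_ext (gW al be ga de th)).
      + intros u v. symmetry. apply is_derive_unique, gK_derive.
      + apply gW_continuous.
    - apply filter_forall. intro u. apply ex_RInt_Rcont. intro x. apply gK_continuous. }
  destruct (MVT_gen J 0 1 (fun t => gV al be ga de th t q - gV al be ga de th t p)) as [c [Hc Ec]].
  - intros t _. apply D.
  - intros t _. apply continuity_pt_filterlim. apply (ex_derive_continuous J). eexists. apply D.
  - rewrite Rmin_left, Rmax_right in Hc by lra.
    change (Rabs (J 1 - J 0) <= eps). rewrite Ec. replace (_ * (1 - 0)) with
      (gV al be ga de th c q - gV al be ga de th c p) by ring. now apply H.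
Qed.

Lemma exp_mono x y : x <= y -> exp x <= exp y.
Proof. intros [H|H]; [left; now apply exp_increasing|right; now rewrite H]. Qed.

(* For [|x|] large the real part of [y^2] exceeds [|x|] uniformly in [t]. *)
Lemma gV_decay (p q ga de : R) : 0 < p -> 0 < p * p - q * q ->
  exists X C, 0 <= C /\ forall th t x, 0 <= t <= 1 -> X <= Rabs x ->
    Rabs (gV (p - 1) q ga de th t x) <= C * exp (- Rabs x).
Proof.
  intros Hp Hpq.
  set (d := Rmin 1 (p * p - q * q) / 2).
  assert (Hd : 0 < d /\ 2 * d <= 1 /\ 2 * d <= p * p - q * q).
  { unfold d, Rmin. destruct (Rle_dec _ _); lra. }
  destruct Hd as [Hd0 [Hd1 Hd2]].
  set (c1 := 2 * ((1 + p) * Rabs ga + Rabs q * Rabs de)).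
  set (c0 := de * de).
  set (b := Rabs (p - 1) + Rabs ga + Rabs q + Rabs de).
  (* Beyond this threshold u = abs x satisfies d u^2 - c1 u >= 2 u. One half of the decay exp (- 2
     u) so gained absorbs the linear factor of [gV]. *)
  exists (1 + (c1 + 2) / d). exists (b * exp (PI * c0)).
  pose proof (Rabs_pos ga) as P1. pose proof (Rabs_pos de) as P2. pose proof (Rabs_pos q) as P3.
  pose proof (Rabs_pos (p - 1)) as P4. pose proof PI_RGT_0 as PI0. pose proof PI2_3_2 as PI3.
  assert (Hc1 : 0 <= c1) by (unfold c1; nra).
  split; [apply Rmult_le_pos; [unfold b; lra|left; apply exp_pos]|].
  intros th t x Ht Hx.
  set (u := Rabs x) in *.
  assert (Hx2 : x * x = u * u) by (unfold u; rewrite <- Rabs_mult, Rabs_pos_eq; nra).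
  assert (Hu1 : 1 <= u).
  { assert (0 <= (c1 + 2) / d) by (apply Rmult_le_pos; [lra|left; apply Rinv_0_lt_compat; lra]). lra. }
  assert (Hud : c1 + 2 <= d * u).
  { apply Rle_trans with (d * ((c1 + 2) / d)); [right; field; lra|].
    apply Rmult_le_compat_l; lra. }
  assert (Q : 2 * u - c0 <= gA (p - 1) ga t x * gA (p - 1) ga t x - gB q de t x * gB q de t x).
  { unfold gA, gB.
    set (r := 1 + t * (p - 1)).
    assert (Hr : 0 <= r <= 1 + p) by (unfold r; nra).
    replace ((r * x + t * ga) * (r * x + t * ga) - (t * q * x + t * de) * (t * q * x + t * de))
      with ((r * r - t * t * (q * q)) * (x * x) + 2 * t * x * (r * ga - t * (q * de))
            + t * t * (ga * ga) - t * t * (de * de)) by ring.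
    (* As r = (1 - t) + t p, the right side is (1 - t)^2 + 2 t (1 - t) p + t^2 (p^2 - q^2). It is at
       least 2 d ((1 - t)^2 + t^2), hence at least d. *)
    assert (L1 : d <= r * r - t * t * (q * q)).
    { assert (r * r - t * t * (q * q) = (1 - t) * (1 - t) + 2 * t * (1 - t) * p
         + t * t * (p * p - q * q)) by (unfold r; ring).
      assert (0 <= 2 * t * (1 - t) * p) by (apply Rmult_le_pos; nra).
      assert (t * t * (2 * d) <= t * t * (p * p - q * q))
        by (apply Rmult_le_compat_l; [apply Rle_0_sqr|lra]).
      assert ((1 - t) * (1 - t) * (2 * d) <= (1 - t) * (1 - t) * 1)
        by (apply Rmult_le_compat_l; [apply Rle_0_sqr|lra]).
      assert (0 <= d * ((2 * t - 1) * (2 * t - 1))) by (apply Rmult_le_pos; [lra|apply Rle_0_sqr]).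
      lra. }
    assert (L2 : Rabs (2 * t * x * (r * ga - t * (q * de))) <= c1 * u).
    { rewrite !Rabs_mult. fold u. rewrite (Rabs_pos_eq 2), (Rabs_pos_eq t) by lra.
      assert (Rabs (r * ga - t * (q * de)) <= (1 + p) * Rabs ga + Rabs q * Rabs de).
      { eapply Rle_trans; [apply Rabs_triang|]. rewrite Rabs_Ropp, !Rabs_mult.
        rewrite (Rabs_pos_eq r), (Rabs_pos_eq t) by lra.
        assert (0 <= Rabs q * Rabs de) by nra.
        apply Rplus_le_compat; [apply Rmult_le_compat_r; lra|nra]. }
      unfold c1.
      pose proof (Rabs_pos (r * ga - t * (q * de))).
      apply Rle_trans with (2 * 1 * u * ((1 + p) * Rabs ga + Rabs q * Rabs de)); [|lra].
      apply Rmult_le_compat; try nra. }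
    assert (L3 : d * (u * u) <= (r * r - t * t * (q * q)) * (x * x)).
    { rewrite Hx2. apply Rmult_le_compat_r; [apply Rle_0_sqr|lra]. }
    assert (L5 : - (c1 * u) <= 2 * t * x * (r * ga - t * (q * de))).
    { pose proof (Rle_abs (- (2 * t * x * (r * ga - t * (q * de))))) as L6.
      rewrite Rabs_Ropp in L6. lra. }
    assert (0 <= t * t * (ga * ga)) by (apply Rmult_le_pos; apply Rle_0_sqr).
    assert (t * t * (de * de) <= 1 * c0).
    { unfold c0. apply Rmult_le_compat_r; [apply Rle_0_sqr|]. clear - Ht. nra. }
    assert ((c1 + 2) * u <= d * u * u) by (apply Rmult_le_compat_r; lra). lra. }
  unfold gV. rewrite Rabs_mult.
  assert (G : gexp (p - 1) q ga de t x <= exp (PI * c0) * exp (- (2 * u)) ).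
  { unfold gexp. rewrite <- exp_plus.
    apply exp_mono. nra. }
  assert (G0 : 0 < gexp (p - 1) q ga de t x) by apply exp_pos.
  rewrite (Rabs_pos_eq (gexp _ _ _ _ _ _)) by lra.
  assert (T : Rabs (((p - 1) * x + ga) * gcos (p - 1) q ga de th t x
     + (q * x + de) * gsin (p - 1) q ga de th t x) <= b * exp u).
  { assert (Tc : Rabs (gcos (p - 1) q ga de th t x) <= 1) by (apply Rabs_le, COS_bound).
    assert (Ts : Rabs (gsin (p - 1) q ga de th t x) <= 1) by (apply Rabs_le, SIN_bound).
    assert (U1 : Rabs ((p - 1) * x + ga) <= Rabs (p - 1) * u + Rabs ga).
    { eapply Rle_trans; [apply Rabs_triang|]. rewrite Rabs_mult. fold u. lra. }
    assert (U2 : Rabs (q * x + de) <= Rabs q * u + Rabs de).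
    { eapply Rle_trans; [apply Rabs_triang|]. rewrite Rabs_mult. fold u. lra. }
    eapply Rle_trans; [apply Rabs_triang|]. rewrite !Rabs_mult.
    pose proof (Rabs_pos ((p - 1) * x + ga)). pose proof (Rabs_pos (q * x + de)).
    pose proof (exp_ineq1_le u).
    apply Rle_trans with (b * u).
    - unfold b. nra.
    - apply Rmult_le_compat_l; [unfold b; lra|lra]. }
  apply Rle_trans with (exp (PI * c0) * exp (- (2 * u)) * (b * exp u)).
  - apply Rmult_le_compat; try easy; [lra|apply Rabs_pos].
  - right. replace (- u) with (- (2 * u) + u) by ring. rewrite exp_plus. ring.
Qed.

(** The integrals increase with N, and comparison with 1 / (1 + x^2) bounds them by PI. The value of
    the limit is left open here and comes later from theta_3 at i. *)
Lemma gauss_lim : exists I0 : R,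
  is_lim_seq (fun N => RInt (fun x => exp (- PI * (x * x))) (- (INR N + / 2)) (INR N + / 2)) I0.
Proof.
  set (f := fun x => exp (- PI * (x * x))).
  assert (Cf : forall x, continuous f x).
  { intro x. apply (ex_derive_continuous f). unfold f. auto_derive. easy. }
  assert (Ex : forall a b, ex_RInt f a b) by (intros; now apply ex_RInt_Rcont).
  assert (Pos : forall a b, a <= b -> 0 <= RInt f a b).
  { intros a b Hab. apply RInt_ge_0; auto. intros x _. left. apply exp_pos. }
  apply (ex_finite_lim_seq_incr _ PI).
  - intro N. rewrite S_INR.
    rewrite <- (RInt_Chasles f (- (INR N + 1 + / 2)) (- (INR N + / 2)) (INR N + 1 + / 2)) by apply Ex.
    rewrite <- (RInt_Chasles f (- (INR N + / 2)) (INR N + / 2) (INR N + 1 + / 2)) by apply Ex.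
    pose proof (Pos (- (INR N + 1 + / 2)) (- (INR N + / 2)) ltac:(lra)).
    pose proof (Pos (INR N + / 2) (INR N + 1 + / 2) ltac:(lra)).
    unfold plus; simpl. lra.
  - intro N. pose proof (pos_INR N). set (r := INR N + / 2).
    assert (I : is_RInt (fun x => / (1 + x ^ 2)) (- r) r (atan r - atan (- r))).
    { apply (is_RInt_derive (V := R_CompleteNormedModule) atan (fun x => / (1 + x ^ 2))).
      - intros x _. apply is_derive_Reals.
        apply derivable_pt_lim_atan.
      - intros x _. apply (ex_derive_continuous (fun x => / (1 + x ^ 2))). auto_derive. nra. }
    apply Rle_trans with (RInt (fun x => / (1 + x ^ 2)) (- r) r).
    + apply RInt_le; [unfold r; lra | apply Ex | now exists (atan r - atan (- r)) |].
      intros x _. unfold f. rewrite Ropp_mult_distr_l_reverse, exp_Ropp.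
      apply Rinv_le_contravar; [nra|]. pose proof PI2_3_2.
      eapply Rle_trans; [|apply exp_ineq1_le]. nra.
    + rewrite (is_RInt_unique _ _ _ _ I). pose proof (atan_bound r). pose proof (atan_bound (- r)).
      lra.
Qed.

(** At t = 0 the affine map is the identity and the integrand is exp (- PI x^2) cos th. The boundary
    terms of the homotopy decay geometrically in N. *)
Lemma gK_lim p q ga de th (I0 : R) : 0 < p -> 0 < p * p - q * q ->
  is_lim_seq (fun N => RInt (fun x => exp (- PI * (x * x))) (- (INR N + / 2)) (INR N + / 2)) I0 ->
  is_lim_seq (fun N => RInt (gK (p - 1) q ga de th 1) (- (INR N + / 2)) (INR N + / 2))
    (I0 * cos th).
Proof.
  intros Hp Hpq HI.
  destruct (gV_decay p q ga de Hp Hpq) as [X [C [HC B]]].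
  set (u := fun N => RInt (gK (p - 1) q ga de th 1) (- (INR N + / 2)) (INR N + / 2)).
  set (v := fun N => RInt (gK (p - 1) q ga de th 0) (- (INR N + / 2)) (INR N + / 2)).
  assert (V : is_lim_seq v (I0 * cos th)).
  { eapply is_lim_seq_ext; [|apply (is_lim_seq_mult' _ _ _ _ HI (is_lim_seq_const (cos th)))].
    intro N. unfold v. rewrite (RInt_ext (gK (p - 1) q ga de th 0) (fun x => scal (cos th) (exp (- PI * (x * x))))).
    - rewrite (RInt_scal (V := R_CompleteNormedModule)).
      + apply Rmult_comm.
      + apply ex_RInt_Rcont. intro x. apply (ex_derive_continuous (fun x => exp (- PI * (x * x)))).
        auto_derive. easy.
    - intros x _. unfold gK, gexp, gcos, gsin, gA, gB, scal; simpl; unfold mult; simpl.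
      replace (2 * PI * (((1 + 0 * (p - 1)) * x + 0 * ga) * (0 * q * x + 0 * de)) + th) with th by ring.
      replace (- PI * _) with (- PI * (x * x)) by ring. ring. }
  assert (D : is_lim_seq (fun N => u N - v N) 0).
  { apply is_lim_seq_abs_0.
    apply (is_lim_seq_le_le_loc (fun _ => 0) _ (fun N => 2 * C * exp (- 1) ^ N)).
    - destruct (nfloor_ex (Rmax X 0) (Rmax_r _ _)) as [N0 HN0].
      exists (S N0). intros N HN. split; [apply Rabs_pos|].
      assert (HX : X <= INR N + / 2).
      { pose proof (Rmax_l X 0). apply le_INR in HN. rewrite S_INR in HN. lra. }
      assert (E : exp (- (INR N + / 2)) <= exp (- 1) ^ N).
      { apply Rle_trans with (exp (- INR N)); [apply exp_mono; lra|]. right.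
        clear. induction N as [|N IH]; [simpl; rewrite Ropp_0; apply exp_0|].
        rewrite S_INR. simpl pow. rewrite <- IH, <- exp_plus. f_equal. ring. }
      apply gK_homotopy. intros t Ht. pose proof (pos_INR N).
      pose proof (B th t (INR N + / 2) Ht) as B1.
      pose proof (B th t (- (INR N + / 2)) Ht) as B2.
      rewrite Rabs_Ropp in B2. rewrite Rabs_pos_eq in B1, B2 by lra.
      specialize (B1 HX). specialize (B2 HX).
      eapply Rle_trans; [apply Rabs_triang|]. rewrite Rabs_Ropp. nra.
    - apply is_lim_seq_const.
    - replace (Finite 0) with (Finite (2 * C * 0)) by (f_equal; ring).
      apply is_lim_seq_mult'; [apply is_lim_seq_const|].
      apply is_lim_seq_geom. rewrite Rabs_pos_eq by (left; apply exp_pos).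
      rewrite <- exp_0. apply exp_increasing. lra. }
  pose proof (is_lim_seq_plus' _ _ _ _ D V) as P. rewrite Rplus_0_l in P.
  revert P. apply is_lim_seq_ext. intro N. ring.
Qed.

(** * The inversion formula *)

(* [Re (exp (- i th) a exp (i PI z x^2))] for [a = p + i q] and [z = i a^2]. *)
Definition gauss (p q th x : R) : R :=
  exp (- (PI * (p * p - q * q) * (x * x))) *
  (p * cos (PI * (- (2 * p * q)) * (x * x) + - th)
   + - (q * sin (PI * (- (2 * p * q)) * (x * x) + - th))).

Definition gauss' (p q th x : R) : R :=
  exp (- (PI * (p * p - q * q) * (x * x))) * x *
  (- (2 * PI * (p * p - q * q)) * (p * cos (PI * (- (2 * p * q)) * (x * x) + - th)
   + - (q * sin (PI * (- (2 * p * q)) * (x * x) + - th)))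
   + 2 * PI * (2 * p * q) * (p * sin (PI * (- (2 * p * q)) * (x * x) + - th)
   + q * cos (PI * (- (2 * p * q)) * (x * x) + - th))).

Lemma gauss_derive p q th x : is_derive (gauss p q th) x (gauss' p q th x).
Proof. unfold gauss, gauss'. auto_derive; [easy|]. ring. Qed.

(** Completing the square: for a = p + i q and b = ga + i de = - i k / a, exp (- PI (a x + b)^2) is
    exp (- PI a^2 x^2 + 2 PI i k x) times exp (- PI b^2). The two signs of b give the two
    exponentials in the cosine. The modulus of exp (PI b^2) is the factor in front, and its phase
    moves into th. *)
Lemma gauss_cos p q th k x : 0 < p ->
  let n := p * p + q * q in
  let ga := - (k * q) / n in let de := - (k * p) / n in
  gauss p q th x * cos (2 * PI * k * x) =
  / 2 * exp (PI * (ga * ga - de * de)) *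
  (gK (p - 1) q ga de (th - 2 * PI * (ga * de)) 1 x
   + gK (p - 1) q (- ga) (- de) (th - 2 * PI * (ga * de)) 1 x).
Proof.
  intros Hp n ga de.
  assert (Hn : 0 < n) by (unfold n; nra).
  assert (E1 : p * ga - q * de = 0) by (unfold ga, de; field; lra).
  assert (E2 : p * de + q * ga = - k) by (unfold ga, de, n; field; fold n; lra).
  set (c := ga * ga - de * de).
  set (X := PI * (- (2 * p * q)) * (x * x) + - th).
  assert (K : forall s, s * s = 1 -> gK (p - 1) q (s * ga) (s * de) (th - 2 * PI * (ga * de)) 1 x =
    exp (- (PI * (p * p - q * q) * (x * x))) * exp (- (PI * c)) *
    (p * cos (X + s * (2 * PI * k * x)) - q * sin (X + s * (2 * PI * k * x)))).
  { intros s Hs. unfold gK, gexp, gcos, gsin, gA, gB.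
    replace (2 * PI * (((1 + 1 * (p - 1)) * x + 1 * (s * ga)) * (1 * q * x + 1 * (s * de)))
             + (th - 2 * PI * (ga * de))) with (- (X + s * (2 * PI * k * x))).
    - rewrite cos_neg, sin_neg, <- exp_plus.
      replace (- PI * _) with (- (PI * (p * p - q * q) * (x * x)) + - (PI * c)).
      + ring.
      + transitivity (- PI * ((p * p - q * q) * (x * x) + 2 * s * x * (p * ga - q * de)
          + (s * s) * (ga * ga - de * de))); [rewrite E1, Hs; unfold c; ring | ring].
    - symmetry. transitivity (2 * PI * (p * q * (x * x) + s * x * (p * de + q * ga)
          + (s * s) * (ga * de)) + (th - 2 * PI * (ga * de))); [ring|].
      rewrite E2, Hs. unfold X. ring. }
  replace (gK (p - 1) q ga de (th - 2 * PI * (ga * de)) 1 x)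
    with (gK (p - 1) q (1 * ga) (1 * de) (th - 2 * PI * (ga * de)) 1 x) by (f_equal; ring).
  replace (gK (p - 1) q (- ga) (- de) (th - 2 * PI * (ga * de)) 1 x)
    with (gK (p - 1) q (-1 * ga) (-1 * de) (th - 2 * PI * (ga * de)) 1 x) by (f_equal; ring).
  rewrite !K by ring. unfold gauss. fold X.
  set (Y := 2 * PI * k * x). set (G := exp (- (PI * (p * p - q * q) * (x * x)))).
  replace (X + -1 * Y) with (X - Y) by ring. replace (X + 1 * Y) with (X + Y) by ring.
  rewrite cos_plus, cos_minus, sin_plus, sin_minus.
  transitivity (exp (PI * c) * exp (- (PI * c)) * G * ((p * cos X + - (q * sin X)) * cos Y)).
  - rewrite <- exp_plus, Rplus_opp_r, exp_0. ring.
  - field.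
Qed.

Lemma gauss_cos_lim p q th k (I0 : R) : 0 < p -> 0 < p * p - q * q ->
  is_lim_seq (fun N => RInt (fun x => exp (- PI * (x * x))) (- (INR N + / 2)) (INR N + / 2)) I0 ->
  is_lim_seq (fun N => RInt (fun x => gauss p q th x * cos (2 * PI * k * x))
     (- (INR N + / 2)) (INR N + / 2))
  (I0 * (exp (- (PI * ((p * p - q * q) / (p * p + q * q) ^ 2) * k ^ 2))
     * cos (PI * (2 * p * q / (p * p + q * q) ^ 2) * k ^ 2 - th))).
Proof.
  intros Hp Hpq HI. assert (Hn : 0 < p * p + q * q) by nra.
  pose proof (gauss_cos p q th k) as E. cbv zeta in E.
  set (n := p * p + q * q) in *. set (ga := - (k * q) / n) in *. set (de := - (k * p) / n) in *.
  pose proof (gK_lim p q ga de (th - 2 * PI * (ga * de)) I0 Hp Hpq HI) as L1.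
  pose proof (gK_lim p q (- ga) (- de) (th - 2 * PI * (ga * de)) I0 Hp Hpq HI) as L2.
  pose proof (is_lim_seq_mult' _ _ _ _
    (is_lim_seq_const (/ 2 * exp (PI * (ga * ga - de * de))))
    (is_lim_seq_plus' _ _ _ _ L1 L2)) as L3.
  match type of L3 with is_lim_seq _ (Finite ?l) =>
    replace (Finite (I0 * _)) with (Finite l) end.
  - revert L3. apply is_lim_seq_ext. intro N.
    rewrite (RInt_ext (fun x => gauss p q th x * cos (2 * PI * k * x))
      (fun x => scal (/ 2 * exp (PI * (ga * ga - de * de)))
        (plus (gK (p - 1) q ga de (th - 2 * PI * (ga * de)) 1 x)
              (gK (p - 1) q (- ga) (- de) (th - 2 * PI * (ga * de)) 1 x))))
      by (intros x _; now apply E).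
    assert (Ex : forall ga de th a b, ex_RInt (gK (p - 1) q ga de th 1) a b).
    { intros. apply ex_RInt_Rcont. intro x. apply gK_continuous. }
    rewrite (RInt_scal (V := R_CompleteNormedModule))
      by now apply (ex_RInt_plus (V := R_NormedModule)).
    rewrite (RInt_plus (V := R_CompleteNormedModule)) by apply Ex. reflexivity.
  - f_equal.
    replace (PI * (ga * ga - de * de)) with (- (PI * ((p * p - q * q) / n ^ 2) * k ^ 2))
      by (unfold ga, de; field; lra).
    replace (PI * (2 * p * q / n ^ 2) * k ^ 2 - th) with (- (th - 2 * PI * (ga * de)))
      by (unfold ga, de; field; lra).
    rewrite cos_neg. field.
Qed.

Lemma RS_geom N r : RS N (fun n => r ^ Z.abs_nat n) * (1 - r) + 2 * r ^ S N = 1 + r.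
Proof.
  induction N as [|N IH]; [simpl; ring|].
  cbn [RS]. replace (Z.abs_nat (- Z.of_nat (S N))) with (S N) by lia.
  replace (Z.abs_nat (Z.of_nat (S N))) with (S N) by lia.
  transitivity (RS N (fun n => r ^ Z.abs_nat n) * (1 - r) + 2 * r ^ S N); [simpl; ring|easy].
Qed.

Lemma gauss_bound p q th : 0 < p -> 0 < p * p - q * q -> exists K r, 0 < r < 1 /\ 0 <= K /\
  forall n s, Rabs s <= / 2 -> Rabs (gauss' p q th (IZR n + s)) <= K * r ^ Z.abs_nat n.
Proof.
  intros Hp Hpq. pose proof PI_RGT_0 as PI0.
  set (y := p * p - q * q) in *. set (c := 2 * PI * (y + Rabs (2 * p * q)) * (p + Rabs q)).
  assert (Hy : 0 < PI * y) by nra.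
  pose proof (Rabs_pos q) as Q0. pose proof (Rabs_pos (2 * p * q)) as Q1.
  assert (Hc : 0 <= c) by (unfold c; apply Rmult_le_pos; [apply Rmult_le_pos|]; lra).
  (* With u = abs x, the factor u of the derivative is at most exp (PI y u) / (PI y). From abs n <=
     u + 1/2 and (u - 1)^2 >= 0 follows u - u^2 <= 3/2 - abs n, the source of the 3/2. *)
  exists (c * (/ (PI * y) * exp (3 / 2 * (PI * y)))), (exp (- (PI * y))).
  assert (I0 : 0 < / (PI * y)) by now apply Rinv_0_lt_compat.
  split; [|split].
  - split; [apply exp_pos|]. rewrite <- exp_0. apply exp_increasing. lra.
  - apply Rmult_le_pos; [easy|]. left. apply Rmult_lt_0_compat; [easy|apply exp_pos].
  - intros n s Hs. set (x := IZR n + s).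
    assert (R : exp (- (PI * y)) ^ Z.abs_nat n = exp (- (PI * y) * Rabs (IZR n))).
    { rewrite <- abs_IZR, <- Zabs2Nat.id_abs, <- INR_IZR_INZ.
      induction (Z.abs_nat n) as [|m IH]; [simpl; now rewrite Rmult_0_r, exp_0|].
      rewrite S_INR. simpl pow. rewrite IH, <- exp_plus. f_equal. ring. }
    rewrite R.
    assert (Hx : Rabs (IZR n) - / 2 <= Rabs x).
    { pose proof (Rabs_triang x (- s)) as T. rewrite Rabs_Ropp in T.
      replace (x + - s) with (IZR n) in T by (unfold x; ring). lra. }
    unfold gauss'. fold y. set (X := PI * _ * _ + _).
    assert (Tc : Rabs (cos X) <= 1) by (apply Rabs_le, COS_bound).
    assert (Ts : Rabs (sin X) <= 1) by (apply Rabs_le, SIN_bound).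
    assert (B : Rabs (- (2 * PI * y) * (p * cos X + - (q * sin X))
       + 2 * PI * (2 * p * q) * (p * sin X + q * cos X)) <= c).
    { assert (B1 : Rabs (p * cos X + - (q * sin X)) <= p + Rabs q).
      { eapply Rle_trans; [apply Rabs_triang|]. rewrite Rabs_Ropp, !Rabs_mult, (Rabs_pos_eq p) by lra.
        apply Rplus_le_compat; nra. }
      assert (B2 : Rabs (p * sin X + q * cos X) <= p + Rabs q).
      { eapply Rle_trans; [apply Rabs_triang|]. rewrite !Rabs_mult, (Rabs_pos_eq p) by lra.
        apply Rplus_le_compat; nra. }
      eapply Rle_trans; [apply Rabs_triang|].
      rewrite (Rabs_mult (- (2 * PI * y))), (Rabs_mult (2 * PI * (2 * p * q))), (Rabs_mult (2 * PI)).
      rewrite Rabs_Ropp, (Rabs_pos_eq (2 * PI * y)), (Rabs_pos_eq (2 * PI)) by nra.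
      assert (2 * PI * y * Rabs (p * cos X + - (q * sin X)) <= 2 * PI * y * (p + Rabs q))
        by (apply Rmult_le_compat_l; nra).
      assert (2 * PI * Rabs (2 * p * q) * Rabs (p * sin X + q * cos X)
         <= 2 * PI * Rabs (2 * p * q) * (p + Rabs q)) by (apply Rmult_le_compat_l; nra).
      unfold c. lra. }
    rewrite Rabs_mult, Rmult_comm.
    replace (c * (/ (PI * y) * exp (3 / 2 * (PI * y))) * exp (- (PI * y) * Rabs (IZR n)))
      with (c * (/ (PI * y) * (exp (3 / 2 * (PI * y)) * exp (- (PI * y) * Rabs (IZR n))))) by ring.
    apply Rmult_le_compat; [apply Rabs_pos.. | easy |].
    rewrite Rabs_mult, (Rabs_pos_eq (exp _)) by (left; apply exp_pos).
    set (u := Rabs x) in *. assert (Hu0 : 0 <= u) by apply Rabs_pos.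
    assert (Hx2 : x * x = u * u) by (unfold u; rewrite <- Rabs_mult, Rabs_pos_eq; nra).
    rewrite Hx2, <- exp_plus.
    assert (Hu : u <= / (PI * y) * exp (PI * y * u)).
    { apply Rmult_le_reg_l with (PI * y); [easy|].
      rewrite <- Rmult_assoc, Rinv_r, Rmult_1_l by lra.
      pose proof (exp_ineq1_le (PI * y * u)). lra. }
    apply Rle_trans with (exp (- (PI * y * (u * u))) * (/ (PI * y) * exp (PI * y * u))).
    { apply Rmult_le_compat_l; [left; apply exp_pos|easy]. }
    replace (exp (- (PI * y * (u * u))) * (/ (PI * y) * exp (PI * y * u)))
      with (/ (PI * y) * (exp (- (PI * y * (u * u))) * exp (PI * y * u))) by ring.
    apply Rmult_le_compat_l; [lra|]. rewrite <- exp_plus. apply exp_mono.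
    pose proof (Rle_0_sqr (u - 1)) as S0. unfold Rsqr in S0.
    assert (S1 : u - u * u <= 3 / 2 - Rabs (IZR n)) by lra.
    apply (Rmult_le_compat_l (PI * y)) in S1; lra.
Qed.

Lemma RS_lin N a b f g : RS N (fun n => a * f n + b * g n) = a * RS N f + b * RS N g.
Proof. induction N as [|N IH]; cbn [RS]; [|rewrite IH]; ring. Qed.

(** The arguments are z = i a^2 and -1 / z for a = p + i q, and a is the principal root of z / i.
    [I0] stands for the real Gaussian integral, not yet evaluated. *)
Lemma theta3_inversion_scaled p q (I0 : R) : 0 < p -> 0 < p * p - q * q ->
  is_lim_seq (fun N => RInt (fun x => exp (- PI * (x * x))) (- (INR N + / 2)) (INR N + / 2)) I0 ->
  ((p, q) * theta3 (- (2 * p * q), p * p - q * q)%R = RtoC I0 *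
   theta3 (2 * p * q / (p * p + q * q) ^ 2, (p * p - q * q) / (p * p + q * q) ^ 2)%R)%C.
Proof.
  intros Hp Hpq HI. assert (Hn : 0 < p * p + q * q) by nra.
  set (z := (- (2 * p * q), p * p - q * q) : C).
  set (w := (2 * p * q / (p * p + q * q) ^ 2, (p * p - q * q) / (p * p + q * q) ^ 2) : C).
  assert (Hz : 0 < Im z) by easy.
  assert (Hw : 0 < Im w) by (apply Rdiv_lt_0_compat; [easy|now apply pow_lt]).
  destruct (theta3_RS_lim z Hz) as [Zr Zi]. destruct (theta3_RS_lim w Hw) as [Wr Wi].
  (* Real Poisson summation gives the real part of the identity multiplied by exp (- i th); th = 0
     and th = PI / 2 then recover the complex identity. *)
  assert (P : forall th,
    cos th * (p * Re (theta3 z) - q * Im (theta3 z)) + sin th * (p * Im (theta3 z) + q * Re (theta3 z))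
    = I0 * (cos th * Re (theta3 w) + sin th * Im (theta3 w))).
  { intro th. destruct (gauss_bound p q th Hp Hpq) as [K [r [Hr [HK B]]]].
    apply (fejer_poisson (gauss p q th) (gauss' p q th)
      (fun k => I0 * (cos th * Re (qpow w (IZR k ^ 2)) + sin th * Im (qpow w (IZR k ^ 2))))
      (fun n => K * r ^ Z.abs_nat n) (K * ((1 + r) / (1 - r)))).
    - apply gauss_derive.
    - exact B.
    - intro N.
      rewrite (RS_ext N _ (fun n => r ^ Z.abs_nat n * K)) by (intros; ring). rewrite RS_scal_r, Rmult_comm.
      apply Rmult_le_compat_l; [easy|]. apply Rmult_le_reg_r with (1 - r); [lra|].
      replace ((1 + r) / (1 - r) * (1 - r)) with (1 + r) by (field; lra).
      rewrite <- (RS_geom N r). pose proof (pow_lt r (S N) ltac:(lra)). lra.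
    - intro k. pose proof (gauss_cos_lim p q th (IZR k) I0 Hp Hpq HI) as L.
      replace (cos th * Re (qpow w (IZR k ^ 2)) + sin th * Im (qpow w (IZR k ^ 2))) with
        (exp (- (PI * ((p * p - q * q) / (p * p + q * q) ^ 2) * IZR k ^ 2))
         * cos (PI * (2 * p * q / (p * p + q * q) ^ 2) * IZR k ^ 2 - th)); [exact L|].
      rewrite qpow_eq, cos_minus. unfold w, Re, Im. cbn [fst snd]. ring.
    - replace (cos th * _ + _) with ((cos th * p + sin th * q) * Re (theta3 z)
        + (sin th * p - cos th * q) * Im (theta3 z)) by ring.
      eapply is_lim_seq_ext; [|apply (is_lim_seq_plus' _ _ _ _
        (is_lim_seq_mult' _ _ _ _ (is_lim_seq_const (cos th * p + sin th * q)) Zr)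
        (is_lim_seq_mult' _ _ _ _ (is_lim_seq_const (sin th * p - cos th * q)) Zi))].
      intro N. cbv beta. rewrite <- RS_lin. apply RS_ext. intros n _.
      rewrite qpow_eq. unfold gauss, z, Re, Im. cbn [fst snd].
      replace (IZR n * IZR n) with (IZR n ^ 2) by ring.
      rewrite cos_plus, sin_plus, cos_neg, sin_neg. ring.
    - replace (I0 * _) with ((I0 * cos th) * Re (theta3 w) + (I0 * sin th) * Im (theta3 w)) by ring.
      eapply is_lim_seq_ext; [|apply (is_lim_seq_plus' _ _ _ _
        (is_lim_seq_mult' _ _ _ _ (is_lim_seq_const (I0 * cos th)) Wr)
        (is_lim_seq_mult' _ _ _ _ (is_lim_seq_const (I0 * sin th)) Wi))].
      intro N. cbv beta. rewrite <- RS_lin. apply RS_ext. intros n _. ring. }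
  pose proof (P 0) as P0. rewrite cos_0, sin_0 in P0.
  pose proof (P (PI / 2)) as P1. rewrite cos_PI2, sin_PI2 in P1.
  destruct (theta3 z) as [a b], (theta3 w) as [c d]. simpl in *.
  apply injective_projections; simpl; lra.
Qed.

(** The point z = i is fixed by inversion, with a = 1. So theta_3(i) = I0 theta_3(i), and the real
    part of theta_3(i) is at least 1, its term of index 0. *)
Lemma gauss_lim_1 :
  is_lim_seq (fun N => RInt (fun x => exp (- PI * (x * x))) (- (INR N + / 2)) (INR N + / 2)) 1.
Proof.
  destruct gauss_lim as [I0 HI]. replace 1 with I0; [exact HI|].
  pose proof (theta3_inversion_scaled 1 0 I0 ltac:(lra) ltac:(lra) HI) as E.
  replace (- (2 * 1 * 0)) with 0 in E by ring.
  replace (1 * 1 - 0 * 0) with 1 in E by ring.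
  replace (2 * 1 * 0 / (1 * 1 + 0 * 0) ^ 2) with 0 in E by field.
  replace (1 / (1 * 1 + 0 * 0) ^ 2) with 1 in E by field.
  destruct (theta3_RS_lim (0, 1) ltac:(simpl; lra)) as [L _].
  assert (P : 1 <= Re (theta3 (0, 1))).
  { refine (is_lim_seq_le (fun _ => 1) _ (Finite _) (Finite _) _ (is_lim_seq_const 1) L).
    intro N.
    assert (T : forall x, 0 <= Re (qpow (0, 1) x)).
    { intro x. rewrite qpow_eq. simpl. rewrite Rmult_0_r, Rmult_0_l, cos_0.
      pose proof (exp_pos (- (PI * 1 * x))). lra. }
    induction N as [|N IH]; cbn [RS].
    - rewrite qpow_eq. simpl. rewrite !Rmult_0_l, !Rmult_0_r, Ropp_0, exp_0, cos_0. lra.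
    - pose proof (T (IZR (Z.of_nat (S N)) ^ 2)). pose proof (T (IZR (- Z.of_nat (S N)) ^ 2)). lra. }
  apply (f_equal Re) in E. destruct (theta3 (0, 1)) as [u v]. simpl in *. nra.
Qed.

Lemma theta3_inversion p q : 0 < p -> 0 < p * p - q * q ->
  ((p, q) * theta3 (- (2 * p * q), p * p - q * q)%R =
   theta3 (2 * p * q / (p * p + q * q) ^ 2, (p * p - q * q) / (p * p + q * q) ^ 2)%R)%C.
Proof.
  intros Hp Hpq. rewrite (theta3_inversion_scaled p q 1 Hp Hpq gauss_lim_1). ring.
Qed.

(** * Theta functions at 4 z, inversion of theta_2 and translation by 1 *)

Lemma dil_thser d e w : d <> O -> proper e ->
  dil d (thser e w) = thser (fun a => (Z.of_nat d * e a)%Z) w.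
Proof.
  intros Hd He. symmetry.
  assert (Hp : proper (fun a => (Z.of_nat d * e a)%Z)) by (intro a; specialize (He a); nia).
  apply dil_eval; [easy| |].
  - intros n Hn. apply thser_neq0 in Hn. destruct Hn as [a Ha].
    exists (Z.to_nat (e a)). specialize (He a). nia.
  - intro m. rewrite (thser_big e w m (d * m)) by (auto; nia).
    apply ZS_ext. intros a _. apply ind_cong; [reflexivity|]. nia.
Qed.

Lemma ev_unique z f s s' : ev z f s -> ev z f s' -> s = s'.
Proof.
  intros [_ [A B]] [_ [A' B']]. apply injective_projections.
  - apply is_series_unique in A, A'. unfold Re in *. congruence.
  - apply is_series_unique in B, B'. unfold Im in *. congruence.
Qed.

Definition C4 (z : C) : C := (4 * Re z, 4 * Im z).

Lemma qpow_C4 z m : qpow (C4 z) m = qpow z (4 * m).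
Proof.
  rewrite !qpow_eq. simpl.
  replace (PI * (4 * Im z) * m) with (PI * Im z * (4 * m)) by ring.
  replace (PI * (4 * Re z) * m) with (PI * Re z * (4 * m)) by ring. reflexivity.
Qed.

Lemma ev_dil4_th3 z : 0 < Im z -> ev z (dil 4 th3) (theta3 (C4 z)).
Proof.
  intro Hz. unfold th3. rewrite dil_thser by (easy || apply proper_e3).
  replace (theta3 (C4 z)) with
    (ZSum (fun a => (RtoC (IZR (zone a)) * qpow z (IZR (Z.of_nat 4 * e3 a) / 4))%C)).
  - apply ev_thser; auto using zone_bound. intro a. pose proof (proper_e3 a). lia.
  - unfold theta3. f_equal. extensionality a. unfold zone, e3.
    rewrite Cmult_1_l, qpow_C4. f_equal. simpl Z.of_nat. rewrite !mult_IZR, (pow_IZR a 2).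
    simpl Z.of_nat. field.
Qed.

Lemma ev_dil4_th2 z : 0 < Im z -> ev z (dil 4 th2) (theta2 (C4 z)).
Proof.
  intro Hz. unfold th2. rewrite dil_thser by (easy || apply proper_e2).
  replace (theta2 (C4 z)) with
    (ZSum (fun a => (RtoC (IZR (zone a)) * qpow z (IZR (Z.of_nat 4 * e2 a) / 4))%C)).
  - apply ev_thser; auto using zone_bound. intro a. pose proof (proper_e2 a). lia.
  - unfold theta2. f_equal. extensionality a. unfold zone, e2.
    rewrite Cmult_1_l, qpow_C4. f_equal. simpl Z.of_nat.
    rewrite mult_IZR, <- (pow_IZR _ 2), plus_IZR, mult_IZR. field.
Qed.

Lemma theta3_dissect z : 0 < Im z -> theta3 z = (theta3 (C4 z) + theta2 (C4 z))%C.
Proof.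
  intro Hz. apply (ev_unique z th3); [now apply ev_th3|]. rewrite th3_dissect.
  apply ev_add; auto using ev_dil4_th3, ev_dil4_th2.
Qed.

Lemma theta4_dissect z : 0 < Im z -> theta4 z = (theta3 (C4 z) - theta2 (C4 z))%C.
Proof.
  intro Hz. apply (ev_unique z th4); [now apply ev_th4|]. rewrite th4_dissect.
  apply ev_sub; auto using ev_dil4_th3, ev_dil4_th2.
Qed.

Lemma theta_jacobi z : 0 < Im z -> (theta4 z ^ 4 = theta3 z ^ 4 - theta2 z ^ 4)%C.
Proof.
  intro Hz. apply (ev_unique z (th4 ^ 4)); [now apply ev_pow, ev_th4|].
  rewrite jacobi_quartic. apply ev_sub; apply ev_pow; auto using ev_th3, ev_th2.
Qed.

(** Use the inversion of theta_3 for a and for a / 2, with w = -1 / z. As theta_3(z / 4) =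
    theta_3(z) + theta_2(z), one gets a theta_2(z) = 2 theta_3(4 w) - theta_3(w), and the
    dissections at w turn this into theta_3(4 w) - theta_2(4 w) = theta_4(w). *)
Lemma theta4_inversion p q : 0 < p -> 0 < p * p - q * q ->
  ((p, q) * theta2 (- (2 * p * q), p * p - q * q)%R =
   theta4 (2 * p * q / (p * p + q * q) ^ 2, (p * p - q * q) / (p * p + q * q) ^ 2)%R)%C.
Proof.
  intros Hp Hpq. assert (Hn : 0 < p * p + q * q) by nra.
  pose proof (theta3_inversion p q Hp Hpq) as E.
  pose proof (theta3_inversion (p / 2) (q / 2) ltac:(lra) ltac:(lra)) as E'.
  set (z := (- (2 * p * q), p * p - q * q) : C) in *.
  set (w := (2 * p * q / (p * p + q * q) ^ 2, (p * p - q * q) / (p * p + q * q) ^ 2) : C) in *.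
  set (z' := (- (2 * (p / 2) * (q / 2)), p / 2 * (p / 2) - q / 2 * (q / 2)) : C) in *.
  assert (Hz : C4 z' = z) by (unfold z, z', C4; apply injective_projections; simpl; field).
  match type of E' with _ = theta3 ?v => replace v with (C4 w) in E'
    by (unfold w, C4; apply injective_projections; simpl; field; lra) end.
  assert (Hz' : 0 < Im z') by (unfold z'; simpl; lra).
  assert (Hw : 0 < Im w) by (apply Rdiv_lt_0_compat; [easy|now apply pow_lt]).
  rewrite (theta3_dissect z' Hz'), Hz in E'.
  pose proof (theta3_dissect w Hw) as D3. rewrite (theta4_dissect w Hw).
  assert (A : ((p / 2, q / 2)%R * (theta3 z + theta2 z) * 2 = (p, q) * theta3 z + (p, q) * theta2 z)%C).
  { replace ((p, q) : C) with (2 * (p / 2, q / 2)%R)%C; [ring|].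
    apply injective_projections; simpl; field. }
  transitivity ((p, q) * theta3 z + (p, q) * theta2 z - (p, q) * theta3 z)%C; [ring|].
  rewrite <- A, E', E, D3. ring.
Qed.

Lemma theta3_shift w : theta3 (1 + w)%C = theta4 w /\ theta4 (1 + w)%C = theta3 w.
Proof.
  assert (P : forall a : Z, qpow (1 + w)%C (IZR a ^ 2)
    = (RtoC ((-1) ^ Z.to_nat (a * a)) * qpow w (IZR a ^ 2))%C).
  { intro a. rewrite !qpow_eq. destruct w as [x y]. simpl Re. simpl Im.
    replace (PI * (0 + y) * IZR a ^ 2) with (PI * y * IZR a ^ 2) by ring.
    replace (PI * (1 + x) * IZR a ^ 2) with (PI * x * IZR a ^ 2 + INR (Z.to_nat (a * a)) * PI)
      by (rewrite INR_IZR_INZ, Z2Nat.id, mult_IZR by nia; ring).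
    assert (T : forall n t, cos (t + INR n * PI) = (-1) ^ n * cos t
              /\ sin (t + INR n * PI) = (-1) ^ n * sin t).
    { induction n as [|n IH]; intro t.
      - simpl. rewrite Rmult_0_l, Rplus_0_r. lra.
      - rewrite S_INR. replace (t + (INR n + 1) * PI) with (t + INR n * PI + PI) by ring.
        rewrite neg_cos, neg_sin. destruct (IH t) as [-> ->]. simpl. split; ring. }
    destruct (T (Z.to_nat (a * a)) (PI * x * IZR a ^ 2)) as [-> ->].
    apply injective_projections; simpl; ring. }
  assert (S1 : forall n : nat, (-1) ^ n * (-1) ^ n = 1).
  { intro n. rewrite <- Rpow_mult_distr. replace (-1 * -1) with 1 by ring. apply pow1. }
  split.
  - unfold theta3, theta4. f_equal. extensionality a. apply P.
  - unfold theta3, theta4. f_equal. extensionality a. rewrite P, Cmult_assoc, <- RtoC_mult, S1.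
    apply Cmult_1_l.
Qed.

(** * Principal powers and the shadow in terms of theta functions *)

Lemma Carg_pos w : 0 < Re w -> Carg w = atan (Im w / Re w).
Proof. intro H. unfold Carg. now destruct (Rlt_dec 0 (Re w)). Qed.

Lemma Cpowr_add w s t : Cpowr w (s + t) = (Cpowr w s * Cpowr w t)%C.
Proof. unfold Cpowr. rewrite <- Cexp_add, RtoC_plus. f_equal. ring. Qed.

Lemma Cpowr_eq w s : Cpowr w s =
  (exp (s * ln (Cmod w)) * cos (s * Carg w), exp (s * ln (Cmod w)) * sin (s * Carg w)).
Proof.
  unfold Cpowr, Cexp, Clog. simpl.
  replace (s * ln (Cmod w) - 0 * Carg w) with (s * ln (Cmod w)) by ring.
  replace (s * Carg w + 0 * ln (Cmod w)) with (s * Carg w) by ring. reflexivity.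
Qed.

Lemma Cpowr_1 w : 0 < Re w -> Cpowr w 1 = w.
Proof.
  intro H. rewrite Cpowr_eq, Carg_pos by easy. rewrite !Rmult_1_l.
  assert (Hm : 0 < Cmod w).
  { apply Cmod_gt_0. intro E. rewrite E in H. simpl in H. lra. }
  rewrite exp_ln by easy. destruct w as [x y]. simpl in *.
  rewrite cos_atan, sin_atan.
  assert (E : sqrt (1 + (y / x)²) = Cmod (x, y) / x).
  { unfold Cmod. simpl. replace (x * (x * 1) + y * (y * 1)) with (x² * (1 + (y / x)²))
      by (unfold Rsqr; field; lra).
    rewrite sqrt_mult by (unfold Rsqr; nra). rewrite sqrt_Rsqr by lra. field. lra. }
  rewrite E. apply injective_projections; simpl; field; split; lra.
Qed.

(** All weights are multiples of 1/2, so the power in a shadow is a natural power of one principal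
    square root. *)
Lemma Cpowr_half_pow w n : Cpowr w (INR n * / 2) = (Cpowr w (/ 2) ^ n)%C.
Proof.
  induction n as [|n IH].
  - simpl. rewrite Rmult_0_l, Cpowr_eq, !Rmult_0_l, exp_0, cos_0, sin_0.
    apply injective_projections; simpl; ring.
  - rewrite S_INR, Rmult_plus_distr_r, Rmult_1_l, Rplus_comm, Cpowr_add, IH. reflexivity.
Qed.

Lemma Re_Cpowr_half w : 0 < Re w -> 0 < Re (Cpowr w (/ 2)).
Proof.
  intro H. rewrite Cpowr_eq, Carg_pos by easy. simpl.
  apply Rmult_lt_0_compat; [apply exp_pos|]. pose proof (atan_bound (Im w / Re w)).
  pose proof PI_RGT_0. apply cos_gt_0; lra.
Qed.

(** Let s be the principal root of i / z and a = 1 / s. Then z = i a^2, and Re a > 0 because Re s >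
    0; this fixes the sign in the inversion formulas. The translation by 1 exchanges theta_3 and
    theta_4 at -1 / z. *)
Lemma theta_shift_inversion z : 0 < Im z ->
  exists a : C, (Cpowr (Ci / z) (/ 2) * a = 1)%C /\
    theta3 (1 - / z)%C = (a * theta2 z)%C /\ theta4 (1 - / z)%C = (a * theta3 z)%C /\
    0 < Im (1 - / z)%C.
Proof.
  intro Hz. set (s := Cpowr (Ci / z) (/ 2)).
  assert (Hz0 : z <> 0%C) by (intro E; rewrite E in Hz; simpl in Hz; lra).
  assert (Hw : 0 < Re (Ci / z)%C).
  { destruct z as [x y]. simpl in *. unfold Rdiv.
    replace (0 * (x * / (x * (x * 1) + y * (y * 1))) - 1 * (- y * / (x * (x * 1) + y * (y * 1))))
      with (y * / (x * (x * 1) + y * (y * 1))) by ring.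
    apply Rmult_lt_0_compat; [easy|]. apply Rinv_0_lt_compat. nra. }
  assert (Hs : (s * s = Ci / z)%C).
  { unfold s. rewrite <- Cpowr_add. replace (/ 2 + / 2) with 1 by field. now apply Cpowr_1. }
  assert (Hs0 : s <> 0%C).
  { intro E. pose proof (Re_Cpowr_half _ Hw) as H. fold s in H. rewrite E in H. simpl in H. lra. }
  assert (CiN : Ci <> 0%C) by (intro E; apply (f_equal snd) in E; simpl in E; lra).
  pose proof (Re_Cpowr_half _ Hw) as Hsr. fold s in Hsr.
  assert (Ha : (/ s * / s * Ci = z)%C).
  { transitivity (Ci / (s * s))%C; [field; easy|]. rewrite Hs. field. easy. }
  assert (Ha0 : 0 < Re (/ s)%C).
  { destruct s as [u v]. simpl in *. apply Rdiv_lt_0_compat; [easy|nra]. }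
  assert (Hinv : (s * / s = 1)%C) by (field; easy).
  exists (/ s)%C. split; [easy|].
  destruct (/ s)%C as [p q] eqn:Es. simpl in Ha0.
  assert (Ez : z = (- (2 * p * q), p * p - q * q)).
  { rewrite <- Ha. apply injective_projections; simpl; ring. }
  assert (Hpq : 0 < p * p - q * q) by (rewrite Ez in Hz; exact Hz).
  set (w := (2 * p * q / (p * p + q * q) ^ 2, (p * p - q * q) / (p * p + q * q) ^ 2) : C).
  assert (Hn : 0 < p * p + q * q) by nra.
  assert (Ew : (1 - / z = 1 + w)%C).
  { rewrite Ez. unfold w. unfold Cminus. f_equal.
    apply injective_projections; simpl; field; split; nra. }
  rewrite Ew. destruct (theta3_shift w) as [-> ->].
  rewrite Ez at 1 2. unfold w at 1 2.
  rewrite theta4_inversion, theta3_inversion by easy.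
  split; [reflexivity|]. split; [reflexivity|].
  unfold w. simpl. rewrite Rplus_0_l. apply Rdiv_lt_0_compat; [easy|]. nra.
Qed.

Lemma shadow_eq eps alpha beta z : 0 < Im z ->
  shadow eps alpha beta z = (RtoC ((- / 16) ^ beta) *
    ((theta3 z ^ 4 + theta4 z ^ 4) ^ eps * theta2 z ^ alpha
      * (theta3 z ^ 4 * theta4 z ^ 4) ^ beta))%C.
Proof.
  intro Hz. destruct (theta_shift_inversion z Hz) as [a [Ha [E3 [E4 Hi]]]].
  unfold shadow.
  replace (weight eps alpha beta) with (INR (4 * eps + alpha + 8 * beta) * / 2)
    by (unfold weight; rewrite !plus_INR, !mult_INR; simpl; field).
  rewrite Cpowr_half_pow. set (s := Cpowr (Ci / z) (/ 2)) in *.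
  (* The Jacobi identity at 1 - 1 / z yields the fourth power of theta_2 from the other two
     functions. Its minus sign produces (-1/16)^beta and the sum of fourth powers in the shadow of
     phi. *)
  assert (E2 : (theta2 (1 - / z) ^ 4 = - (a ^ 4 * theta4 z ^ 4))%C).
  { pose proof (theta_jacobi _ Hi) as J. rewrite E3, E4 in J.
    transitivity ((a * theta2 z) ^ 4 - ((a * theta2 z) ^ 4 - theta2 (1 - / z) ^ 4))%C; [ring|].
    rewrite <- J, (theta_jacobi z Hz). ring. }
  unfold form, phi, Delta8. rewrite E2, E3, E4.
  replace ((a * theta3 z) ^ 4 - - (a ^ 4 * theta4 z ^ 4))%C
    with (a ^ 4 * (theta3 z ^ 4 + theta4 z ^ 4))%C by ring.
  replace (RtoC (/ 16) * - (a ^ 4 * theta4 z ^ 4) * (a * theta3 z) ^ 4)%C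
    with (a ^ 8 * (RtoC (- / 16) * (theta3 z ^ 4 * theta4 z ^ 4)))%C
    by (rewrite RtoC_opp; ring).
  rewrite !Cpow_mult_l, <- !Cpow_mult_r, !Cpow_add_r, RtoC_pow.
  transitivity ((s ^ (4 * eps) * a ^ (4 * eps)) * (s ^ alpha * a ^ alpha)
    * (s ^ (8 * beta) * a ^ (8 * beta)) * (RtoC (- / 16) ^ beta *
    ((theta3 z ^ 4 + theta4 z ^ 4) ^ eps * theta2 z ^ alpha *
     (theta3 z ^ (4 * beta) * theta4 z ^ (4 * beta)))))%C; [ring|].
  rewrite <- !Cpow_mult_l, Ha, !Cpow_1_l. ring.
Qed.

(** The exponent alpha / 4 + 2 n of q is the exponent alpha + 8 n of t, the progression of
    [supp_Fsh]. *)
Lemma sh_vanish_intro eps alpha beta (P : R -> Prop) :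
  (forall n, P (INR (alpha + 8 * n) / 4) -> Fsh eps alpha beta (alpha + 8 * n)%nat = 0%Z) ->
  sh_vanish eps alpha beta P.
Proof.
  intro H. exists (fun n => RtoC ((- / 16) ^ beta * IZR (Fsh eps alpha beta (alpha + 8 * n)%nat))).
  assert (E : forall n, INR alpha / 4 + 2 * INR n = INR (alpha + 8 * n) / 4).
  { intro n. rewrite plus_INR, mult_INR. simpl (INR 8). field. }
  split.
  - intros z Hz. rewrite shadow_eq by easy.
    pose proof (ev_sparse z _ _ alpha 8 ((- / 16) ^ beta) ltac:(lia)
      (supp_Fsh eps alpha beta) (ev_Fsh z eps alpha beta Hz)) as HS.
    revert HS. apply is_series_ext. intro n. f_equal. unfold tq. now rewrite E.
  - intros n Hn. rewrite H; [f_equal; ring|]. now rewrite <- E.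
Qed.

(** * From integer coefficients to conditions on real indices *)

Lemma INR_pow2 n a : Z.of_nat n = (a ^ 2)%Z -> INR n = IZR a ^ 2.
Proof. intro H. now rewrite INR_IZR_INZ, H, (pow_IZR a 2). Qed.

Lemma INR_sum2sq n a b : Z.of_nat n = (a ^ 2 + b ^ 2)%Z -> INR n = IZR a ^ 2 + IZR b ^ 2.
Proof. intro H. now rewrite INR_IZR_INZ, H, plus_IZR, (pow_IZR a 2), (pow_IZR b 2). Qed.

Lemma INR_div4_eq m n : INR m / 4 = INR n -> m = (4 * n)%nat.
Proof. intro H. apply INR_eq. rewrite mult_INR. simpl (INR 4). lra. Qed.

Lemma f_vanish_4a_8b eps alpha beta r :
  (forall a b, Fform eps alpha beta (4 * (4 ^ a * (8 * b + r)))%nat = 0%Z) ->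
  f_vanish eps alpha beta (form_4a_8b r).
Proof. intro H. apply f_vanish_intro. intros n [a [b E]]. apply INR_eq in E. now rewrite E. Qed.

Lemma f_vanish_2_4a eps alpha beta :
  (forall a, Fform eps alpha beta (4 * (4 ^ a * 2))%nat = 0%Z) ->
  f_vanish eps alpha beta is_2_4a.
Proof.
  intro H. apply f_vanish_intro. intros n [a E]. apply INR_eq in E.
  now rewrite E, (Nat.mul_comm 2).
Qed.

Lemma sh_vanish_2_4a eps alpha beta :
  (forall a, Fsh eps alpha beta (4 * (4 ^ a * 2))%nat = 0%Z) ->
  sh_vanish eps alpha beta is_2_4a.
Proof.
  intro H. apply sh_vanish_intro. intros n [a E]. apply INR_div4_eq in E.
  now rewrite E, (Nat.mul_comm 2).
Qed.

Lemma f_vanish_4a eps alpha beta :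
  (forall a, Fform eps alpha beta (4 * (4 ^ a * 1))%nat = 0%Z) ->
  f_vanish eps alpha beta is_4a.
Proof.
  intro H. apply f_vanish_intro. intros n [a E]. apply INR_eq in E.
  now rewrite E, <- (Nat.mul_1_r (4 ^ a)).
Qed.

Lemma sh_vanish_4a eps alpha beta :
  (forall a, Fsh eps alpha beta (4 * (4 ^ a * 1))%nat = 0%Z) ->
  sh_vanish eps alpha beta is_4a.
Proof.
  intro H. apply sh_vanish_intro. intros n [a E]. apply INR_div4_eq in E.
  now rewrite E, <- (Nat.mul_1_r (4 ^ a)).
Qed.

Lemma f_vanish_at eps alpha beta k : Fform eps alpha beta (4 * k)%nat = 0%Z ->
  f_vanish eps alpha beta (fun m => m = INR k).
Proof. intro H. apply f_vanish_intro. intros n E. apply INR_eq in E. now rewrite E. Qed.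

Lemma sh_vanish_at eps alpha beta k : Fsh eps alpha beta k = 0%Z ->
  sh_vanish eps alpha beta (fun m => m = INR k / 4).
Proof.
  intro H. apply sh_vanish_intro. intros n E.
  replace (alpha + 8 * n)%nat with k; [easy|]. apply INR_eq. lra.
Qed.

Theorem lemma7p1 :
  (* (a) *)
  (forall k : nat,
     f_vanish 0 (4 * k) k (fun m => exists j : Z, m - INR k = 2 * IZR j + 1)) /\
  (forall k : nat,
     sh_vanish 0 (16 * k) k (fun m => exists j : Z, m = 4 * IZR j + 2)) /\
  (* (b) *)
  f_vanish 0 1 0 (fun m => ~ is_sq m) /\
  sh_vanish 0 1 0 (fun m => ~ is_sq_4 m) /\
  f_vanish 0 2 0 (fun m => ~ is_sum2sq m) /\
  sh_vanish 0 2 0 (fun m => ~ is_sum2sq_4 m) /\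
  f_vanish 0 3 0 (form_4a_8b 7) /\
  f_vanish 1 12 0 (fun m => m = 1) /\
  (* (c) *)
  f_vanish 0 1 1 (form_4a_8b 5) /\
  f_vanish 0 2 1 (fun m => ~ is_sum2sq m) /\
  sh_vanish 0 2 1 (fun m => ~ is_sum2sq_4 m) /\
  f_vanish 0 3 1 (form_4a_8b 7) /\
  f_vanish 0 7 1 (form_4a_8b 3) /\
  f_vanish 1 3 1 (form_4a_8b 7) /\
  f_vanish 1 16 1 is_2_4a /\
  sh_vanish 1 16 1 is_2_4a /\
  sh_vanish 1 40 1 (fun m => m = 24) /\
  (* (d) *)
  f_vanish 0 5 2 (form_4a_8b 1) /\
  f_vanish 0 12 2 is_4a /\
  f_vanish 1 8 2 is_4a /\
  sh_vanish 1 8 2 is_4a /\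
  f_vanish 1 20 2 (fun m => m = 3) /\
  f_vanish 1 33 2 (fun m => m = 4) /\
  sh_vanish 1 33 2 (fun m => m = 49 / 4) /\
  (* (e) *)
  f_vanish 0 4 3 is_2_4a /\
  f_vanish 1 24 3 is_2a /\
  sh_vanish 1 24 3 is_2a.
Proof.
  repeat split.
  - intro k. apply f_vanish_intro. intros n [j E].
    apply (supp_vanish 8 (4 * k) _ _ (Fform_eta k)). intros [l Hl].
    assert (Z.of_nat n - Z.of_nat k = 2 * j + 1)%Z; [|lia].
    apply eq_IZR. rewrite minus_IZR, plus_IZR, mult_IZR, <- !INR_IZR_INZ. lra.
  - intro k. apply sh_vanish_intro. intros n [j E].
    apply (supp_vanish 16 (16 * k) _ _ (Fsh_eta k)). intros [l Hl]. rewrite Hl in E.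
    assert (Z.of_nat (16 * k + 16 * l) = 4 * (4 * j + 2))%Z; [|lia].
    apply eq_IZR. rewrite mult_IZR, plus_IZR, mult_IZR, <- INR_IZR_INZ. lra.
  - apply f_vanish_intro. intros n H. destruct (Z.eq_dec (Fform 0 1 0 (4 * n)%nat) 0) as [E|E]; [easy|].
    destruct (Fform_1 n E) as [a Ha]. destruct H. exists a. now apply INR_pow2.
  - apply sh_vanish_intro. intros n H. destruct (Z.eq_dec (Fsh 0 1 0 (1 + 8 * n)%nat) 0) as [E|E]; [easy|].
    destruct (Fsh_1 _ E) as [a Ha]. destruct H. exists a. now rewrite (INR_pow2 _ _ Ha).
  - apply f_vanish_intro. intros n H. destruct (Z.eq_dec (Fform 0 2 0 (4 * n)%nat) 0) as [E|E]; [easy|].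
    destruct (Fform_2 n E) as [a [b Ha]]. destruct H. exists a, b. now apply INR_sum2sq.
  - apply sh_vanish_intro. intros n H. destruct (Z.eq_dec (Fsh 0 2 0 (2 + 8 * n)%nat) 0) as [E|E]; [easy|].
    destruct (Fsh_2 _ E) as [a [b Ha]]. destruct H. exists a, b. now rewrite (INR_sum2sq _ _ _ Ha).
  - apply f_vanish_4a_8b, Fform_3.
  - apply (f_vanish_at 1 12 0 1), Fform_phi_12.
  - apply f_vanish_4a_8b, Fform_1_1.
  - apply f_vanish_intro. intros n H. destruct (Z.eq_dec (Fform 0 2 1 (4 * n)%nat) 0) as [E|E]; [easy|].
    destruct (Fform_2_1 n E) as [a [b Ha]]. destruct H. exists a, b. now apply INR_sum2sq.
  - apply sh_vanish_intro. intros n H. destruct (Z.eq_dec (Fsh 0 2 1 (2 + 8 * n)%nat) 0) as [E|E]; [easy|].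
    destruct (Fsh_2_1 _ E) as [a [b Ha]]. destruct H. exists a, b. now rewrite (INR_sum2sq _ _ _ Ha).
  - apply f_vanish_4a_8b, Fform_3_1.
  - apply f_vanish_4a_8b, Fform_7_1.
  - apply f_vanish_4a_8b, Fform_phi_3_1.
  - apply f_vanish_2_4a, Fform_phi_16_1.
  - apply sh_vanish_2_4a, Fsh_phi_16_1.
  - replace 24 with (INR 96 / 4) by (rewrite INR_IZR_INZ; simpl; field).
    apply sh_vanish_at, Fsh_phi_40_1.
  - apply f_vanish_4a_8b, Fform_5_2.
  - apply f_vanish_4a, Fform_12_2.
  - apply f_vanish_4a, Fform_phi_8_2.
  - apply sh_vanish_4a, Fsh_phi_8_2.
  - replace 3 with (INR 3) by (simpl; ring). apply f_vanish_at, Fform_phi_20_2.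
  - replace 4 with (INR 4) by (simpl; ring). apply f_vanish_at, Fform_phi_33_2.
  - replace (49 / 4) with (INR 49 / 4) by (rewrite INR_IZR_INZ; simpl; field).
    apply sh_vanish_at, Fsh_phi_33_2.
  - apply f_vanish_2_4a, Fform_4_3.
  - apply f_vanish_intro. intros n [a E]. apply INR_eq in E. rewrite E. apply Fform_phi_24_3.
  - apply sh_vanish_intro. intros n [a E]. apply INR_div4_eq in E. rewrite E. apply Fsh_phi_24_3.
Qed.
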